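(* Let $A$ be a real isotropic $d\times d$ dilation matrix, let $m\ge1$, let $\phi^m$ be the corresponding elliptic scaling function of order $m$, and let $\mathcal{B}:=\sup_{\xi\in\mathbb{R}^d}\mu(\xi)$. If $$\mathcal{B}<|\det A|^{\frac{2}{d}-\frac{1}{2m}},$$ then $\phi^m\in L^2(\mathbb{R}^d)$ and the integer shifts $\{\phi^m(\cdot-k):k\in\mathbb{Z}^d\}$ form a Riesz basis (of their closed linear span in $L^2(\mathbb{R}^d)$).
   Context: A real isotropic dilation matrix is a $d\times d$ matrix $A$ with integer entries, all of whose eigenvalues are greater than $1$ in absolute value, which is diagonalizable over $\mathbb{C}$ and all of whose eigenvalues have equal absolute value. Put $q:=|\det A|$ and $A^{-T}:=(A^T)^{-1}$. One can factor $A^{-T}=q^{-1/d}Q^{-1}UQ$ with $U$ real orthogonal and $Q$ real symmetric positive definite; fix such a $Q$ and write $Q^2=(q_{ij})_{1\le i,j\le d}$. Define $$P(\xi):=\xi^TQ^2\xi=\sum_{i} q_{ii}\xi_i^2+2\sum_{i<j}q_{ij}\xi_i\xi_j,\qquad G(\xi):=4\sum_{i} q_{ii}\sin^2\frac{\xi_i}{2}+2\sum_{i<j}q_{ij}\sin\xi_i\sin\xi_j .$$ Let $S(A^T):=\{s\in[0,1)^d: A^Ts\in\mathbb{Z}^d\}$ (this set has $q$ elements and contains $0$), and define the mask $$m_0(\xi):=\prod_{s\in S(A^T)\setminus\{0\}}\frac{G(\xi+2\pi s)}{G(2\pi s)}.$$ Define $$\mu(\xi):=\frac{q^{2/d}\,m_0(A^{-T}\xi)\,G(A^{-T}\xi)}{G(\xi)},$$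 where at the points of $2\pi\mathbb{Z}^d$ (zeros of $G$) the value is understood as the limit, and $M(\xi):=\prod_{j=0}^\infty\mu\bigl((A^{-T})^j\xi\bigr)$. The elliptic scaling function $\phi$ is the tempered distribution with $\hat\phi(\xi)=\prod_{j=1}^\infty m_0((A^{-T})^j\xi)=\frac{G(\xi)}{P(\xi)}M(\xi)$ (with $G/P:=1$ at $\xi=0$); it is compactly supported. The elliptic scaling function of order $m$ is $\phi^1:=\phi$, $\phi^m:=\phi*\phi^{m-1}$, i.e. $\hat\phi^m(\xi)=(\hat\phi(\xi))^m$. The Fourier transform is $\hat f(\xi)=\int_{\mathbb{R}^d} f(x)e^{-i\xi\cdot x}\,dx$. *)

(* Defs.v *)
From HB Require Import structures.
From mathcomp Require Import all_boot all_order all_algebra.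
From mathcomp Require Import complex.
From mathcomp Require Import all_classical all_reals all_analysis.

Set Implicit Arguments.
Unset Strict Implicit.
Unset Printing Implicit Defensive.

Import Order.TTheory GRing.Theory Num.Theory.
Import numFieldNormedType.Exports.

Local Open Scope classical_set_scope.
Local Open Scope ring_scope.
Local Open Scope complex_scope.

(* R^d is 'cV[R]_d, with the sigma-algebra generated by the coordinates (the
   Borel one) and the Lebesgue measure obtained by iterating products with the
   one-dimensional Lebesgue measure. *)

Definition colvec_display : measure_display.
Proof. exact: (measure_tuple_display default_measure_display). Qed.

Section colvec_measurable.
Context (R : realType) (n : nat).

Definition coord (i : 'I_n) (v : 'cV[R]_n) : R := v i ord0.

Let colvec_set0 : g_sigma_preimage coord set0.
Proof. exact: sigma_algebra0. Qed.

Let colvec_setC A : g_sigma_preimage coord A -> g_sigma_preimage coord (~` A).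
Proof. exact: sigma_algebraC. Qed.

Let colvec_bigcup (F : (set 'cV[R]_n)^nat) :
  (forall i, g_sigma_preimage coord (F i)) ->
  g_sigma_preimage coord (\bigcup_i (F i)).
Proof. exact: sigma_algebra_bigcup. Qed.

HB.instance Definition _ := @isMeasurable.Build colvec_display
  'cV[R]_n (g_sigma_preimage coord) colvec_set0 colvec_setC colvec_bigcup.

End colvec_measurable.

Section colvec_cons.
Context (R : realType).

Definition cons_cv n (p : measurableTypeR R * 'cV[R]_n) : 'cV[R]_n.+1 :=
  col_mx (p.1 : R)%:M p.2 : 'cV[R]_(1 + n).
Definition head_cv n (v : 'cV[R]_n.+1) : measurableTypeR R := v ord0 ord0.
Definition behead_cv n (v : 'cV[R]_n.+1) : 'cV[R]_n :=
  \col_i v (lift ord0 i) ord0.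

Lemma measurable_coord n (i : 'I_n) : measurable_fun setT (@coord R n i).
Proof.
move=> _ Y mY; rewrite setTI; apply: sub_sigma_algebra => /=.
rewrite -bigcup_seq/=; exists i => /=; first by rewrite mem_index_enum.
by exists Y => //; rewrite setTI.
Qed.

Lemma measurable_fun_coordP d (T : measurableType d) n (f : T -> 'cV[R]_n) :
  (forall i, measurable_fun setT (fun x => coord i (f x))) ->
  measurable_fun setT f.
Proof.
move=> mf.
suff : g_sigma_preimage (fun i => coord i \o f) `<=` measurable.
  rewrite g_sigma_preimage_comp => prefS _ A mA.
  by apply: prefS; exists A.
apply: smallest_sub; first exact: sigma_algebra_measurable.
rewrite -bigcup_seq => A [i _] [B mB <-]; exact: mf.
Qed.

Lemma coord_cons0 n (p : measurableTypeR R * 'cV[R]_n) :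
  coord ord0 (cons_cv p) = p.1.
Proof.
have -> : ord0 = lshift n (ord0 : 'I_1) by exact: val_inj.
apply: (etrans (col_mxEu (p.1 : R)%:M p.2 ord0 ord0)).
by rewrite mxE mulr1n.
Qed.

Lemma coord_consS n (p : measurableTypeR R * 'cV[R]_n) i :
  coord (lift ord0 i) (cons_cv p) = coord i p.2.
Proof.
have -> : lift ord0 i = rshift 1 i by exact: val_inj.
exact: (col_mxEd (p.1 : R)%:M p.2 i ord0).
Qed.

Lemma measurable_cons_cv n : measurable_fun setT (@cons_cv n).
Proof.
apply: measurable_fun_coordP => i; case: (unliftP ord0 i) => [j ->|->].
  under eq_fun do rewrite coord_consS.
  by apply: measurableT_comp; [exact: measurable_coord|exact: measurable_snd].
under eq_fun do rewrite coord_cons0.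
exact: measurable_fst.
Qed.

Lemma measurable_behead_cv n : measurable_fun setT (@behead_cv n).
Proof.
apply: measurable_fun_coordP => i.
rewrite (_ : (fun _ => _) = coord (lift ord0 i)); first exact: measurable_coord.
by apply/funext => v; rewrite /coord mxE.
Qed.

End colvec_cons.

Section lebesgue_cons.
Context (R : realType) (n : nat).
Variable mu : {sigma_finite_measure set 'cV[R]_n -> \bar R}.

Definition lebesgue_cons : set 'cV[R]_n.+1 -> \bar R :=
  pushforward (@lebesgue_measure R \x mu)%E (@cons_cv R n).

Let lebesgue_cons0 : lebesgue_cons set0 = 0%E.
Proof. by rewrite /lebesgue_cons /pushforward preimage_set0 measure0. Qed.

Let lebesgue_cons_ge0 A : (0 <= lebesgue_cons A)%E.
Proof. exact: (measure_ge0 (@lebesgue_measure R \x mu)%E). Qed.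

Let lebesgue_cons_sigma_additive : semi_sigma_additive lebesgue_cons.
Proof.
move=> F mF tF mUF; rewrite /lebesgue_cons /pushforward preimage_bigcup.
apply: measure_semi_sigma_additive.
- by move=> i; rewrite -[X in measurable X]setTI; exact: measurable_cons_cv.
- apply/trivIsetP => /= i j _ _ ij; rewrite -preimage_setI.
  by move/trivIsetP : tF => /(_ _ _ _ _ ij) ->//; rewrite preimage_set0.
- rewrite -preimage_bigcup -[X in measurable X]setTI.
  exact: measurable_cons_cv.
Qed.

HB.instance Definition _ := isMeasure.Build _ _ _ lebesgue_cons
  lebesgue_cons0 lebesgue_cons_ge0 lebesgue_cons_sigma_additive.

Let lebesgue_cons_sigma_finite : sigma_finite setT lebesgue_cons.
Proof.
have /sigma_finiteP[F [TF ndF Foo]] := sigma_finiteT (@lebesgue_measure R).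
have /sigma_finiteP[G [TG ndG Goo]] := sigma_finiteT mu.
pose g (v : 'cV[R]_n.+1) : measurableTypeR R * 'cV[R]_n :=
  (head_cv v, behead_cv v).
have mg : measurable_fun setT g.
  apply: measurable_fun_pair; last exact: measurable_behead_cv.
  exact: measurable_coord.
have gK p : g (cons_cv p) = p.
  case: p => x v; congr pair; first exact: (coord_cons0 (x, v)).
  apply/matrixP => i j; rewrite mxE (ord1 j).
  exact: (coord_consS (x, v)).
exists (fun k => g @^-1` (F k `*` G k)).
  apply/esym; rewrite -subTset => v _.
  have : [set: measurableTypeR R] (g v).1 by [].
  have : [set: 'cV[R]_n] (g v).2 by [].
  rewrite TF TG => -[k _ Gk] [l _ Fl]; exists (maxn l k) => //; split.
    by move: (_).1 Fl; exact/subsetPset/ndF/leq_maxl.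
  by move: (_).2 Gk; exact/subsetPset/ndG/leq_maxr.
move=> k; have [mFk Fk] := Foo k; have [mGk Gk] := Goo k; split.
  by rewrite -[X in measurable X]setTI; apply: mg => //; exact: measurableX.
rewrite /lebesgue_cons /pushforward -comp_preimage.
rewrite (_ : g \o _ = id) ?preimage_id; last by apply/funext => p; exact: gK.
by rewrite product_measure1E// lte_mul_pinfty// ge0_fin_numE.
Qed.

HB.instance Definition _ := Measure_isSigmaFinite.Build _ _ _ lebesgue_cons
  lebesgue_cons_sigma_finite.

End lebesgue_cons.

Fixpoint lebesgue (R : realType) (n : nat) :
    {sigma_finite_measure set 'cV[R]_n -> \bar R} :=
  match n with
  | 0 => \d_(0 : 'cV[R]_0)
  | n'.+1 => lebesgue_cons (lebesgue R n')
  end.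

Section complex_integration.
Context (R : realType) (d : nat).
Implicit Types f g : 'cV[R]_d -> R[i].

Definition normc (z : R[i]) : R := ComplexField.Normc.normc z.

Definition measurableC f : Prop :=
  measurable_fun setT (fun x => complex.Re (f x)) /\
  measurable_fun setT (fun x => complex.Im (f x)).

Definition integralC f : R[i] :=
  (\int[lebesgue R d]_x complex.Re (f x)) +i*
  (\int[lebesgue R d]_x complex.Im (f x)).

Definition sqnormL2 f : \bar R :=
  (\int[lebesgue R d]_x ((normc (f x)) ^+ 2)%:E)%E.

Definition L2 f : Prop := measurableC f /\ (sqnormL2 f < +oo)%E.

End complex_integration.

Section riesz_basis.
Context (R : realType) (d : nat) (K : choiceType).
Implicit Types (e : K -> 'cV[R]_d -> R[i]) (V : set ('cV[R]_d -> R[i])).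

Definition lincomb e (s : seq K) (c : K -> R[i]) : 'cV[R]_d -> R[i] :=
  fun x => \sum_(k <- s) c k * e k x.

(* The closure is taken for the L^2 norm, whose square is sqnormL2. *)
Definition closed_span e : set ('cV[R]_d -> R[i]) :=
  [set h | L2 h /\ forall eps : R, 0 < eps -> exists s c,
     (sqnormL2 (fun x => h x - lincomb e s c x)%R < eps%:E)%E].

(* A Riesz basis of the closed subspace V of L^2: a complete system in V
   satisfying the two-sided l^2 estimate, which is required of finitely
   supported coefficient families; s lists the support without repetition.
   Elements of V are functions, not classes; closed_span is stable under a.e.
   equality. *)
Definition riesz_basis V e : Prop :=
  [/\ forall k, V (e k),
      V = closed_span e
    & exists a b : R, [/\ 0 < a, 0 < b
      & forall (s : seq K) (c : K -> R[i]), uniq s ->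
          ((a * \sum_(k <- s) normc (c k) ^+ 2)%R%:E
             <= sqnormL2 (lincomb e s c))%E /\
          (sqnormL2 (lincomb e s c)
             <= (b * \sum_(k <- s) normc (c k) ^+ 2)%R%:E)%E]].

End riesz_basis.

Section tempered_distributions.
Context (R : realType) (d : nat).
Implicit Types (f g h : 'cV[R]_d -> R[i]) (x xi : 'cV[R]_d).

Definition basis_cv (i : 'I_d) : 'cV[R]_d := delta_mx i ord0.

Definition dpartial (i : 'I_d) g : 'cV[R]_d -> R[i] := fun x =>
  'D_(basis_cv i) (fun y => complex.Re (g y)) x +i*
  'D_(basis_cv i) (fun y => complex.Im (g y)) x.

(* A multi-index is a sequence of coordinates. *)
Definition dmulti (beta : seq 'I_d) g : 'cV[R]_d -> R[i] :=
  foldr dpartial g beta.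

Definition monomial (alpha : seq 'I_d) x : R := \prod_(i <- alpha) x i ord0.

Definition smooth g : Prop :=
  forall (beta : seq 'I_d) (i : 'I_d) x,
    derivable (fun y => complex.Re (dmulti beta g y)) x (basis_cv i) /\
    derivable (fun y => complex.Im (dmulti beta g y)) x (basis_cv i).

(* Continuity of the partial derivatives is not listed: it follows from the
   bounds on those of the next order. *)
Definition schwartz g : Prop :=
  smooth g /\
  forall alpha beta : seq 'I_d, exists K : R, forall x,
    normc ((monomial alpha x)%:C * dmulti beta g x) <= K.

(* A functional of which only the values at Schwartz functions are constrained
   or used. *)
Definition generalized_function := ('cV[R]_d -> R[i]) -> R[i].

(* Continuity: T is bounded by a multiple of finitely many of the seminorms
   sup_x |x^alpha d^beta g(x)|; K stands for a bound on their maximum. *)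
Definition tempered (T : generalized_function) : Prop :=
  (forall (a : R[i]) g h, schwartz g -> schwartz h ->
     T (fun x => a * g x + h x) = a * T g + T h) /\
  exists (N : nat) (C : R), forall g, schwartz g -> forall K : R,
    (forall alpha beta : seq 'I_d, (size alpha <= N)%N -> (size beta <= N)%N ->
       forall x, normc ((monomial alpha x)%:C * dmulti beta g x) <= K) ->
    normc (T g) <= C * K.

Definition function_distribution f : generalized_function :=
  fun g => integralC (fun x => f x * g x).

Definition expi (t : R) : R[i] := cos t +i* sin t.

Definition dotv xi x : R := \sum_(i < d) xi i ord0 * x i ord0.

Definition fourier g : 'cV[R]_d -> R[i] :=
  fun xi => integralC (fun x => g x * expi (- dotv xi x)).

Definition fourier_distribution (T : generalized_function) :
    generalized_function :=
  fun g => T (fourier g).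

End tempered_distributions.

Section elliptic_scaling_functions.
Context (R : realType) (d : nat).

Definition real_mx n (A : 'M[int]_(d, n)) : 'M[R]_(d, n) :=
  map_mx (fun z : int => z%:~R) A.

Definition complex_mx (A : 'M[int]_d) : 'M[R[i]]_d :=
  map_mx (fun z : int => z%:~R) A.

Definition isotropic_dilation (A : 'M[int]_d) : Prop :=
  [/\ forall a : R[i], eigenvalue (complex_mx A) a -> 1 < `|a|,
      diagonalizable (complex_mx A)
    & forall a b : R[i], eigenvalue (complex_mx A) a ->
        eigenvalue (complex_mx A) b -> `|a| = `|b| ].

Definition absdet (A : 'M[int]_d) : R := `|\det A|%:~R.

(* A^{-T}, acting on column vectors *)
Definition invT (A : 'M[int]_d) : 'M[R]_d := invmx (real_mx A)^T.

Definition isotropy_factor (A : 'M[int]_d) (Q : 'M[R]_d) : Prop :=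
  [/\ Q^T = Q,
      forall x : 'cV[R]_d, x != 0 -> 0 < (x^T *m Q *m x) ord0 ord0
    & exists U : 'M[R]_d, U *m U^T = 1%:M /\
        invT A = (absdet A `^ (- (d%:R^-1))) *: (invmx Q *m U *m Q)].

Definition G (Q : 'M[R]_d) (xi : 'cV[R]_d) : R :=
  let q := Q *m Q in
  4 * (\sum_(i < d) q i i * sin (xi i ord0 / 2) ^+ 2) +
  2 * (\sum_(i < d) \sum_(j < d | (i < j)%N)
         q i j * sin (xi i ord0) * sin (xi j ord0)).

(* The set S(A^T). *)
Definition digits (A : 'M[int]_d) : set 'cV[R]_d :=
  [set s : 'cV[R]_d | (forall i, 0 <= s i ord0 < 1) /\
           exists k : 'cV[int]_d, (real_mx A)^T *m s = real_mx k].

(* The product is over a finite set, as \big[_/_]_(_ \in _) requires: there are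
   |det A| digits, 0 included. *)
Definition m0 (A : 'M[int]_d) (Q : 'M[R]_d) (xi : 'cV[R]_d) : R :=
  \big[*%R/1]_(s \in digits A `\ 0)
     (G Q (xi + (2 * pi) *: s) / G Q ((2 * pi) *: s)).

Definition mu_quotient (A : 'M[int]_d) (Q : 'M[R]_d) (xi : 'cV[R]_d) : R :=
  absdet A `^ (2 / d%:R) * m0 A Q (invT A *m xi) * G Q (invT A *m xi) / G Q xi.

(* The zeros of G, where mu is defined by its limit. *)
Definition two_pi_lattice : set 'cV[R]_d :=
  [set xi : 'cV[R]_d | exists k : 'cV[int]_d, xi = (2 * pi) *: real_mx k].

Definition mu (A : 'M[int]_d) (Q : 'M[R]_d) (xi : 'cV[R]_d) : R :=
  if `[< two_pi_lattice xi >] then lim (mu_quotient A Q eta @[eta --> xi^'])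
  else mu_quotient A Q xi.

Definition phi_hat (A : 'M[int]_d) (Q : 'M[R]_d) (xi : 'cV[R]_d) : R :=
  lim ((\prod_(1 <= j < n.+1) m0 A Q ((invT A) ^+ j *m xi)) @[n --> \oo]).

(* T is the elliptic scaling function phi^m of order m: the tempered distribution
   whose Fourier transform, given by duality, is the function phi_hat ^ m. *)
Definition elliptic_scaling_function (A : 'M[int]_d) (Q : 'M[R]_d) (m : nat)
    (T : generalized_function R d) : Prop :=
  tempered T /\
  forall g, schwartz g -> fourier_distribution T g =
    function_distribution (fun xi => (phi_hat A Q xi ^+ m)%:C) g.

Definition integer_shifts (f : 'cV[R]_d -> R[i]) (k : 'cV[int]_d) :
    'cV[R]_d -> R[i] :=
  fun x => f (x - real_mx k).

End elliptic_scaling_functions.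

(* Main.v *)
Require Import Defs.
From mathcomp Require Import all_boot all_order all_algebra.
From mathcomp Require Import complex.
From mathcomp Require Import all_classical all_reals all_analysis.
From mathcomp Require Import measurable_realfun.
From mathcomp Require Import ring lra.

Import Order.TTheory GRing.Theory Num.Theory.
Import numFieldNormedType.Exports.

Set Implicit Arguments.
Unset Strict Implicit.
Unset Printing Implicit Defensive.

Local Open Scope classical_set_scope.
Local Open Scope ring_scope.

(** Write [T] for the inverse transpose of [A], [q] for the absolute value of
    [det A] and [h] for [phi_hat ^+ m]. The function [phi^m] is the inverse
    Fourier transform of [h], and the squared norm of a combination of its integer
    translates with coefficients [w] is, up to the factor [(2 pi)^d], the integral
    of [h^2] against the squared modulus of the trigonometric polynomial with
    coefficients [w]. Over a cube of side [2 pi L] centered at the origin the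
    squared modulus alone integrates to [(2 pi L)^d] times the sum of the
    [|w k|^2]. Hence two properties of [h] give the Riesz bounds
    ([riesz_inverse_transform]):
    - [h] is bounded below on the cube [|x i| <= pi];
    - [h^2] is dominated pointwise by a family of multiples of indicator functions
      of cubes, the integrals of which form a convergent geometric series.

    The second one is where the bound on the supremum [B] of [mu] enters. Put
    [r = q^(-1/d)]; in the norm [nu x = |Q x|] the matrix [T] is [r] times an
    isometry. The bound on [mu] says that [m0 (T y) G (T y) <= r^2 B G y], at the
    points of the lattice as well since both sides vanish there
    ([numerator_bound]), and it telescopes along orbits: the product of the
    [m0 (T^j x)] for [1 <= j <= n], times [G (T^n x)], is at most [b^n G x], where
    [b = r^2 B < q^(-1/(2 m))]. If [n] is the first time at which the orbit of [x]
    enters a given small ball and [n >= 1], then [T^n x] lies in an annulus around the origin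
    where [G] is bounded below, so that [phi_hat x <= D b^n], while [x] belongs to
    a cube of side comparable to [r^(-n)], of volume comparable to [q^n]
    ([phi_decay], [phi_hat_decay]). The series is geometric of ratio
    [b^(2 m) q < 1].

    For the first property, [m0 (T x)] vanishes only on the lattice of periods,
    whose only point in the cube is the origin, where [m0] is [1]; so [phi_hat],
    which is continuous, is positive on that compact cube ([phi_hat_gt0],
    [positive_min]).

    The Fourier analysis rests on the formula of Plancherel for the cosine and sine
    transforms of continuous bounded integrable functions ([plancherel],
    [plancherel_cross]), proved by damping with [exp (- e (|x 1| + ... + |x d|))],
    whose transform is a product of Poisson kernels. It is extended to [h] by a
    sequence of truncations whose transforms converge almost everywhere
    ([L2_inversion], [L2_inverse_transform]). *)

(** * Lebesgue measure on column vectors *)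

Section euclidean_measure.
Context (R : realType).

(** An open set of [R^d] is a countable union of boxes with rational centers. *)
Lemma open_measurable_cv d (U : set 'cV[R]_d) : open U -> measurable U.
Proof.
move=> oU.
pose box (p : 'cV[rat]_d * nat) : set 'cV[R]_d :=
  \bigcap_(i in [set: 'I_d]) (Defs.coord i @^-1` ball (ratr (p.1 i ord0) : R) p.2.+1%:R^-1).
have -> : U = \bigcup_(p in [set p | box p `<=` U]) box p.
  apply/seteqP; split => [x Ux|x [p /= pU px]]; last exact: pU.
  have /nbhs_ballP[e /= e0 xe] : nbhs x U by exact: open_nbhs_nbhs.
  have [n ne] : exists n : nat, n.+1%:R^-1 < e / 2.
    have := near_infty_natSinv_lt (PosNum (divr_gt0 e0 (ltr0n R 2))).
    by move=> /filter_ex [n nP]; exists n.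
  have h i : exists r : rat, `|x i ord0 - ratr r| < n.+1%:R^-1.
    have : x i ord0 - n.+1%:R^-1 < x i ord0 + n.+1%:R^-1 :> R.
      by rewrite ltrBlDr -addrA ltrDl addr_gt0.
    move=> /rat_in_itvoo[r]; rewrite in_itv/= => /andP[r1 r2].
    by exists r; rewrite ltr_distlC r1.
  have [c cP] := choice h.
  exists (\col_i c i, n); rewrite /box/=.
    move=> y yb; apply: xe; split => // i j; rewrite (ord1 j) /ball /=.
    have := yb i I; rewrite /= /ball/= mxE => yi.
    rewrite (splitr e) -(subrK (ratr (c i)) (x i ord0)) -addrA.
    by rewrite (le_lt_trans (ler_normD _ _))// ltrD// (lt_trans _ ne).
  by move=> i _; rewrite /= mxE /ball/= distrC; exact: cP.
have -> : \bigcup_(p in [set p | box p `<=` U]) box p =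
    \bigcup_p (if `[< box p `<=` U >] then box p else set0).
  apply/seteqP; split => x [p /= pU px]; exists p => //.
    by case: asboolP.
  - by case: asboolP px.
  - by case: asboolP px.
apply: countable_bigcupT_measurable => [|p]; first exact: countableP.
case: asboolP => // _.
apply: fin_bigcap_measurable => // i _.
rewrite -[X in measurable X]setTI; apply: measurable_coord => //.
exact: measurable_realfun.measurable_ball.
Qed.

Lemma continuous_measurable_cv d (f : 'cV[R]_d -> R) :
  continuous f -> measurable_fun setT f.
Proof.
move=> /continuousP cf; apply: (measurability _ (RGenOpens.measurableE R)).
move=> _ [_ [a [b ->] <-]]; rewrite setTI.
by apply: open_measurable_cv; apply: cf; exact: interval_open.
Qed.

Section cons.
Context (d : nat).
Local Open Scope ereal_scope.

Lemma tonelli_cons (f : 'cV[R]_d.+1 -> \bar R) :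
  measurable_fun setT f -> (forall x, 0 <= f x) ->
  \int[lebesgue R d.+1]_x f x =
  \int[@lebesgue_measure R]_x \int[lebesgue R d]_v f (cons_cv (x, v)).
Proof.
move=> mf f0.
transitivity (\int[pushforward (@lebesgue_measure R \x lebesgue R d) (@cons_cv R d)]_x f x).
  by [].
rewrite ge0_integral_pushforward//; last exact: measurable_cons_cv.
rewrite preimage_setT fubini_tonelli1//=.
apply: measurableT_comp => //; exact: measurable_cons_cv.
Qed.

Lemma integrable_cons (f : 'cV[R]_d.+1 -> \bar R) :
  (lebesgue R d.+1).-integrable setT f ->
  (@lebesgue_measure R \x lebesgue R d).-integrable setT (fun p => f (cons_cv p)).
Proof.
move=> /integrableP[mf fi]; apply/integrableP; split.
  by apply: measurableT_comp => //; exact: measurable_cons_cv.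
move: fi; rewrite tonelli_cons//; last exact: measurableT_comp.
rewrite fubini_tonelli1//=; apply: measurableT_comp => //.
by apply: measurableT_comp => //; exact: measurable_cons_cv.
Qed.

Lemma fubini_cons (f : 'cV[R]_d.+1 -> \bar R) :
  (lebesgue R d.+1).-integrable setT f ->
  \int[lebesgue R d.+1]_x f x =
  \int[@lebesgue_measure R]_x \int[lebesgue R d]_v f (cons_cv (x, v)).
Proof.
move=> fi; have := integrable_cons fi => fi'.
rewrite (integral12_prod_meas1 fi').
transitivity (\int[pushforward (@lebesgue_measure R \x lebesgue R d) (@cons_cv R d)]_x f x).
  by [].
rewrite integral_pushforward ?preimage_setT//; first exact: measurable_cons_cv.
exact: measurable_int fi.
Qed.

End cons.

Lemma measurable_affine (a e : R) :
  measurable_fun setT (fun s : measurableTypeR R => a + e * s : measurableTypeR R).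
Proof.
apply: continuous_measurable_fun => x; apply: cvgD; first exact: cvg_cst.
by apply: cvgM; [exact: cvg_cst|exact: cvg_id].
Qed.

(** The right-hand side is a measure in [A] that agrees with Lebesgue measure on
    half-open intervals. The scale [e] may be negative, for the sake of reflections. *)
Lemma lebesgue_measure_affine (a e : R) : e != 0 ->
  forall A, measurable A ->
  (lebesgue_measure A =
   `|e|%:E * lebesgue_measure ((fun s : R => (a + e * s)%R) @^-1` A))%E.
Proof.
move=> e0.
pose m_ : {measure set (measurableTypeR R) -> \bar R} :=
  mscale (NngNum (normr_ge0 e))
    (pushforward (@lebesgue_measure R) (fun s : measurableTypeR R => a + e * s : measurableTypeR R)).
pose m := m_ (measurable_affine a e).
suff H X : ocitv X -> lebesgue_measure X = m X.
  by move=> A mA; exact: (lebesgue_measure_unique H mA).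
move=> [[x y] _ <-]/=.
rewrite /m /m_ /mscale/= /pushforward/=.
have [xy|yx] := ltP x y; last first.
  by rewrite !set_itv_ge ?preimage_set0 ?measure0 ?mule0//= bnd_simp -leNgt.
have [ep|en] := ltP 0 e.
  have -> : (fun s : R => a + e * s) @^-1` `]x, y]%classic =
      `]((x - a) / e), ((y - a) / e)]%classic.
    apply/seteqP; split => s /=; rewrite !in_itv/= ltr_pdivrMr// ler_pdivlMr//;
      by rewrite ltrBlDl lerBrDl mulrC.
  rewrite !lebesgue_measure_itv/= !lte_fin xy ltr_pM2r ?invr_gt0// ltrD2r xy.
  rewrite gtr0_norm// -!EFinD -EFinM; congr EFin; field; exact: e0.
have {}en : e < 0 by rewrite lt_neqAle e0.
have -> : (fun s : R => a + e * s) @^-1` `]x, y]%classic =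
    `[((y - a) / e), ((x - a) / e)[%classic.
  apply/seteqP; split => s /=; rewrite !in_itv/= ltr_ndivlMr// ler_ndivrMr//;
    by rewrite ltrBlDl lerBrDl mulrC andbC.
rewrite !lebesgue_measure_itv/= !lte_fin xy ltr_nM2r ?invr_lt0// ltrD2r xy.
rewrite ltr0_norm// -!EFinD -EFinM; congr EFin; field; exact: e0.
Qed.

Section ge0_affine.
Local Open Scope ereal_scope.

Lemma ge0_integral_affine (a e : R) (f : R -> \bar R) : e != 0%R ->
  measurable_fun setT f -> (forall x, 0 <= f x) ->
  `|e|%:E * \int[@lebesgue_measure R]_s f (a + e * s)%R =
  \int[@lebesgue_measure R]_x f x.
Proof.
move=> e0 mf f0.
pose m_ : {measure set (measurableTypeR R) -> \bar R} :=
  pushforward (@lebesgue_measure R) (fun s : measurableTypeR R => (a + e * s)%R : measurableTypeR R).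
pose m := m_ (measurable_affine a e).
transitivity (\int[mscale (NngNum (normr_ge0 e)) m]_x f x); last first.
  apply: eq_measure_integral => A mA _.
  exact: esym (lebesgue_measure_affine a e0 mA).
rewrite ge0_integral_mscale//=; congr (_ * _).
rewrite ge0_integral_pushforward// ?preimage_setT//.
exact: measurable_affine.
Qed.

(** One coordinate is changed at a time, by Tonelli's theorem. *)
Lemma ge0_integral_affine_cv d (a : 'cV[R]_d) (e : R) (f : 'cV[R]_d -> \bar R) :
  e != 0%R -> measurable_fun setT f -> (forall x, 0 <= f x) ->
  (`|e| ^+ d)%:E * \int[lebesgue R d]_s f (a + e *: s)%R =
  \int[lebesgue R d]_x f x.
Proof.
move=> e0; elim: d => [|d IH] in a f *.
  move=> mf f0; rewrite expr0 mul1e; apply: eq_integral => x _; congr f.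
  by apply/matrixP => -[].
move=> mf f0; rewrite !tonelli_cons//; last first.
  apply: measurableT_comp => //; apply: measurable_fun_coordP => i.
  rewrite [X in measurable_fun _ X](_ : _ = fun x => (Defs.coord i a + e * Defs.coord i x)%R); last first.
    by apply/funext => x; rewrite /Defs.coord !mxE.
  apply: (measurableT_comp (measurable_affine _ _)); exact: measurable_coord.
have mF : measurable_fun setT (fun p => f (cons_cv p)).
  by apply: measurableT_comp => //; exact: measurable_cons_cv.
have mG : measurable_fun setT (fun x => \int[lebesgue R d]_v f (cons_cv (x, v))).
  exact: (measurable_fun_fubini_tonelli_F (fun p => f (cons_cv p))).
have cE s v : (a + e *: cons_cv (s, v))%R =
    cons_cv ((Defs.coord ord0 a + e * s)%R, (behead_cv a + e *: v)%R).
  apply/matrixP => i j; rewrite (ord1 j) 2!mxE.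
  rewrite -!/(Defs.coord _ _); case: (unliftP ord0 i) => [k ->|->].
    by rewrite !coord_consS /Defs.coord !mxE.
  by rewrite !coord_cons0.
pose F x := \int[lebesgue R d]_v f (cons_cv (x, v)).
have F0 x : 0 <= F x by exact: integral_ge0.
apply: (etrans _ (@ge0_integral_affine (Defs.coord ord0 a) e F e0 mG F0)).
rewrite exprS EFinM -muleA; congr (_ * _).
rewrite -ge0_integralZl//.
- apply: eq_integral => s _; rewrite /F.
  rewrite -(IH (behead_cv a) (fun v => f (cons_cv ((Defs.coord ord0 a + e * s)%R, v))))//; last first.
    exact: (measurableT_comp mF (pair1_measurable ((Defs.coord ord0 a + e * s)%R : measurableTypeR R))).
  by congr (_ * _); apply: eq_integral => v _; rewrite cE.
- have mH : measurable_fun setT (fun p : measurableTypeR R * 'cV[R]_d =>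
      f (cons_cv (p.1, (behead_cv a + e *: p.2)%R))).
    apply: measurableT_comp => //; apply: measurable_fun_coordP => i.
    case: (unliftP ord0 i) => [k ->|->].
      under eq_fun do rewrite coord_consS /= /Defs.coord !mxE.
      apply: (measurableT_comp (measurable_affine _ _)).
      by apply: (measurableT_comp (measurable_coord k)); exact: measurable_snd.
    by under eq_fun do rewrite coord_cons0 /=; exact: measurable_fst.
  under eq_fun do under eq_integral do rewrite cE.
  have := measurable_fun_fubini_tonelli_F (m2 := lebesgue R d) _ mH (fun=> f0 _).
  move=> mK; exact: (measurableT_comp mK (measurable_affine (Defs.coord ord0 a) e)).
- by move=> x _; exact: integral_ge0.
Qed.

End ge0_affine.
End euclidean_measure.

(** * Integrals of real functions *)

Section real_integration.
Context dT (T : measurableType dT) (R : realType).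
Variable mu : {measure set T -> \bar R}.
Implicit Types f g k : T -> R.

Local Notation integ f := (mu.-integrable setT (EFin \o f)).

Lemma integ_le f g : measurable_fun setT f -> (forall x, `|f x| <= g x) ->
  integ g -> integ f.
Proof.
move=> mf fg; apply: le_integrable => //; first exact/measurable_EFinP.
by move=> x _ /=; rewrite lee_fin (le_trans (fg x)) ?ler_norm.
Qed.

Lemma integ_measurable f : integ f -> measurable_fun setT f.
Proof. by move=> /measurable_int/measurable_EFinP. Qed.

Lemma integ_mul f k (C : R) : integ f -> measurable_fun setT k ->
  (forall x, `|k x| <= C) -> integ (fun x => f x * k x).
Proof.
move=> fi mk kC; have mf := integ_measurable fi.
apply: (@integ_le _ (fun x => C * `|f x|)); first exact: measurable_funM.
  by move=> x; rewrite normrM mulrC ler_wpM2r.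
apply: (@integrableZl _ _ _ _ _ _ _ (EFin \o (fun x => `|f x|))) => //.
exact: integrable_norm.
Qed.

Lemma integD f g : integ f -> integ g -> integ (fun x => f x + g x).
Proof. by move=> fi gi; exact: (integrableD measurableT fi gi). Qed.

Lemma integB f g : integ f -> integ g -> integ (fun x => f x - g x).
Proof. by move=> fi gi; exact: (integrableB measurableT fi gi). Qed.

Lemma integZ (c : R) f : integ f -> integ (fun x => c * f x).
Proof. by move=> fi; exact: (integrableZl measurableT c fi). Qed.

Lemma integ_ge0P f : measurable_fun setT f -> (forall x, 0 <= f x) ->
  (\int[mu]_x (f x)%:E < +oo)%E -> integ f.
Proof.
move=> mf f0 fi; apply/integrableP; split; first exact/measurable_EFinP.
by under eq_integral do rewrite /= ger0_norm//.
Qed.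

Lemma EFin_Rintegral f : integ f ->
  (\int[mu]_x f x)%:E = (\int[mu]_x (f x)%:E)%E.
Proof. by move=> fi; rewrite /Rintegral fineK//; exact: integrable_fin_num. Qed.

Lemma Rintegral_dominated_convergence (f_ : nat -> T -> R) f g :
  (forall n, measurable_fun setT (f_ n)) -> measurable_fun setT f ->
  {ae mu, forall x, f_ n x @[n --> \oo] --> f x} ->
  integ g -> {ae mu, forall x n, `|f_ n x| <= g x} ->
  integ f /\ \int[mu]_x f_ n x @[n --> \oo] --> \int[mu]_x f x.
Proof.
move=> mf_ mf f_f ig f_g.
have [|||||fi _ cv] := @dominated_convergence _ _ _ mu _ measurableT
  (fun n x => (f_ n x)%:E) (EFin \o f) (EFin \o g).
- by move=> n; exact/measurable_EFinP.
- exact/measurable_EFinP.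
- by apply: filterS f_f => x h _; apply: cvg_comp h _; exact: cvg_refl.
- exact: ig.
- by apply: filterS f_g => x h n _; rewrite lee_fin.
split => //; apply: fine_cvg.
by rewrite (EFin_Rintegral fi).
Qed.

End real_integration.

Section bounded_kernel.
Context d1 d2 (T1 : measurableType d1) (T2 : measurableType d2) (R : realType).
Variables (m1 : {sigma_finite_measure set T1 -> \bar R}).
Variables (m2 : {sigma_finite_measure set T2 -> \bar R}).
Variables (k : T1 * T2 -> R) (C : R).
Hypotheses (mk : measurable_fun setT k) (kC : forall p, `|k p| <= C).
Variables (u : T1 -> R) (a : T2 -> R).
Hypotheses (ui : m1.-integrable setT (EFin \o u))
           (ai : m2.-integrable setT (EFin \o a)).

Lemma integrable_kernel :
  (m1 \x m2)%E.-integrable setT (fun p => (u p.1 * a p.2 * k p)%:E).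
Proof.
have mf : measurable_fun setT (fun p => (u p.1 * a p.2 * k p)).
  apply: measurable_funM => //; apply: measurable_funM.
    by apply: (measurableT_comp (integ_measurable ui)); exact: measurable_fst.
  by apply: (measurableT_comp (integ_measurable ai)); exact: measurable_snd.
have C0 : 0 <= C by apply: le_trans (kC (point, point)).
apply/(integrable12ltyP m1 m2); first exact/measurable_EFinP.
apply: (@le_lt_trans _ _ (\int[m1]_x ((C * `|u x|)%:E * \int[m2]_y `|(a y)%:E|))%E).
  apply: ge0_le_integral => //.
  - by move=> x _; exact: integral_ge0.
  - apply: (measurable_fun_fubini_tonelli_F (fun p => `|(u p.1 * a p.2 * k p)%:E|%E)) => //.
    by apply: measurableT_comp => //; exact/measurable_EFinP.
  - apply: emeasurable_funM => //; apply/measurable_EFinP.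
    apply: measurable_funM => //; apply: measurableT_comp => //.
    exact: integ_measurable ui.
  - move=> x _; rewrite -ge0_integralZl//; last 2 first.
    + apply: measurableT_comp => //; exact: measurable_int ai.
    + by rewrite lee_fin mulr_ge0.
    apply: ge0_le_integral => //.
    + apply: measurableT_comp => //; apply/measurable_EFinP.
      exact: (measurableT_comp mf (pair1_measurable x)).
    + apply: emeasurable_funM => //; apply: measurableT_comp => //; exact: measurable_int ai.
    + move=> y _; rewrite /= -EFinM lee_fin !normrM -(mulrA C) [leLHS]mulrC.
      by rewrite ler_wpM2r// mulr_ge0.
rewrite ge0_integralZr//; last 3 first.
- apply/measurable_EFinP; apply: measurable_funM => //.
  by apply: measurableT_comp => //; exact: integ_measurable ui.
- by move=> x _; rewrite lee_fin mulr_ge0.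
- exact: integral_ge0.
under eq_integral do rewrite EFinM.
rewrite ge0_integralZl//; last first.
  by apply/measurable_EFinP; apply: measurableT_comp => //; exact: integ_measurable ui.
have /integrableP[_ h1] := ui; have /integrableP[_ h2] := ai.
have U0 : (0 <= \int[m1]_x (`|u x|%:E))%E by exact: integral_ge0.
have Ci : (C%:E * \int[m1]_x (`|u x|%:E) < +oo)%E by apply: lte_mul_pinfty.
apply: lte_mul_pinfty => //; first exact: mule_ge0.
by rewrite ge0_fin_numE// mule_ge0.
Qed.

(** Fubini's theorem; with a trigonometric kernel this is the multiplication formula
    of Fourier analysis. *)
Lemma Rintegral_kernel_adjoint :
  \int[m1]_x (u x * \int[m2]_y (a y * k (x, y))) =
  \int[m2]_y (a y * \int[m1]_x (u x * k (x, y))).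
Proof.
have h1 x : (\int[m2]_y (u x * a y * k (x, y))%:E)%E =
    (u x * \int[m2]_y (a y * k (x, y)))%:E.
  have ik : m2.-integrable setT (EFin \o (fun y => a y * k (x, y))).
    apply: (integ_mul (C := C)) => //; exact: (measurableT_comp mk (pair1_measurable x)).
  rewrite -RintegralZl// EFin_Rintegral; last exact: integZ.
  by apply: eq_integral => y _; rewrite mulrA.
have h2 y : (\int[m1]_x (u x * a y * k (x, y))%:E)%E =
    (a y * \int[m1]_x (u x * k (x, y)))%:E.
  have ik : m1.-integrable setT (EFin \o (fun x => u x * k (x, y))).
    apply: (integ_mul (C := C)) => //; exact: (measurableT_comp mk (pair2_measurable y)).
  rewrite -RintegralZl// EFin_Rintegral; last exact: integZ.
  by apply: eq_integral => x _; rewrite mulrCA mulrA.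
rewrite /Rintegral; congr fine.
under eq_integral do rewrite -h1; under [RHS]eq_integral do rewrite -h2.
exact: (Fubini integrable_kernel).
Qed.

(** Adding [`|a y| * C] makes the integrand nonnegative, so that the measurability
    comes from Tonelli's theorem; the constant is subtracted afterwards. *)
Lemma measurable_kernel : measurable_fun setT (fun x => \int[m2]_y (a y * k (x, y))).
Proof.
have C0 : 0 <= C by apply: le_trans (kC (point, point)).
pose g x := (\int[m2]_y (`|a y| * C + a y * k (x, y))%:E)%E.
have ia : m2.-integrable setT (EFin \o (fun y => `|a y| * C)).
  by apply: (@integ_mul _ _ _ _ (fun y => `|a y|) (fun=> C) `|C|) => //; exact: integrable_norm.
have ik x : m2.-integrable setT (EFin \o (fun y => a y * k (x, y))).
  apply: (integ_mul (C := C)) => //; exact: (measurableT_comp mk (pair1_measurable x)).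
have -> : (fun x => \int[m2]_y (a y * k (x, y))) =
    (fun x => fine (g x) - \int[m2]_y (`|a y| * C)).
  apply/funext => x; rewrite -[fine _]/(\int[m2]_y (`|a y| * C + a y * k (x, y))).
  by rewrite RintegralD// addrC addKr.
apply: measurable_funB => //; apply: measurableT_comp => //.
apply: (measurable_fun_fubini_tonelli_F (fun p => (`|a p.2| * C + a p.2 * k p)%:E)).
  apply/measurable_EFinP; apply: measurable_funD; apply: measurable_funM => //.
    apply: measurableT_comp => //.
    by apply: (measurableT_comp (integ_measurable ai)); exact: measurable_snd.
  by apply: (measurableT_comp (integ_measurable ai)); exact: measurable_snd.
move=> p; rewrite lee_fin -lerBlDl sub0r.
have := lexx (`|a p.2| * `|k p|); rewrite -{1}normrM ler_norml => /andP[+ _].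
by apply: le_trans; rewrite lerN2 ler_wpM2l.
Qed.

Lemma kernel_bounded x : `|\int[m2]_y (a y * k (x, y))| <= C * \int[m2]_y `|a y|.
Proof.
have C0 : 0 <= C by apply: le_trans (kC (point, point)).
have ik : m2.-integrable setT (EFin \o (fun y => a y * k (x, y))).
  apply: (integ_mul (C := C)) => //; exact: (measurableT_comp mk (pair1_measurable x)).
apply: (le_trans (le_normr_Rintegral _ _)) => //.
rewrite -RintegralZl//; last exact: integrable_norm.
apply: le_Rintegral => //.
- exact: integrable_norm.
- by apply: integZ; exact: integrable_norm.
- by move=> y _; rewrite normrM mulrC ler_wpM2r.
Qed.

End bounded_kernel.

Section change_of_variable.
Context d1 d2 (T1 : measurableType d1) (T2 : measurableType d2) (R : realType).
Variables (m1 : {measure set T1 -> \bar R}) (m2 : {measure set T2 -> \bar R}).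
Variables (h : T1 -> T2) (c : R).
Hypotheses (mh : measurable_fun setT h) (c0 : 0 < c).
Hypothesis ge0_h : forall g : T2 -> \bar R, measurable_fun setT g ->
  (forall x, 0 <= g x)%E ->
  (c%:E * \int[m1]_x g (h x) = \int[m2]_x g x)%E.

(** An integrable function is the difference of the nonnegative functions
    [`|f x| + f x] and [`|f x|]. *)
Lemma Rintegral_change (f : T2 -> R) : m2.-integrable setT (EFin \o f) ->
  m1.-integrable setT (EFin \o (f \o h)) /\
  c * \int[m1]_x f (h x) = \int[m2]_x f x.
Proof.
have pos g : m2.-integrable setT (EFin \o g) -> (forall x, 0 <= g x) ->
    m1.-integrable setT (EFin \o (g \o h)) /\
    c * \int[m1]_x g (h x) = \int[m2]_x g x.
  move=> gi g0; have mg := integ_measurable gi.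
  have E : (c%:E * \int[m1]_x (g (h x))%:E = \int[m2]_x (g x)%:E)%E.
    apply: (ge0_h (g := EFin \o g)); first exact/measurable_EFinP.
    by move=> x; rewrite lee_fin.
  have ghi : m1.-integrable setT (EFin \o (g \o h)).
    apply: integ_ge0P => //=; first exact: measurableT_comp.
    have : (c%:E * \int[m1]_x (g (h x))%:E < +oo)%E.
      rewrite E; have /integrableP[_] := gi; apply: le_lt_trans.
      by apply: ge0_le_integral => //;
        [by move=> x _; rewrite lee_fin|exact/measurable_EFinP|apply: measurableT_comp => //; exact/measurable_EFinP|move=> x _ /=; rewrite lee_fin ler_norm].
    rewrite !ltey; apply: contra => /eqP ->.
    by rewrite gt0_muley ?lte_fin.
  split => //; apply: EFin_inj.
  by rewrite EFinM (EFin_Rintegral ghi) (EFin_Rintegral gi).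
move=> fi; have nfi : m2.-integrable setT (EFin \o (fun x => `|f x|)).
  exact: integrable_norm.
have [n1 n2] := pos _ nfi (fun x => normr_ge0 _).
have [|p1 p2] := pos (fun x => `|f x| + f x) (integD nfi fi).
  by move=> x; rewrite -lerBlDl sub0r lerNl -normrN ler_norm.
have fhi : m1.-integrable setT (EFin \o (f \o h)).
  have := integB p1 n1; apply: eq_integrable => // x _ /=.
  by rewrite addrC addKr.
split => //; move: p2; rewrite !RintegralD// mulrDr => p2.
by apply: (addrI (\int[m2]_x `|f x|)); rewrite -p2 -n2.
Qed.

End change_of_variable.

Section affine.
Context (R : realType).

Lemma measurable_affine_cv d (a : 'cV[R]_d) (e : R) :
  measurable_fun setT (fun s : 'cV[R]_d => a + e *: s).
Proof.
apply: measurable_fun_coordP => i.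
under eq_fun do rewrite /Defs.coord !mxE.
by apply: (measurableT_comp (measurable_affine _ _)); exact: measurable_coord.
Qed.

Lemma Rintegral_affine_cv d (a : 'cV[R]_d) (e : R) (f : 'cV[R]_d -> R) : e != 0 ->
  (lebesgue R d).-integrable setT (EFin \o f) ->
  (lebesgue R d).-integrable setT (EFin \o (fun s => f (a + e *: s))) /\
  `|e| ^+ d * \int[lebesgue R d]_s f (a + e *: s) = \int[lebesgue R d]_x f x.
Proof.
move=> e0 fi.
have c0 : 0 < `|e| ^+ d by rewrite exprn_gt0// normr_gt0.
have H g := @ge0_integral_affine_cv R d a e g e0.
exact: (Rintegral_change (measurable_affine_cv a e) c0 H fi).
Qed.

Lemma Rintegral_affine (a e : R) (f : R -> R) : e != 0 ->
  (@lebesgue_measure R).-integrable setT (EFin \o f) ->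
  (@lebesgue_measure R).-integrable setT (EFin \o (fun s => f (a + e * s))) /\
  `|e| * \int[@lebesgue_measure R]_s f (a + e * s) = \int[@lebesgue_measure R]_x f x.
Proof.
move=> e0 fi.
have c0 : 0 < `|e| by rewrite normr_gt0.
have H g := @ge0_integral_affine R a e g e0.
exact: (Rintegral_change (measurable_affine a e) c0 H fi).
Qed.

End affine.

(** * Weights on the line and their products *)

Section one_dimensional.
Context (R : realType).
Local Notation leb := (@lebesgue_measure R).
Local Notation integ1 f := (leb.-integrable setT (EFin \o f)).

Lemma Rintegral_odd (f : R -> R) : integ1 f -> (forall x, f (- x) = - f x) ->
  \int[leb]_x f x = 0.
Proof.
move=> fi fodd.
have n1 : -1 != 0 :> R by rewrite oppr_eq0 oner_neq0.
have [_] := Rintegral_affine 0 n1 fi.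
rewrite normrN1 mul1r.
under eq_Rintegral do rewrite add0r mulN1r fodd -mulN1r.
rewrite RintegralZl// mulN1r => /eqP; rewrite -subr_eq0 -opprD oppr_eq0.
by rewrite -mulr2n mulrn_eq0/= => /eqP.
Qed.

Lemma measurable_expNabs : measurable_fun setT (fun x : R => expR (- `|x|)).
Proof. by apply: measurableT_comp => //; apply: measurableT_comp. Qed.

(** The summand [1 + cos (t * x)] is nonnegative, so that the fundamental theorem
    of calculus on a half-line applies without prior knowledge of integrability. *)
Lemma integral_expNabs_cos (t : R) :
  (\int[leb]_x (expR (- `|x|) * (1 + cos (t * x)))%:E = (2 * (1 + (1 + t ^+ 2)^-1))%:E)%E.
Proof.
have t1 : 1 + t ^+ 2 != 0 by rewrite gt_eqF// ltr_wpDr ?sqr_ge0.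
pose f x := expR (- `|x|) * (1 + cos (t * x)).
pose g (x : R) := expR (- x) * (1 + cos (t * x)).
pose F (x : R) := expR (- x) * (- 1 + (- cos (t * x) + t * sin (t * x)) / (1 + t ^+ 2)).
have g0 x : 0 <= g x.
  by rewrite mulr_ge0 ?expR_ge0// addrC -lerBlDr sub0r cos_geN1.
have cg : continuous g.
  move=> x; apply: differentiable_continuous; apply/derivable1_diffP.
  exact: ex_derive.
have dF (x : R) : is_derive x 1 F (g x).
  rewrite /F; apply: is_derive_eq; rewrite /g /GRing.scale/=; field.
  exact: t1.
have eF : derive1 F = g by apply/funext => x; rewrite derive1E; apply: derive_val.
rewrite ge0_symfun_integralT; last 3 first.
- by move=> x; rewrite mulr_ge0 ?expR_ge0// addrC -lerBlDr sub0r cos_geN1.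
- move=> x; apply: cvgM.
    apply: continuous_comp; last exact: continuous_expR.
    by apply: continuousN; exact: norm_continuous.
  apply: cvgD; first exact: cvg_cst.
  apply: continuous_comp; last exact: continuous_cos.
  by apply: cvgM; [exact: cvg_cst|exact: cvg_id].
- by move=> x /=; rewrite normrN mulrN cosN.
rewrite EFinM; congr (_ * _)%E.
transitivity (\int[leb]_(x in `[0%R, +oo[) (g x)%:E)%E.
  rewrite set_itvcy; apply: eq_integral => x; rewrite inE/= => x0.
  by rewrite ger0_norm.
rewrite (@ge0_continuous_FTC2y _ g F 0 0) => //.
- rewrite /F oppr0 expR0 mulr0 cos0 sin0 mulr0 addr0 mul1r -EFinB; congr EFin.
  by rewrite sub0r opprD opprK mulNr opprK mul1r.
- exact: continuous_subspaceT.
- pose K := 1 + (1 + `|t|) / (1 + t ^+ 2).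
  have FK x : `|F x| <= K * expR (- x).
    rewrite normrM ger0_norm ?expR_ge0// mulrC ler_wpM2r ?expR_ge0//.
    rewrite (le_trans (ler_normD _ _))// normrN1 lerD2l normrM normfV.
    rewrite (@ger0_norm _ (1 + t ^+ 2)) ?addr_ge0 ?sqr_ge0//.
    rewrite ler_wpM2r ?invr_ge0 ?addr_ge0 ?sqr_ge0//.
    rewrite (le_trans (ler_normD _ _))// normrN lerD//.
      by rewrite ler_norml cos_geN1 cos_le1.
    by rewrite normrM ler_piMr// ler_norml sin_geN1 sin_le1.
  have K0 : K * expR (- x) @[x --> +oo%R] --> (0 : R).
    by rewrite -(mulr0 K); apply: cvgMr; exact: cvgr_expR.
  apply/norm_cvg0P; apply: (squeeze_cvgr _ (cvg_cst 0) K0).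
  by near=> x; rewrite normr_ge0 FK.
- by apply: cvg_at_right_filter; apply: differentiable_continuous; apply/derivable1_diffP; have ? := dF 0; exact: ex_derive.
- by move=> x _; rewrite eF.
Unshelve. all: by end_near. Qed.

End one_dimensional.

Section one_dimensional_weights.
Context (R : realType).
Local Notation leb := (@lebesgue_measure R).
Local Notation integ1 f := (leb.-integrable setT (EFin \o f)).

Lemma measurable_cosM (t : R) : measurable_fun setT (fun x : R => cos (t * x)).
Proof.
apply: measurableT_comp; last exact: mulrl_measurable.
exact: continuous_measurable_fun (@continuous_cos R).
Qed.

Lemma measurable_sinM (t : R) : measurable_fun setT (fun x : R => sin (t * x)).
Proof.
apply: measurableT_comp; last exact: mulrl_measurable.
exact: continuous_measurable_fun (@continuous_sin R).
Qed.

Lemma norm_cos_le1 (x : R) : `|cos x| <= 1.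
Proof. by rewrite ler_norml cos_geN1 cos_le1. Qed.

Lemma norm_sin_le1 (x : R) : `|sin x| <= 1.
Proof. by rewrite ler_norml sin_geN1 sin_le1. Qed.

Lemma integ1_expNabs : integ1 (fun x : R => expR (- `|x|)).
Proof.
apply: integ_ge0P; [exact: measurable_expNabs|by move=> x; exact: expR_ge0|].
have : (\int[leb]_x ((2%:E) * (expR (- `|x|))%:E) < +oo)%E.
  under eq_integral => x _.
    rewrite (_ : 2%:E * _ = (expR (- `|x|) * (1 + cos (0 * x)))%:E)%E; last first.
      by rewrite -EFinM mul0r cos0 mulrC -(natrD _ 1 1).
    over.
  by rewrite integral_expNabs_cos ltry.
rewrite ge0_integralZl//; last first.
  by apply/measurable_EFinP; exact: measurable_expNabs.
by rewrite !ltey; apply: contra => /eqP ->; rewrite gt0_muley ?lte_fin.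
Qed.

Lemma Rintegral_expNabs_cos (t : R) :
  \int[leb]_x (expR (- `|x|) * cos (t * x)) = 2 / (1 + t ^+ 2).
Proof.
have ie := integ1_expNabs.
have ic s : integ1 (fun x => expR (- `|x|) * cos (s * x)).
  by apply: (@integ_mul _ _ _ _ _ _ 1) => //;
    [exact: measurable_cosM|by move=> x; exact: norm_cos_le1].
have h s : \int[leb]_x expR (- `|x|) + \int[leb]_x (expR (- `|x|) * cos (s * x)) =
    2 * (1 + (1 + s ^+ 2)^-1).
  rewrite -RintegralD//; apply: EFin_inj; rewrite -integral_expNabs_cos.
  rewrite (EFin_Rintegral (integD ie (ic s))).
  by apply: eq_integral => x _; rewrite mulrDr mulr1.
have h1 : \int[leb]_x expR (- `|x|) = 2.
  have := h 0; under [X in _ + X]eq_Rintegral do rewrite mul0r cos0 mulr1.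
  rewrite expr0n/= addr0 invr1 => h0; lra.
by have := h t; rewrite h1 mulrDr mulr1 => /addrI.
Qed.

Lemma Rintegral_expNabs_sin (t : R) :
  \int[leb]_x (expR (- `|x|) * sin (t * x)) = 0.
Proof.
apply: Rintegral_odd; last by move=> x; rewrite normrN mulrN sinN mulrN.
by apply: (@integ_mul _ _ _ _ _ _ 1 integ1_expNabs) => //;
  [exact: measurable_sinM|by move=> x; exact: norm_sin_le1].
Qed.

(** The Fourier transform of [expR (- `|x|)]. *)
Definition poisson (x : R) : R := 2 / (1 + x ^+ 2).

Lemma poisson_ge0 x : 0 <= poisson x.
Proof. by rewrite divr_ge0// addr_ge0// sqr_ge0. Qed.

Lemma continuous_poisson : continuous poisson.
Proof.
move=> x; apply: cvgM; first exact: cvg_cst.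
exact: (@continuous_oneDsqrV R x).
Qed.

Lemma integral_poisson : (\int[leb]_x (poisson x)%:E = (2 * pi)%:E)%E.
Proof.
rewrite ge0_symfun_integralT; last 3 first.
- exact: poisson_ge0.
- exact: continuous_poisson.
- by move=> x /=; rewrite /poisson sqrrN.
rewrite -set_itvcy.
under eq_integral do rewrite EFinM.
rewrite ge0_integralZl//; last 2 first.
- apply/measurable_EFinP; apply: measurable_funTS; apply: continuous_measurable_fun.
  exact: (@continuous_oneDsqrV R).
- by move=> x _; rewrite lee_fin invr_ge0 addr_ge0// sqr_ge0.
rewrite (@integral0y_oneDsqr R) -!EFinM; congr EFin.
by rewrite mulrCA; congr (_ * _); rewrite mulrCA mulfV ?mulr1.
Qed.

Lemma integ1_poisson : integ1 poisson.
Proof.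
apply: integ_ge0P; [|exact: poisson_ge0|by rewrite integral_poisson ltry].
exact: continuous_measurable_fun continuous_poisson.
Qed.

Lemma Rintegral_poisson : \int[leb]_x poisson x = 2 * pi.
Proof. by rewrite /Rintegral integral_poisson. Qed.

(** The interval consists of [L] periods of the characters with integer frequencies,
    which are therefore orthogonal for this weight. *)
Definition periods (L : nat) (x : R) : R := \1_(`[- (pi * L%:R), pi * L%:R]%classic) x.

Lemma periods_ge0 L x : 0 <= periods L x.
Proof. by rewrite /periods indicE. Qed.

Lemma measurable_periods L : measurable_fun setT (periods L).
Proof. exact: measurable_indic. Qed.

Lemma integral_periods L : (\int[leb]_x (periods L x)%:E = (2 * pi * L%:R)%:E)%E.
Proof.
rewrite integral_indic// setIT /= lebesgue_measure_itv/= lte_fin.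
have p0 : 0 <= pi * L%:R :> R by rewrite mulr_ge0// ?pi_ge0.
have [->|Lneq0] := eqVneq L 0; first by rewrite !mulr0 oppr0 ltxx.
rewrite gtrN ?mulr_gt0 ?pi_gt0 ?ltr0n ?lt0n//.
by rewrite -EFinD; congr EFin; ring.
Qed.

Lemma integ1_periods L : integ1 (periods L).
Proof.
apply: integ_ge0P; [exact: measurable_periods|exact: periods_ge0|].
by rewrite integral_periods ltry.
Qed.

Lemma Rintegral_periods L : \int[leb]_x periods L x = 2 * pi * L%:R.
Proof. by rewrite /Rintegral integral_periods. Qed.

Lemma Rintegral_periods_sin L (t : R) :
  \int[leb]_x (periods L x * sin (t * x)) = 0.
Proof.
apply: Rintegral_odd; last first.
  move=> x; rewrite mulrN sinN mulrN; congr (- (_ * _)).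
  by rewrite /periods !indicE !mem_setE !in_itv/= lerN2 lerNl andbC.
by apply: (@integ_mul _ _ _ _ _ _ 1 (integ1_periods L)) => //;
  [exact: measurable_sinM|by move=> x; exact: norm_sin_le1].
Qed.

Lemma sin_natpi (n : nat) : sin (n%:R * pi) = 0 :> R.
Proof.
elim: n => [|n IH]; first by rewrite mul0r sin0.
by rewrite -addn1 natrD mulrDl mul1r sinDpi IH oppr0.
Qed.

Lemma sin_intpi (z : int) : sin (z%:~R * pi) = 0 :> R.
Proof.
case: z => n; first by rewrite -pmulrn sin_natpi.
by rewrite NegzE mulrNz mulNr sinN -pmulrn sin_natpi oppr0.
Qed.

Lemma Rintegral_periods_cos L (z : int) : z != 0 ->
  \int[leb]_x (periods L x * cos (z%:~R * x)) = 0.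
Proof.
move=> z0; have z0' : z%:~R != 0 :> R by rewrite intr_eq0.
transitivity (\int[leb]_(x in `[- (pi * L%:R), pi * L%:R]) cos (z%:~R * x)).
  rewrite [RHS]Rintegral_mkcond; apply: eq_Rintegral => x _.
  by rewrite /periods indicE patchE; case: ifP => _; rewrite ?mul1r ?mul0r.
have [->|Lneq0] := eqVneq L 0; first by rewrite mulr0 oppr0 set_itv1 Rintegral_set1.
have pL : 0 < pi * L%:R :> R by rewrite mulr_gt0 ?pi_gt0 ?ltr0n ?lt0n.
pose F (x : R) := sin (z%:~R * x) / z%:~R.
have dF (x : R) : is_derive x 1 F (cos (z%:~R * x)).
  rewrite /F; apply: is_derive_eq; rewrite /GRing.scale/=; field; exact: z0'.
have cF : continuous F.
  move=> x; have ? := dF x; apply: differentiable_continuous.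
  by apply/derivable1_diffP; exact: ex_derive.
rewrite /Rintegral (@continuous_FTC2 _ _ F).
- rewrite /F mulrN sinN.
  have -> : z%:~R * (pi * L%:R) = (z * L%:Z)%:~R * pi :> R.
    by rewrite intrM -pmulrn; ring.
  by rewrite sin_intpi oppr0 !mul0r sube0.
- by rewrite gtrN.
- apply: continuous_subspaceT => x; apply: continuous_comp; last exact: continuous_cos.
  by apply: cvgM; [exact: cvg_cst|exact: cvg_id].
- split.
  + by move=> x _; have ? := dF x; exact: ex_derive.
  + by apply: cvg_at_right_filter; exact: cF.
  + by apply: cvg_at_left_filter; exact: cF.
- move=> x _; rewrite derive1E; have ? := dF x; exact: derive_val.
Qed.

End one_dimensional_weights.

Section product_weights.
Context (R : realType).
Local Notation leb := (@lebesgue_measure R).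
Local Notation integ1 f := (leb.-integrable setT (EFin \o f)).
Local Notation integ d f := ((lebesgue R d).-integrable setT (EFin \o f)).

Definition pweight (w : R -> R) d (x : 'cV[R]_d) : R := \prod_(i < d) w (x i ord0).

Lemma cons_cvS d (x : R) (v : 'cV[R]_d) i : cons_cv (x, v) (lift ord0 i) ord0 = v i ord0.
Proof.
have := coord_consS ((x : measurableTypeR R), v) i.
by rewrite /Defs.coord.
Qed.

Lemma pweight_cons w d (x : R) (v : 'cV[R]_d) :
  pweight w (cons_cv (x, v)) = w x * pweight w v.
Proof.
rewrite /pweight big_ord_recl; congr (w _ * _); first exact: (coord_cons0 (x, v)).
by apply: eq_bigr => i _; rewrite cons_cvS.
Qed.

Lemma dotv_cons d (t : 'cV[R]_d.+1) (x : R) (v : 'cV[R]_d) :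
  dotv t (cons_cv (x, v)) = t ord0 ord0 * x + dotv (behead_cv t) v.
Proof.
rewrite /dotv big_ord_recl; congr (_ * _ + _); first exact: (coord_cons0 (x, v)).
by apply: eq_bigr => i _; rewrite cons_cvS mxE.
Qed.

Lemma measurable_pweight w d : measurable_fun setT w -> measurable_fun setT (@pweight w d).
Proof.
move=> mw; apply: measurable_prod => i _; apply: (measurableT_comp mw).
exact: measurable_coord.
Qed.

Lemma pweight_ge0 w d (x : 'cV[R]_d) : (forall x, 0 <= w x) -> 0 <= pweight w x.
Proof. by move=> w0; apply: prodr_ge0. Qed.

Lemma lebesgue0E (f : 'cV[R]_0 -> \bar R) : (\int[lebesgue R 0]_x f x = f 0%R)%E.
Proof.
rewrite (eq_integral (cst (f 0%R))); last first.
  by move=> x _; congr (f _); apply/matrixP => -[].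
by rewrite integral_cst//= diracE mem_set// mule1.
Qed.

Lemma integral_pweight w d : (forall x, 0 <= w x) -> integ1 w ->
  (\int[lebesgue R d]_x (pweight w x)%:E = ((\int[leb]_x w x) ^+ d)%:E)%E.
Proof.
move=> w0 wi; have mw := integ_measurable wi; elim: d => [|d IH].
  by rewrite lebesgue0E /pweight big_ord0.
rewrite tonelli_cons; last 2 first.
- by apply/measurable_EFinP; exact: measurable_pweight.
- by move=> x; rewrite lee_fin pweight_ge0.
under eq_integral => x _.
  under eq_integral => v _ do rewrite pweight_cons EFinM.
  rewrite ge0_integralZl//; last 3 first.
  - by apply/measurable_EFinP; exact: measurable_pweight.
  - by move=> v _; rewrite lee_fin pweight_ge0.
  - by rewrite lee_fin.
  rewrite IH; over.
rewrite ge0_integralZr//; last 3 first.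
- exact/measurable_EFinP.
- by move=> x _; rewrite lee_fin.
- by rewrite lee_fin exprn_ge0// Rintegral_ge0.
by rewrite -(EFin_Rintegral wi) -EFinM exprS.
Qed.

Lemma integ_pweight w d : (forall x, 0 <= w x) -> integ1 w -> integ d (@pweight w d).
Proof.
move=> w0 wi; apply: integ_ge0P.
- by apply: measurable_pweight; exact: integ_measurable wi.
- by move=> x; exact: pweight_ge0.
- by rewrite integral_pweight// ltry.
Qed.

Lemma Rintegral_pweight w d : (forall x, 0 <= w x) -> integ1 w ->
  \int[lebesgue R d]_x pweight w x = (\int[leb]_x w x) ^+ d.
Proof. by move=> w0 wi; rewrite /Rintegral integral_pweight. Qed.

Lemma Rfubini_cons d (f : 'cV[R]_d.+1 -> R) : integ d.+1 f ->
  (forall x, integ d (fun v => f (cons_cv (x, v)))) ->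
  \int[lebesgue R d.+1]_x f x =
  \int[leb]_x \int[lebesgue R d]_v f (cons_cv (x, v)).
Proof.
move=> fi fiv; rewrite /Rintegral; congr fine; rewrite fubini_cons//.
by apply: eq_integral => x _; rewrite -(EFin_Rintegral (fiv x)).
Qed.

Lemma measurable_dotv d (t : 'cV[R]_d) : measurable_fun setT (dotv t).
Proof.
apply: measurable_sum => i; apply: measurable_funM => //.
exact: measurable_coord.
Qed.

Lemma integ_mul_cos d (t : 'cV[R]_d) f : integ d f -> integ d (fun x => f x * cos (dotv t x)).
Proof.
move=> fi; apply: (@integ_mul _ _ _ _ _ _ 1) => //; last by move=> x; exact: norm_cos_le1.
apply: measurableT_comp (measurable_dotv _).
exact: continuous_measurable_fun (@continuous_cos R).
Qed.

Lemma integ_mul_sin d (t : 'cV[R]_d) f : integ d f -> integ d (fun x => f x * sin (dotv t x)).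
Proof.
move=> fi; apply: (@integ_mul _ _ _ _ _ _ 1) => //; last by move=> x; exact: norm_sin_le1.
apply: measurableT_comp (measurable_dotv _).
exact: continuous_measurable_fun (@continuous_sin R).
Qed.

(** The addition formulas split off one coordinate at a time; the terms with a
    one-dimensional sine integral vanish. *)
Lemma Rintegral_pweight_trig w d (t : 'cV[R]_d) :
  (forall x, 0 <= w x) -> integ1 w ->
  (forall i, \int[leb]_x (w x * sin (t i ord0 * x)) = 0) ->
  \int[lebesgue R d]_x (pweight w x * cos (dotv t x)) =
    \prod_(i < d) \int[leb]_x (w x * cos (t i ord0 * x)) /\
  \int[lebesgue R d]_x (pweight w x * sin (dotv t x)) = 0.
Proof.
move=> w0 wi; elim: d t => [|d IH] t ts.
  by rewrite /Rintegral !lebesgue0E /=/pweight /dotv !big_ord0 cos0 sin0 mulr1 mulr0.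
have wpi := integ_pweight d w0 wi.
have [|IHc IHs] := IH (behead_cv t); first by move=> i; rewrite mxE.
have icos := integ_mul_cos (behead_cv t) wpi.
have isin := integ_mul_sin (behead_cv t) wpi.
have wc : integ1 (fun x => w x * cos (t ord0 ord0 * x)).
  by apply: (@integ_mul _ _ _ _ _ _ 1) => //;
    [exact: measurable_cosM|by move=> x; exact: norm_cos_le1].
have ws : integ1 (fun x => w x * sin (t ord0 ord0 * x)).
  by apply: (@integ_mul _ _ _ _ _ _ 1) => //;
    [exact: measurable_sinM|by move=> x; exact: norm_sin_le1].
have cE x v : pweight w (cons_cv (x, v)) * cos (dotv t (cons_cv (x, v))) =
    w x * cos (t ord0 ord0 * x) * (pweight w v * cos (dotv (behead_cv t) v)) -
    w x * sin (t ord0 ord0 * x) * (pweight w v * sin (dotv (behead_cv t) v)).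
  by rewrite pweight_cons dotv_cons cosD; ring.
have sE x v : pweight w (cons_cv (x, v)) * sin (dotv t (cons_cv (x, v))) =
    w x * sin (t ord0 ord0 * x) * (pweight w v * cos (dotv (behead_cv t) v)) +
    w x * cos (t ord0 ord0 * x) * (pweight w v * sin (dotv (behead_cv t) v)).
  by rewrite pweight_cons dotv_cons sinD; ring.
split.
- rewrite Rfubini_cons; last 2 first.
  + by apply: integ_mul_cos; exact: integ_pweight.
  + by move=> x; under eq_fun do rewrite /= cE; apply: integB; apply: integZ.
  transitivity (\int[leb]_x (w x * cos (t ord0 ord0 * x) *
      \int[lebesgue R d]_v (pweight w v * cos (dotv (behead_cv t) v)))).
    apply: eq_Rintegral => x _; under eq_Rintegral do rewrite cE.
    rewrite RintegralB//; [|exact: integZ|exact: integZ].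
    by rewrite !RintegralZl// IHs mulr0 subr0.
  rewrite RintegralZr// IHc big_ord_recl; congr (_ * _).
  by apply: eq_bigr => i _; under eq_Rintegral do rewrite mxE.
- rewrite Rfubini_cons; last 2 first.
  + by apply: integ_mul_sin; exact: integ_pweight.
  + by move=> x; under eq_fun do rewrite /= sE; apply: integD; apply: integZ.
  transitivity (\int[leb]_x (w x * sin (t ord0 ord0 * x) *
      \int[lebesgue R d]_v (pweight w v * cos (dotv (behead_cv t) v)))).
    apply: eq_Rintegral => x _; under eq_Rintegral do rewrite sE.
    rewrite RintegralD//; [|exact: integZ|exact: integZ].
    by rewrite !RintegralZl// IHs mulr0 addr0.
  by rewrite RintegralZr// ts mul0r.
Qed.

End product_weights.

(** * Cosine and sine transforms *)

Section fourier.
Context (R : realType) (d : nat).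
Local Notation integ f := ((lebesgue R d).-integrable setT (EFin \o f)).
Local Notation "'I' f" := (\int[lebesgue R d]_x f x) (at level 10, f at level 9).
Implicit Types (a b u : 'cV[R]_d -> R) (x y xi : 'cV[R]_d).

Lemma dotvC x y : dotv x y = dotv y x.
Proof. by apply: eq_bigr => i _; rewrite mulrC. Qed.

Lemma dotvDr x y z : dotv x (y + z) = dotv x y + dotv x z.
Proof. by rewrite /dotv -big_split; apply: eq_bigr => i _; rewrite mxE mulrDr. Qed.

Lemma dotvZr (c : R) x y : dotv x (c *: y) = c * dotv x y.
Proof. by rewrite /dotv mulr_sumr; apply: eq_bigr => i _; rewrite mxE mulrCA. Qed.

Lemma dotvZl (c : R) x y : dotv (c *: x) y = c * dotv x y.
Proof. by rewrite dotvC dotvZr dotvC. Qed.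

Lemma dotvNr x y : dotv x (- y) = - dotv x y.
Proof. by rewrite -scaleN1r dotvZr mulN1r. Qed.

Lemma dotvBr x y z : dotv x (y - z) = dotv x y - dotv x z.
Proof. by rewrite dotvDr dotvNr. Qed.

Lemma measurable_dotv_pair :
  measurable_fun setT (fun p : 'cV[R]_d * 'cV[R]_d => dotv p.1 p.2).
Proof.
apply: measurable_sum => i; apply: measurable_funM.
  by apply: (measurableT_comp (measurable_coord i)); exact: measurable_fst.
by apply: (measurableT_comp (measurable_coord i)); exact: measurable_snd.
Qed.

Definition cosk (p : 'cV[R]_d * 'cV[R]_d) : R := cos (dotv p.1 p.2).
Definition sink (p : 'cV[R]_d * 'cV[R]_d) : R := sin (dotv p.1 p.2).

Lemma measurable_cosk : measurable_fun setT cosk.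
Proof.
apply: measurableT_comp measurable_dotv_pair.
exact: continuous_measurable_fun (@continuous_cos R).
Qed.

Lemma measurable_sink : measurable_fun setT sink.
Proof.
apply: measurableT_comp measurable_dotv_pair.
exact: continuous_measurable_fun (@continuous_sin R).
Qed.

Lemma cosk_le1 p : `|cosk p| <= 1. Proof. exact: norm_cos_le1. Qed.
Lemma sink_le1 p : `|sink p| <= 1. Proof. exact: norm_sin_le1. Qed.

(** For a real function [u] the Fourier transform is [fcos u - i * fsin u]. *)
Definition fcos u x : R := \int[lebesgue R d]_y (u y * cosk (x, y)).
Definition fsin u x : R := \int[lebesgue R d]_y (u y * sink (x, y)).

Lemma measurable_fcos u : integ u -> measurable_fun setT (fcos u).
Proof. by move=> ui; apply: (measurable_kernel measurable_cosk cosk_le1 ui). Qed.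

Lemma measurable_fsin u : integ u -> measurable_fun setT (fsin u).
Proof. by move=> ui; apply: (measurable_kernel measurable_sink sink_le1 ui). Qed.

(** The multiplier [expw (e *: x)] damps integrals of products of transforms;
    [poissonw] is the Fourier transform of [expw]. *)
Definition expw : 'cV[R]_d -> R := @pweight R (fun t => expR (- `|t|)) d.
Definition poissonw : 'cV[R]_d -> R := @pweight R (@poisson R) d.

Lemma integ_expw : integ expw.
Proof. by apply: integ_pweight; [move=> t; exact: expR_ge0|exact: integ1_expNabs]. Qed.

Lemma integ_poissonw : integ poissonw.
Proof. by apply: integ_pweight; [exact: poisson_ge0|exact: integ1_poisson]. Qed.

Lemma Rintegral_poissonw : I poissonw = (2 * pi) ^+ d.
Proof.
by rewrite Rintegral_pweight ?Rintegral_poisson//;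
  [exact: poisson_ge0|exact: integ1_poisson].
Qed.

Lemma integ_expw_scale (e : R) : 0 < e -> integ (fun x => expw (e *: x)).
Proof.
move=> e0; have [+ _] := Rintegral_affine_cv 0 (lt0r_neq0 e0) integ_expw.
by under eq_fun do rewrite /= add0r.
Qed.

Lemma Rintegral_expw_cos (e : R) xi : 0 < e ->
  e ^+ d * \int[lebesgue R d]_x (expw (e *: x) * cos (dotv (e *: xi) x)) = poissonw xi.
Proof.
move=> e0.
have wi : integ (fun x => expw x * cos (dotv xi x)) by apply: integ_mul_cos; exact: integ_expw.
have [_] := Rintegral_affine_cv 0 (lt0r_neq0 e0) wi.
rewrite gtr0_norm// => h.
transitivity (\int[lebesgue R d]_x (expw x * cos (dotv xi x))).
  rewrite -h; congr (_ * _); apply: eq_Rintegral => x _.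
  by rewrite add0r dotvZr dotvZl.
have [-> _] := @Rintegral_pweight_trig R (fun t => expR (- `|t|)) d xi
  (fun=> expR_ge0 _) (integ1_expNabs R) (fun i => Rintegral_expNabs_sin _).
by apply: eq_bigr => i _; rewrite Rintegral_expNabs_cos.
Qed.

Lemma Rintegral_expw_sin (e : R) xi : 0 < e ->
  \int[lebesgue R d]_x (expw (e *: x) * sin (dotv xi x)) = 0.
Proof.
move=> e0; pose t := e^-1 *: xi.
have wi : integ (fun x => expw x * sin (dotv t x)) by apply: integ_mul_sin; exact: integ_expw.
have [_] := Rintegral_affine_cv 0 (lt0r_neq0 e0) wi.
have [_ ->] := @Rintegral_pweight_trig R (fun t => expR (- `|t|)) d t
  (fun=> expR_ge0 _) (integ1_expNabs R) (fun i => Rintegral_expNabs_sin _).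
move=> /eqP; rewrite mulf_eq0 expf_eq0 normr_eq0 gt_eqF// andbF/= => /eqP h.
rewrite -[RHS]h; apply: eq_Rintegral => x _.
by rewrite add0r dotvZr dotvZl mulrA mulfV ?gt_eqF// mul1r.
Qed.

Lemma expw_bounds (x : 'cV[R]_d) : 0 <= expw x <= 1.
Proof.
rewrite pweight_ge0; last by move=> t; exact: expR_ge0.
by apply: prodr_ile1 => i _; rewrite expR_ge0 -expR0 ler_expR oppr_le0 normr_ge0.
Qed.

Lemma norm_expw_le1 x : `|expw x| <= 1.
Proof. by have /andP[h1 h2] := expw_bounds x; rewrite ger0_norm. Qed.

Lemma measurable_expw_scale (e : R) : measurable_fun setT (fun x => expw (e *: x)).
Proof.
have mw : measurable_fun setT expw by apply: measurable_pweight; exact: measurable_expNabs.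
have := measurableT_comp mw (measurable_affine_cv 0 e).
by under eq_fun do rewrite /= add0r.
Qed.

(** The functions to which Plancherel's formula is applied. *)
Definition nice u := [/\ continuous u, exists M, forall x, `|u x| <= M & integ u].

Lemma nice_measurable u : nice u -> measurable_fun setT u.
Proof. by move=> [cu _ _]; exact: continuous_measurable_cv. Qed.

Lemma fcos_bounded u : integ u -> exists M, forall x, `|fcos u x| <= M.
Proof.
move=> ui; exists (1 * \int[lebesgue R d]_y `|u y|) => x.
exact: (kernel_bounded measurable_cosk cosk_le1 ui).
Qed.

Lemma fsin_bounded u : integ u -> exists M, forall x, `|fsin u x| <= M.
Proof.
move=> ui; exists (1 * \int[lebesgue R d]_y `|u y|) => x.
exact: (kernel_bounded measurable_sink sink_le1 ui).
Qed.

Lemma integ_mul_fcos a u : integ a -> integ u -> integ (fun x => u x * fcos a x).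
Proof.
move=> ai ui; have [M aM] := fcos_bounded ai.
exact: (integ_mul ui (measurable_fcos ai) aM).
Qed.

Lemma integ_mul_fsin a u : integ a -> integ u -> integ (fun x => u x * fsin a x).
Proof.
move=> ai ui; have [M aM] := fsin_bounded ai.
exact: (integ_mul ui (measurable_fsin ai) aM).
Qed.

Lemma integ_mul_cosk u xi : integ u -> integ (fun x => u x * cosk (xi, x)).
Proof.
move=> ui; exact: (integ_mul ui (measurableT_comp measurable_cosk (pair1_measurable xi))
  (fun x => cosk_le1 (xi, x))).
Qed.

Lemma integ_mul_sink u xi : integ u -> integ (fun x => u x * sink (xi, x)).
Proof.
move=> ui; exact: (integ_mul ui (measurableT_comp measurable_sink (pair1_measurable xi))
  (fun x => sink_le1 (xi, x))).
Qed.

Lemma coskC x y : cosk (x, y) = cosk (y, x).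
Proof. by rewrite /cosk/= dotvC. Qed.

Lemma sinkC x y : sink (x, y) = sink (y, x).
Proof. by rewrite /sink/= dotvC. Qed.

Lemma fcos_adjoint u a : integ u -> integ a ->
  \int[lebesgue R d]_x (u x * fcos a x) = \int[lebesgue R d]_x (a x * fcos u x).
Proof.
move=> ui ai; rewrite (Rintegral_kernel_adjoint measurable_cosk cosk_le1 ui ai).
by apply: eq_Rintegral => y _; congr (_ * _); apply: eq_Rintegral => x _; rewrite coskC.
Qed.

Lemma fsin_adjoint u a : integ u -> integ a ->
  \int[lebesgue R d]_x (u x * fsin a x) = \int[lebesgue R d]_x (a x * fsin u x).
Proof.
move=> ui ai; rewrite (Rintegral_kernel_adjoint measurable_sink sink_le1 ui ai).
by apply: eq_Rintegral => y _; congr (_ * _); apply: eq_Rintegral => x _; rewrite sinkC.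
Qed.

Section damped.
Variable e : R.
Hypothesis e0 : 0 < e.
Let D x := expw (e *: x).
Let Di : integ D. Proof. exact: integ_expw_scale. Qed.

(** Moving the two transforms to the damping factor leaves the sine transform of an
    even function. *)
Lemma Rintegral_damped_cross a b : integ a -> integ b ->
  \int[lebesgue R d]_x (D x * (fcos a x * fsin b x - fsin a x * fcos b x)) = 0.
Proof.
move=> ai bi.
have ic := integ_mul_fcos bi Di; have is_ := integ_mul_fsin bi Di.
transitivity (\int[lebesgue R d]_x (D x * fsin b x * fcos a x) -
              \int[lebesgue R d]_x (D x * fcos b x * fsin a x)).
  rewrite -RintegralB//; [|exact: integ_mul_fcos|exact: integ_mul_fsin].
  by apply: eq_Rintegral => x _; ring.
rewrite (fcos_adjoint is_ ai) (fsin_adjoint ic ai); apply/eqP; rewrite subr_eq0; apply/eqP.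
apply: eq_Rintegral => xi _; congr (_ * _); rewrite /fcos -/(fcos b) /fsin -/(fsin b).
transitivity (\int[lebesgue R d]_x (D x * cosk (xi, x) * fsin b x)).
  by apply: eq_Rintegral => x _; rewrite mulrAC.
transitivity (\int[lebesgue R d]_x (D x * sink (xi, x) * fcos b x)); last first.
  by apply: eq_Rintegral => x _; rewrite mulrAC.
have ick := integ_mul_cosk xi Di; have isk := integ_mul_sink xi Di.
rewrite (fsin_adjoint ick bi) (fcos_adjoint isk bi); apply: eq_Rintegral => eta _; congr (_ * _).
apply/eqP; rewrite -subr_eq0; apply/eqP; rewrite -RintegralB//; last 2 first.
- exact: integ_mul_sink.
- exact: integ_mul_cosk.
rewrite -[RHS](Rintegral_expw_sin (eta - xi) e0); apply: eq_Rintegral => x _.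
rewrite -[expw _]/(D x) /cosk /sink/= (dotvC (eta - xi)) dotvBr sinB.
by rewrite !(dotvC x); ring.
Qed.

(** Moving the two transforms to the damping factor leaves its cosine transform at
    [eta - xi], which is a Poisson kernel of width [e]. *)
Lemma Rintegral_damped a b : integ a -> nice b ->
  \int[lebesgue R d]_x (D x * (fcos a x * fcos b x + fsin a x * fsin b x)) =
  \int[lebesgue R d]_xi (a xi * \int[lebesgue R d]_s (poissonw s * b (xi + e *: s))).
Proof.
move=> ai bn; have [_ [Mb bM] bi] := bn; have mb := nice_measurable bn.
have ic := integ_mul_fcos bi Di; have is_ := integ_mul_fsin bi Di.
transitivity (\int[lebesgue R d]_x (D x * fcos b x * fcos a x) +
              \int[lebesgue R d]_x (D x * fsin b x * fsin a x)).
  rewrite -RintegralD//; [|exact: integ_mul_fcos|exact: integ_mul_fsin].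
  by apply: eq_Rintegral => x _; ring.
rewrite (fcos_adjoint ic ai) (fsin_adjoint is_ ai) -RintegralD//;
  [|exact: integ_mul_fcos|exact: integ_mul_fsin].
apply: eq_Rintegral => xi _; rewrite -mulrDr; congr (_ * _).
transitivity (\int[lebesgue R d]_x (D x * cosk (xi, x) * fcos b x) +
              \int[lebesgue R d]_x (D x * sink (xi, x) * fsin b x)).
  by congr (_ + _); apply: eq_Rintegral => x _; rewrite mulrAC.
have ick := integ_mul_cosk xi Di; have isk := integ_mul_sink xi Di.
rewrite (fcos_adjoint ick bi) (fsin_adjoint isk bi) -RintegralD//;
  [|exact: integ_mul_fcos|exact: integ_mul_fsin].
pose K t := \int[lebesgue R d]_x (D x * cos (dotv t x)).
transitivity (\int[lebesgue R d]_eta (b eta * K (eta - xi))).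
  apply: eq_Rintegral => eta _; rewrite -mulrDr; congr (_ * _).
  rewrite -RintegralD//; [|exact: integ_mul_cosk|exact: integ_mul_sink].
  apply: eq_Rintegral => x _.
  rewrite /cosk /sink/= (dotvC (eta - xi)) dotvBr cosB.
  by rewrite !(dotvC x); ring.
have mK : measurable_fun setT (fun eta : 'cV[R]_d => K (eta - xi)).
  have mK0 : measurable_fun setT K.
    have := measurable_fcos Di; congr (measurable_fun _ _).
  have := measurableT_comp mK0 (measurable_affine_cv (- xi) 1).
  by under eq_fun do rewrite /= scale1r addrC.
have [M KM] : exists M, forall t, `|K t| <= M by exact: (fcos_bounded Di).
have bKi : integ (fun eta : 'cV[R]_d => b eta * K (eta - xi)).
  by apply: (integ_mul bi mK (fun eta => KM (eta - xi))).
have [_ <-] := Rintegral_affine_cv xi (lt0r_neq0 e0) bKi.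
have [h _] := Rintegral_affine_cv xi (lt0r_neq0 e0) bKi.
rewrite -RintegralZl// gtr0_norm//; apply: eq_Rintegral => s _.
rewrite addrAC subrr add0r mulrCA mulrC; congr (_ * _).
by rewrite -(Rintegral_expw_cos s e0).
Qed.

End damped.

End fourier.

Section cvg_prod.
Context (R : realType).

Lemma cvg_prodr (T J : Type) (F : set_system T) {FF : Filter F} (r : seq J)
    (f : T -> J -> R) (l : J -> R) :
  (forall j, f n j @[n --> F] --> l j) ->
  \prod_(j <- r) f n j @[n --> F] --> \prod_(j <- r) l j.
Proof.
move=> fl; elim: r => [|j r IH].
  have -> : (fun n => \prod_(j <- [::]) f n j) = cst 1.
    by apply/funext => n; rewrite big_nil.
  by rewrite big_nil; exact: cvg_cst.
have -> : (fun n => \prod_(j <- j :: r) f n j) = (fun n => f n j * \prod_(j <- r) f n j).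
  by apply/funext => n; rewrite big_cons.
by rewrite big_cons; apply: cvgM.
Qed.

Lemma cvg_sumr (T J : Type) (F : set_system T) {FF : Filter F} (r : seq J)
    (f : T -> J -> R) (l : J -> R) :
  (forall j, f n j @[n --> F] --> l j) ->
  \sum_(j <- r) f n j @[n --> F] --> \sum_(j <- r) l j.
Proof.
move=> fl; elim: r => [|j r IH].
  have -> : (fun n => \sum_(j <- [::]) f n j) = cst 0.
    by apply/funext => n; rewrite big_nil.
  by rewrite big_nil; exact: cvg_cst.
have -> : (fun n => \sum_(j <- j :: r) f n j) = (fun n => f n j + \sum_(j <- r) f n j).
  by apply/funext => n; rewrite big_cons.
by rewrite big_cons; apply: cvgD.
Qed.

Lemma continuous_coord d (i : 'I_d) : continuous (fun x : 'cV[R]_d => x i ord0).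
Proof. exact: coord_continuous. Qed.

Lemma continuous_dotv d (t : 'cV[R]_d) : continuous (dotv t).
Proof.
move=> x; apply: (@cvg_sumr _ _ (nbhs x) (nbhs_filter x)) => i; apply: cvgM; first exact: cvg_cst.
exact: continuous_coord.
Qed.

Lemma continuous_expw d (e : R) : continuous (fun x : 'cV[R]_d => expw (e *: x)).
Proof.
move=> x; apply: (@cvg_prodr _ _ (nbhs x) (nbhs_filter x)) => i.
apply: (@cvg_comp _ _ _ (fun y : 'cV[R]_d => - `|(e *: y) i ord0|) expR);
  last exact: continuous_expR.
apply: cvgN; apply: cvg_norm.
under eq_fun do rewrite mxE.
rewrite mxE; apply: cvgM; first exact: cvg_cst.
exact: continuous_coord.
Qed.

End cvg_prod.

(** * The formula of Plancherel *)

Section plancherel.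
Context (R : realType) (d : nat).
Local Notation integ f := ((lebesgue R d).-integrable setT (EFin \o f)).
Local Notation leb := (lebesgue R d).
Implicit Types (a b u : 'cV[R]_d -> R) (x y xi : 'cV[R]_d).

Let e_ (n : nat) : R := n.+1%:R^-1.
Let e_gt0 n : 0 < e_ n. Proof. by rewrite invr_gt0. Qed.

Lemma cvg_affine_harmonic (x s : 'cV[R]_d) : x + e_ n *: s @[n --> \oo] --> x.
Proof.
rewrite -[X in _ --> X]addr0 -(scale0r s); apply: cvgD; first exact: cvg_cst.
by apply: cvgZ; [exact: cvg_harmonic|exact: cvg_cst].
Qed.

Lemma expw_cvg1 x : @expw R d (e_ n *: x) @[n --> \oo] --> (1 : R).
Proof.
have -> : (1 : R) = \prod_(i < d) expR (- `|0 * x i ord0|).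
  by rewrite big1// => i _; rewrite mul0r normr0 oppr0 expR0.
apply: cvg_prodr => i.
apply: (@cvg_comp _ _ _ (fun n => - `|(e_ n *: x) i ord0|) expR); last exact: continuous_expR.
apply: cvgN; apply: cvg_norm.
under eq_fun do rewrite mxE.
by apply: cvgM; [exact: cvg_harmonic|exact: cvg_cst].
Qed.

Lemma expw_nondecreasing x n m : (n <= m)%N -> @expw R d (e_ n *: x) <= expw (e_ m *: x).
Proof.
move=> nm; apply: ler_prod => i _; rewrite expR_ge0 ler_expR lerN2 !mxE !normrM.
by rewrite ler_wpM2r// !ger0_norm ?invr_ge0// lef_pV2 ?posrE// ler_nat ltnS.
Qed.

Let poissonw_ge0 s : 0 <= @poissonw R d s.
Proof. by apply: pweight_ge0; exact: poisson_ge0. Qed.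

Let poissonw_measurable : measurable_fun setT (@poissonw R d).
Proof. exact: integ_measurable (integ_poissonw R d). Qed.

(** The kernel [poissonw] has total mass [(2 * pi) ^+ d]; dominated convergence is
    applied to the inner integral, then to the outer one. *)
Lemma poissonw_limit a b : integ a -> nice b ->
  \int[leb]_xi (a xi * \int[leb]_s (@poissonw R d s * b (xi + e_ n *: s))) @[n --> \oo] -->
  (2 * pi) ^+ d * \int[leb]_xi (a xi * b xi).
Proof.
move=> ai bn; have [cb [M bM] bi] := bn; have mb := nice_measurable bn.
have ma := integ_measurable ai.
have mbs n : measurable_fun setT (fun p : 'cV[R]_d * 'cV[R]_d => b (p.1 + e_ n *: p.2)).
  apply: (measurableT_comp mb); apply: measurable_fun_coordP => i.
  under eq_fun do rewrite /Defs.coord !mxE.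
  apply: measurable_funD.
    by apply: (measurableT_comp (measurable_coord i)); exact: measurable_fst.
  apply: measurable_funM => //.
  by apply: (measurableT_comp (measurable_coord i)); exact: measurable_snd.
have inner xi : \int[leb]_s (@poissonw R d s * b (xi + e_ n *: s)) @[n --> \oo] -->
    (2 * pi) ^+ d * b xi.
  have [| | | | |_] := @Rintegral_dominated_convergence _ _ _ leb
    (fun n s => @poissonw R d s * b (xi + e_ n *: s)) (fun s => @poissonw R d s * b xi)
    (fun s => @poissonw R d s * M).
  - move=> n; apply: measurable_funM => //.
    exact: (measurableT_comp (mbs n) (pair1_measurable xi)).
  - exact: measurable_funM.
  - apply/aeW => s; apply: cvgM; first exact: cvg_cst.
    apply: (@cvg_comp _ _ _ (fun n => xi + e_ n *: s) b); last exact: cb.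
    exact: cvg_affine_harmonic.
  - by apply: (@integ_mul _ _ _ _ _ _ `|M|) => //; exact: integ_poissonw.
  - by apply/aeW => s n; rewrite normrM ger0_norm// ler_wpM2l.
  by rewrite RintegralZr ?Rintegral_poissonw//; exact: integ_poissonw.
have [| | | | |_] := @Rintegral_dominated_convergence _ _ _ leb
    (fun n xi => a xi * \int[leb]_s (@poissonw R d s * b (xi + e_ n *: s)))
    (fun xi => a xi * ((2 * pi) ^+ d * b xi))
    (fun xi => `|a xi| * (M * \int[leb]_s `|@poissonw R d s|)).
- move=> n; apply: measurable_funM => //.
  by apply: (measurable_kernel (mbs n) _ (integ_poissonw R d)).
- by apply: measurable_funM => //; exact: measurable_funM.
- by apply/aeW => xi; apply: cvgM; [exact: cvg_cst|exact: inner].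
- apply: (@integ_mul _ _ _ _ _ _ `|M * \int[leb]_s `|@poissonw R d s| |) => //.
  exact: integrable_norm.
- apply/aeW => xi n; rewrite normrM ler_wpM2l//.
  by apply: (kernel_bounded (mbs n) _ (integ_poissonw R d)).
rewrite -RintegralZl//; last exact: (integ_mul ai mb bM).
by under [X in _ --> X -> _]eq_Rintegral do rewrite mulrCA.
Qed.

Lemma nice_sq a : nice a -> integ (fun x => a x ^+ 2).
Proof. by move=> an; have [ca [M aM] ai] := an; apply: (integ_mul ai (nice_measurable an) aM). Qed.

(** The damping factors increase to [1], so monotone convergence applies: it gives
    the square integrability of the transforms together with the value of the norm. *)
Lemma integral_fourier_sq a : nice a ->
  (\int[leb]_x (fcos a x ^+ 2 + fsin a x ^+ 2)%:E =
   ((2 * pi) ^+ d * \int[leb]_x (a x ^+ 2))%:E)%E.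
Proof.
move=> an; have [ca _ ai] := an.
have mg : measurable_fun setT (fun x => fcos a x ^+ 2 + fsin a x ^+ 2).
  by apply: measurable_funD; apply: measurable_funX;
    [exact: measurable_fcos|exact: measurable_fsin].
pose g_ n x := (expw (e_ n *: x) * (fcos a x ^+ 2 + fsin a x ^+ 2)).
have mg_ n : measurable_fun setT (g_ n).
  by apply: measurable_funM => //; exact: measurable_expw_scale.
have g0 n x : 0 <= g_ n x.
  by rewrite mulr_ge0 ?addr_ge0 ?sqr_ge0//; have /andP[] := expw_bounds (e_ n *: x).
have gi n : integ (g_ n).
  have := integD (integ_mul_fcos ai (integ_mul_fcos ai (integ_expw_scale d (e_gt0 n))))
                 (integ_mul_fsin ai (integ_mul_fsin ai (integ_expw_scale d (e_gt0 n)))).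
  by apply: eq_integrable => // x _ /=; congr EFin; rewrite /g_; ring.
have cvg1 x : (g_ n x)%:E @[n --> \oo] --> (fcos a x ^+ 2 + fsin a x ^+ 2)%:E.
  have h : g_ n x @[n --> \oo] --> 1 * (fcos a x ^+ 2 + fsin a x ^+ 2).
    by apply: cvgM; [exact: expw_cvg1|exact: cvg_cst].
  by rewrite mul1r in h; apply: cvg_comp h _; exact: cvg_refl.
have := @cvg_monotone_convergence _ _ _ leb _ measurableT (fun n x => (g_ n x)%:E).
have -> : (fun x => limn (fun n => (g_ n x)%:E)) =
    (fun x => (fcos a x ^+ 2 + fsin a x ^+ 2)%:E).
  by apply/funext => x; apply/cvg_lim => //; exact: cvg1.
move=> H; have {}H := H (fun n => (measurable_EFinP _ _).2 (mg_ n)).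
have {}H := H (fun n x _ => g0 n x).
have {}H : (\int[leb]_x (g_ n x)%:E @[n --> \oo] -->
    \int[leb]_x (fcos a x ^+ 2 + fsin a x ^+ 2)%:E)%E.
  apply: H => x _ n m nm; rewrite lee_fin ler_wpM2r ?addr_ge0 ?sqr_ge0//.
  exact: expw_nondecreasing.
apply: (cvg_unique _ H) => //.
have -> : (fun n => \int[leb]_x (g_ n x)%:E)%E = (fun n =>
    (\int[leb]_xi (a xi * \int[leb]_s (@poissonw R d s * a (xi + e_ n *: s))))%:E).
  apply/funext => n; rewrite -(EFin_Rintegral (gi n)) -(Rintegral_damped (e_gt0 n) ai an).
  by congr EFin; apply: eq_Rintegral => x _; rewrite /g_ !expr2.
have h := poissonw_limit ai an.
by apply: cvg_comp h _; exact: cvg_refl.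
Qed.

Lemma integ_fourier_sq a : nice a -> integ (fun x => fcos a x ^+ 2 + fsin a x ^+ 2).
Proof.
move=> an; have [ca _ ai] := an.
apply: integ_ge0P; last by rewrite integral_fourier_sq ?ltry.
- by apply: measurable_funD; apply: measurable_funX;
    [exact: measurable_fcos|exact: measurable_fsin].
- by move=> x; rewrite addr_ge0 ?sqr_ge0.
Qed.

Lemma ler_norm_mul_sq (p q : R) : `|p * q| <= p ^+ 2 + q ^+ 2.
Proof.
rewrite normrM -(real_normK (num_real p)) -(real_normK (num_real q)).
have := normr_ge0 p; have := normr_ge0 q; nra.
Qed.

Lemma fourier_damping (f : 'cV[R]_d -> R) : integ f ->
  \int[leb]_x (expw (e_ n *: x) * f x) @[n --> \oo] --> \int[leb]_x f x.
Proof.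
move=> fi; have mf := integ_measurable fi.
have [| | | | |_ //] := @Rintegral_dominated_convergence _ _ _ leb
    (fun n x => expw (e_ n *: x) * f x) f (fun x => `|f x|).
- by move=> n; apply: measurable_funM => //; exact: measurable_expw_scale.
- exact: mf.
- apply/aeW => x; rewrite -[X in _ --> X]mul1r; apply: cvgM; last exact: cvg_cst.
  exact: expw_cvg1.
- exact: integrable_norm.
- by apply/aeW => x n; rewrite normrM ler_piMl// norm_expw_le1.
Qed.

Lemma integ_mul_sq (u v : 'cV[R]_d -> R) : measurable_fun setT u -> measurable_fun setT v ->
  integ (fun x => u x ^+ 2) -> integ (fun x => v x ^+ 2) -> integ (fun x => u x * v x).
Proof.
move=> mu mv ui vi; apply: (integ_le _ _ (integD ui vi)); first exact: measurable_funM.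
by move=> x; exact: ler_norm_mul_sq.
Qed.

Lemma integ_fcos_sq a : nice a -> integ (fun x => fcos a x ^+ 2).
Proof.
move=> an; have [_ _ ai] := an; apply: (integ_le _ _ (integ_fourier_sq an)).
  by apply: measurable_funX; exact: measurable_fcos.
by move=> x; rewrite ger0_norm ?sqr_ge0// lerDl sqr_ge0.
Qed.

Lemma integ_fsin_sq a : nice a -> integ (fun x => fsin a x ^+ 2).
Proof.
move=> an; have [_ _ ai] := an; apply: (integ_le _ _ (integ_fourier_sq an)).
  by apply: measurable_funX; exact: measurable_fsin.
by move=> x; rewrite ger0_norm ?sqr_ge0// lerDr sqr_ge0.
Qed.

Section pair.
Variables (a b : 'cV[R]_d -> R).
Hypotheses (an : nice a) (bn : nice b).
Let ai : integ a. Proof. by case: an. Qed.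
Let bi : integ b. Proof. by case: bn. Qed.

Lemma integ_fcos_fcos : integ (fun x => fcos a x * fcos b x).
Proof.
by apply: integ_mul_sq; [exact: measurable_fcos|exact: measurable_fcos
  |exact: integ_fcos_sq|exact: integ_fcos_sq].
Qed.

Lemma integ_fsin_fsin : integ (fun x => fsin a x * fsin b x).
Proof.
by apply: integ_mul_sq; [exact: measurable_fsin|exact: measurable_fsin
  |exact: integ_fsin_sq|exact: integ_fsin_sq].
Qed.

Lemma integ_fcos_fsin : integ (fun x => fcos a x * fsin b x).
Proof.
by apply: integ_mul_sq; [exact: measurable_fcos|exact: measurable_fsin
  |exact: integ_fcos_sq|exact: integ_fsin_sq].
Qed.

Lemma integ_fsin_fcos : integ (fun x => fsin a x * fcos b x).
Proof.
by apply: integ_mul_sq; [exact: measurable_fsin|exact: measurable_fcos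
  |exact: integ_fsin_sq|exact: integ_fcos_sq].
Qed.

(** Since the transforms are square integrable, dominated convergence removes the
    damping from [Rintegral_damped]. *)
Lemma plancherel :
  \int[leb]_x (fcos a x * fcos b x + fsin a x * fsin b x) =
  (2 * pi) ^+ d * \int[leb]_x (a x * b x).
Proof.
have := fourier_damping (integD integ_fcos_fcos integ_fsin_fsin).
under eq_fun do rewrite (Rintegral_damped (e_gt0 _) ai bn).
move=> h; exact: (cvg_unique _ h (poissonw_limit ai bn)).
Qed.

(** The imaginary part of the inner product of two transforms. *)
Lemma plancherel_cross :
  \int[leb]_x (fcos a x * fsin b x - fsin a x * fcos b x) = 0.
Proof.
have := fourier_damping (integB integ_fcos_fsin integ_fsin_fcos).
under eq_fun do rewrite (Rintegral_damped_cross (e_gt0 _) ai bi).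
move=> h; exact: (cvg_unique _ h (cvg_cst _)).
Qed.

End pair.

End plancherel.

(** * Fourier inversion for square integrable functions *)

Section geometric_convergence.
Context (R : realType).

(** Telescoping the increments gives [K / (1 - r) * (r ^+ n - r ^+ (n + k))], hence
    the Cauchy property and the rate. *)
Lemma geometric_cauchy (u : nat -> R) (K r : R) : 0 <= r < 1 -> 0 <= K ->
  (forall n, `|u n.+1 - u n| <= K * r ^+ n) ->
  exists2 l, u n @[n --> \oo] --> l & forall n, `|l - u n| <= K / (1 - r) * r ^+ n.
Proof.
move=> /andP[r0 r1] K0 uK; have r1' : 0 < 1 - r by rewrite subr_gt0.
have C0 : 0 <= K / (1 - r) by rewrite divr_ge0// ltW.
have uk n k : `|u (n + k)%N - u n| <= K / (1 - r) * (r ^+ n - r ^+ (n + k)).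
  elim: k => [|k IH]; first by rewrite addn0 !subrr normr0 mulr0.
  rewrite -(subrK (u (n + k)%N) (u _)) -addrA (le_trans (ler_normD _ _))//.
  rewrite addnS (le_trans (lerD (uK _) IH))//.
  rewrite le_eqVlt; apply/orP; left; apply/eqP; rewrite exprS; field.
  exact: lt0r_neq0.
have un m n : (n <= m)%N -> `|u m - u n| <= K / (1 - r) * r ^+ n.
  move=> nm; rewrite -(subnKC nm) (le_trans (uk _ _))// ler_wpM2l//.
  by rewrite gerBl exprn_ge0.
have r0cvg : K / (1 - r) * r ^+ n @[n --> \oo] --> (0 : R).
  rewrite -[X in _ --> X](mulr0 (K / (1 - r))); apply: cvgM; first exact: cvg_cst.
  by apply: cvg_expr; rewrite ger0_norm.
have cu : cvg (u n @[n --> \oo]).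
  apply: cauchy_cvg; apply: cauchy_exP => e e0.
  have /cvgrPdist_lt/(_ _ e0)[N _ NP] := r0cvg.
  exists (u N); exists N => // m /= Nm; rewrite /ball/= distrC.
  apply: le_lt_trans (un _ _ Nm) _; have := NP N (leqnn N).
  by rewrite sub0r normrN ger0_norm// mulr_ge0// exprn_ge0.
exists (limn u); first exact: cu.
move=> n; rewrite ler_distl.
have bnd : \forall m \near \oo, u n - K / (1 - r) * r ^+ n <= u m <= u n + K / (1 - r) * r ^+ n.
  by exists n => // m /= nm; have := un _ _ nm; rewrite ler_distl.
apply/andP; split.
  apply: limr_ge; first exact: cu.
  by case: bnd => N _ NP; exists N => // m /= /NP/andP[].
apply: limr_le; first exact: cu.
by case: bnd => N _ NP; exists N => // m /= /NP/andP[].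
Qed.

Lemma nneseries_geometric (K r : R) : 0 <= r < 1 ->
  (\sum_(0 <= j <oo) (K * r ^+ j)%:E = (K / (1 - r))%:E)%E.
Proof.
move=> /andP[r0 r1]; apply/cvg_lim => //.
have h : series (geometric K r) n @[n --> \oo] --> K / (1 - r).
  by apply: cvg_geometric_series; rewrite ger0_norm.
have -> : (fun n => (\sum_(0 <= j < n) (K * r ^+ j)%:E)%E) =
    (fun n => (series (geometric K r) n)%:E).
  by apply/funext => n; rewrite sumEFin.
by apply: cvg_comp h _; exact: cvg_refl.
Qed.

End geometric_convergence.

Lemma sqr_sub_le (R : realType) (a b c : R) :
  (b - c) ^+ 2 <= 2 * (a - b) ^+ 2 + 2 * (a - c) ^+ 2.
Proof.
rewrite -subr_ge0.
have -> : 2 * (a - b) ^+ 2 + 2 * (a - c) ^+ 2 - (b - c) ^+ 2 =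
  (2 * a - b - c) ^+ 2 by ring.
exact: sqr_ge0.
Qed.

Lemma le_quadruple (R : realFieldType) (p q z w : R) :
  p <= z -> q <= w -> w <= z -> 2 * q + 2 * p <= 4 * z.
Proof. lra. Qed.

Lemma half_itv (R : realFieldType) : 0 <= (2^-1 : R) < 1.
Proof. by apply/andP; split; lra. Qed.

Lemma ler_sqr_dist (R : realFieldType) (s l p q : R) : 0 <= s ->
  `|l - p| <= 2 * s -> `|l - q| <= 2 * s -> p ^+ 2 <= 2 * q ^+ 2 + 32 * s ^+ 2.
Proof.
rewrite !ler_norml => s0 /andP[a1 a1'] /andP[a2 a2'].
have b1 : p - q <= 4 * s by lra.
have b2 : - (4 * s) <= p - q by lra.
have b3 : (p - q) ^+ 2 <= (4 * s) ^+ 2.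
  by rewrite -[leLHS]real_normK ?num_real// ler_pXn2r ?nnegrE ?mulr_ge0// ler_norml b1 b2.
have b4 : 0 <= (p - 2 * q) ^+ 2 by exact: sqr_ge0.
have b5 : p ^+ 2 = 2 * q ^+ 2 + 2 * (p - q) ^+ 2 - (p - 2 * q) ^+ 2 by ring.
rewrite exprMn in b3; lra.
Qed.

Section L2_inversion.
Context (R : realType) (d : nat).
Local Notation integ f := ((lebesgue R d).-integrable setT (EFin \o f)).
Local Notation leb := (lebesgue R d).
Implicit Types (a b u : 'cV[R]_d -> R) (x y xi : 'cV[R]_d).

Lemma fcosB a b x : integ a -> integ b -> fcos (fun y => a y - b y) x = fcos a x - fcos b x.
Proof.
move=> ai bi; rewrite /fcos -RintegralB//; [|exact: integ_mul_cosk|exact: integ_mul_cosk].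
by apply: eq_Rintegral => y _; rewrite mulrBl.
Qed.

Lemma fsinB a b x : integ a -> integ b -> fsin (fun y => a y - b y) x = fsin a x - fsin b x.
Proof.
move=> ai bi; rewrite /fsin -RintegralB//; [|exact: integ_mul_sink|exact: integ_mul_sink].
by apply: eq_Rintegral => y _; rewrite mulrBl.
Qed.

Lemma nice_sub a b : nice a -> nice b -> nice (fun x => a x - b x).
Proof.
move=> [ca [M aM] ai] [cb [N bN] bi]; split.
- by move=> x; exact: (cvgB (ca x) (cb x)).
- exists (M + N) => x; rewrite (le_trans (ler_normB _ _))// lerD//.
- exact: integB.
Qed.

Variables (h : 'cV[R]_d -> R) (M : R).
Hypotheses (ch : continuous h) (hM : forall x, `|h x| <= M)
  (hi : integ (fun x => h x ^+ 2)).

Let cut n x := h x * expw (n.+1%:R^-1 *: x).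

Let cut_nice n : nice (cut n).
Proof.
have mh := continuous_measurable_cv ch.
have n0 : 0 < n.+1%:R^-1 :> R by rewrite invr_gt0.
have ie := integ_expw_scale d n0.
split.
- by move=> x; exact: (cvgM (@ch x) (@continuous_expw R d n.+1%:R^-1 x)).
- by exists M => x; rewrite normrM (le_trans _ (@hM x))// ler_piMr// norm_expw_le1.
- have H := integ_mul ie mh (@hM).
  by rewrite (_ : cut n = (fun x => expw (n.+1%:R^-1 *: x) * h x))//;
    apply/funext => x; rewrite /cut mulrC.
Qed.

Let cut_le n x : `|cut n x| <= `|h x|.
Proof. by rewrite normrM ler_piMr// norm_expw_le1. Qed.

Let cut_cvg x : cut n x @[n --> \oo] --> h x.
Proof.
rewrite -[X in _ --> X]mulr1; apply: cvgM; first exact: cvg_cst.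
exact: expw_cvg1.
Qed.

Let dist2 n := \int[leb]_x ((h x - cut n x) ^+ 2).

Let mh := continuous_measurable_cv ch.

Let mdist n : measurable_fun setT (fun x => (h x - cut n x) ^+ 2).
Proof.
apply: measurable_funX; apply: measurable_funB => //.
exact: nice_measurable (cut_nice n).
Qed.

Let dist_le n x : `|(h x - cut n x) ^+ 2| <= h x ^+ 2.
Proof.
have /andP[e0 e1] := expw_bounds (n.+1%:R^-1 *: x : 'cV[R]_d).
rewrite ger0_norm ?sqr_ge0// /cut -[X in X - _]mulr1 -mulrBr exprMn ler_piMr ?sqr_ge0//.
by rewrite expr_le1// ?subr_ge0// gerBl.
Qed.

Let dist_int n : integ (fun x => (h x - cut n x) ^+ 2).
Proof. exact: (integ_le (mdist n) (dist_le n) hi). Qed.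

Let dist2_cvg : dist2 n @[n --> \oo] --> (0 : R).
Proof.
have [| | | | |_] := @Rintegral_dominated_convergence _ _ _ leb
  (fun n x => (h x - cut n x) ^+ 2) (fun=> 0) (fun x => h x ^+ 2).
- exact: mdist.
- exact: measurable_cst.
- apply/aeW => x.
  have H : h x - cut n x @[n --> \oo] --> h x - h x.
    by apply: cvgB; [exact: cvg_cst|exact: cut_cvg].
  by rewrite subrr in H; rewrite -[X in _ --> X](mulr0 (0 : R)); exact: (cvgM H H).
- exact: hi.
- by apply/aeW => x n; exact: dist_le.
by rewrite Rintegral_cst// mul0r.
Qed.

Let ex_index j : exists n, (j <= n)%N /\ dist2 n <= 16^-1 ^+ j.
Proof.
have e0 : 0 < 16^-1 ^+ j :> R by rewrite exprn_gt0// invr_gt0.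
have /cvgrPdist_le/(_ _ e0)[N _ NP] := dist2_cvg.
exists (maxn j N); split; first exact: leq_maxl.
have := NP (maxn j N) (leq_maxr _ _).
by rewrite sub0r normrN; apply: le_trans; exact: ler_norm.
Qed.

(** The approximations [u j] are truncations of [h] that converge in [L^2] at a
    geometric rate: the increments of their transforms are then summable almost
    everywhere, with a square integrable bound. *)
Lemma L2_inversion : exists (u : nat -> 'cV[R]_d -> R) (F1 F2 E : 'cV[R]_d -> R),
  [/\ forall j, nice (u j), forall j x, `|u j x| <= `|h x| &
      forall x, u j x @[j --> \oo] --> h x] /\
  [/\ measurable_fun setT F1, measurable_fun setT F2, integ E &
     {ae leb, forall x, [/\ fcos (u j) x @[j --> \oo] --> F1 x,
        fsin (u j) x @[j --> \oo] --> F2 x &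
        forall j, fcos (u j) x ^+ 2 <= E x /\ fsin (u j) x ^+ 2 <= E x]}].
Proof.
have [k kP] := choice ex_index.
pose u j := cut (k j).
have un j : nice (u j) by exact: cut_nice.
pose g j x := u j.+1 x - u j x.
have gn j : nice (g j) by exact: nice_sub.
pose q j x := fcos (g j) x ^+ 2 + fsin (g j) x ^+ 2.
have q0 j x : 0 <= q j x by rewrite addr_ge0// sqr_ge0.
have gi j : \int[leb]_x (g j x ^+ 2) <= 4 * 16^-1 ^+ j.
  apply: (@le_trans _ _ (2 * dist2 (k j.+1) + 2 * dist2 (k j))).
    have i1 := integZ 2 (dist_int (k j.+1)); have i2 := integZ 2 (dist_int (k j)).
    have e1 := RintegralZl 2 measurableT (dist_int (k j.+1)).
    have e2 := RintegralZl 2 measurableT (dist_int (k j)).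
    have e3 := RintegralD measurableT i1 i2.
    rewrite e1 e2 in e3; rewrite -[leRHS]e3 {e1 e2 e3}.
    apply: (le_Rintegral measurableT (nice_sq (gn j)) (integD i1 i2)).
    by move=> x _; exact: sqr_sub_le.
  have [_ h1] := kP j; have [_ h2] := kP j.+1.
  apply: (le_quadruple h1 h2).
  by rewrite exprS ler_piMl// ?exprn_ge0// ?invr_ge0// invf_le1// ler1n.
(* The integral of [q j] is of order [16 ^- j], so the series of the [4 ^+ j * q j] is
   integrable. Where its sum [E0] is finite, [q j] is at most [E0 * 4 ^- j]: the
   increments of the transforms are of order [2 ^- j]. *)
pose W j x := ((4 ^+ j * q j x)%:E)%E.
have mq j : measurable_fun setT (q j).
  have [_ _ ?] := gn j.
  by apply: measurable_funD; apply: measurable_funX;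
    [exact: measurable_fcos|exact: measurable_fsin].
pose E0 x := (\sum_(0 <= j <oo) W j x)%E.
have mW j : measurable_fun setT (W j) by apply/measurable_EFinP; exact: measurable_funM.
have W0 j x : (0 <= W j x)%E by rewrite lee_fin mulr_ge0// exprn_ge0.
have mE0 : measurable_fun setT E0.
  by apply: ge0_emeasurable_sum => // j x _ _; exact: W0.
have E00 x : (0 <= E0 x)%E by apply: nneseries_ge0 => j _ _; exact: W0.
have E0fin : (\int[leb]_x E0 x < +oo)%E.
  rewrite integral_nneseries//.
  apply: (@le_lt_trans _ _ (\sum_(0 <= j <oo) ((4 * (2 * pi) ^+ d) * 4^-1 ^+ j)%:E)%E).
    apply: lee_nneseries => j _; first by rewrite integral_ge0.
    rewrite /W; under eq_integral do rewrite EFinM.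
    have mEq : measurable_fun setT (fun x => (q j x)%:E) by apply/measurable_EFinP.
    have q0E x : setT x -> (0 <= (q j x)%:E)%E by move=> _; rewrite lee_fin.
    have c0 : (0 <= (4 ^+ j)%:E :> \bar R)%E by rewrite lee_fin exprn_ge0.
    rewrite (ge0_integralZl leb measurableT mEq q0E c0).
    rewrite integral_fourier_sq// -EFinM lee_fin.
    have -> : 4 * (2 * pi) ^+ d * 4^-1 ^+ j =
        4 ^+ j * ((2 * pi) ^+ d * (4 * 16^-1 ^+ j)) :> R.
      have -> : 16^-1 = 4^-1 * 4^-1 :> R by field.
      rewrite [(4^-1 * 4^-1) ^+ j]exprMn !exprVn; have : 4 ^+ j != 0 :> R by rewrite expf_neq0.
      by move: (4 ^+ j) => y y0; field.
    by rewrite ler_wpM2l ?exprn_ge0// ler_wpM2l// exprn_ge0// mulr_ge0// pi_ge0.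
  by rewrite nneseries_geometric ?ltry// invr_ge0 ler0n invf_lt1// ltr1n.
have E0i : leb.-integrable setT E0.
  apply/integrableP; split => //.
  by under eq_integral do rewrite gee0_abs//.
pose fin := [set x | (E0 x < +oo)%E].
have mfin : measurable fin.
  have -> : fin = setT `&` E0 @^-1` (~` [set +oo%E]).
    apply/seteqP; split => [x|x [_ /= h']]; rewrite /fin/= ltey; last exact/eqP.
    by move=> /eqP h'; split.
  by apply: mE0 => //; apply: measurableC; exact: emeasurable_set1.
pose e1 x := fine (E0 x).
have e10 x : 0 <= e1 x by exact: fine_ge0.
have e1i : integ e1.
  apply: le_integrable E0i => //.
    by apply/measurable_EFinP; exact: measurableT_comp.
  move=> x _ /=; rewrite ger0_norm// gee0_abs// /e1.
  by move: (E00 x); case: (E0 x) => // _; rewrite leey.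
have qle x j : fin x -> q j x <= e1 x * 4^-1 ^+ j.
  move=> finx.
  rewrite exprVn ler_pdivlMr ?exprn_gt0// mulrC -lee_fin /e1 fineK; last first.
    by rewrite ge0_fin_numE.
  apply: (@le_trans _ _ (\sum_(0 <= i < j.+1) W i x)%E); last first.
    by apply: nneseries_lim_ge => i _ _; exact: W0.
  by rewrite big_nat_recr//= -[leLHS]add0e leeD2r// sume_ge0.
have sq_abs (c s : R) : 0 <= s -> c ^+ 2 <= s ^+ 2 -> `|c| <= s.
  by move=> s0 cs; rewrite -(ler_pXn2r (n := 2)) ?nnegrE// real_normK ?num_real.
have step x j (c : R) : fin x -> c ^+ 2 <= q j x -> `|c| <= Num.sqrt (e1 x) * 2^-1 ^+ j.
  move=> finx cq; apply: sq_abs; first by rewrite mulr_ge0 ?sqrtr_ge0 ?exprn_ge0.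
  rewrite exprMn sqr_sqrtr// -exprM mulnC exprM.
  have -> : 2^-1 ^+ 2 = 4^-1 :> R by field.
  exact: le_trans cq (qle _ _ finx).
have half := half_itv R.
have C x := @geometric_cauchy R (fun n => fcos (u n) x) (Num.sqrt (e1 x)) _ half (sqrtr_ge0 _).
have S x := @geometric_cauchy R (fun n => fsin (u n) x) (Num.sqrt (e1 x)) _ half (sqrtr_ge0 _).
have ui j : integ (u j) by have [_ _] := un j.
have {}C x : fin x -> exists2 l, fcos (u n) x @[n --> \oo] --> l &
    forall n, `|l - fcos (u n) x| <= Num.sqrt (e1 x) / (1 - 2^-1) * 2^-1 ^+ n.
  move=> finx; apply: C => n; rewrite -fcosB//; apply: step => //.
  by rewrite /q lerDl sqr_ge0.
have {}S x : fin x -> exists2 l, fsin (u n) x @[n --> \oo] --> l &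
    forall n, `|l - fsin (u n) x| <= Num.sqrt (e1 x) / (1 - 2^-1) * 2^-1 ^+ n.
  move=> finx; apply: S => n; rewrite -fsinB//; apply: step => //.
  by rewrite /q lerDr sqr_ge0.
have dom x (v : nat -> R) l : (forall n, `|l - v n| <= Num.sqrt (e1 x) / (1 - 2^-1) * 2^-1 ^+ n) ->
    forall n, v n ^+ 2 <= 2 * v 0 ^+ 2 + 32 * e1 x.
  move=> vl n.
  have s0 := sqrtr_ge0 (e1 x).
  have se : Num.sqrt (e1 x) ^+ 2 = e1 x by rewrite sqr_sqrtr.
  have h2 : (2^-1 : R) ^+ n <= 1 by case/andP: half => ? /ltW ?; rewrite exprn_ile1.
  have h3 : 1 - 2^-1 = 2^-1 :> R by field.
  have a1 : `|l - v n| <= 2 * Num.sqrt (e1 x).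
    apply: le_trans (vl n) _; rewrite h3 invrK.
    by rewrite -[leRHS]mulr1 [X in _ <= X * _]mulrC ler_wpM2l// mulr_ge0.
  have a2 : `|l - v 0| <= 2 * Num.sqrt (e1 x).
    by apply: le_trans (vl 0) _; rewrite h3 invrK expr0 mulr1 mulrC.
  by rewrite -se; exact: ler_sqr_dist a1 a2.
pose F1 x := \1_fin x * limn (fun n => fcos (u n) x).
pose F2 x := \1_fin x * limn (fun n => fsin (u n) x).
pose E x := 2 * (fcos (u 0) x ^+ 2 + fsin (u 0) x ^+ 2) + 32 * e1 x.
have finae : {ae leb, forall x, fin x}.
  have := integrable_ae measurableT E0i; apply: filterS => x /(_ I).
  by rewrite /fin/= ge0_fin_numE.
exists u, F1, F2, E; split; [split|split].
- exact: un.
- by move=> j x; exact: cut_le.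
- move=> x; apply/cvgrPdist_le => e e0.
  have /cvgrPdist_le/(_ _ e0)[N _ NP] := @cut_cvg x.
  exists N => // j /= Nj; apply: NP => /=.
  by have [h1 _] := kP j; exact: leq_trans h1.
- apply: (@measurable_fun_cvg _ _ _ _ (fun n x => \1_fin x * fcos (u n) x)).
    by move=> n; apply: measurable_funM; [exact: measurable_indic|exact: measurable_fcos].
  move=> x _; rewrite /F1 indicE; case: (boolP (x \in fin)) => [|_]; last first.
    by rewrite mul0r; under eq_fun do rewrite mul0r; exact: cvg_cst.
  rewrite inE => /C[l lC _]; apply: cvgM; first exact: cvg_cst.
  by apply/cvg_ex; exists l.
- apply: (@measurable_fun_cvg _ _ _ _ (fun n x => \1_fin x * fsin (u n) x)).
    by move=> n; apply: measurable_funM; [exact: measurable_indic|exact: measurable_fsin].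
  move=> x _; rewrite /F2 indicE; case: (boolP (x \in fin)) => [|_]; last first.
    by rewrite mul0r; under eq_fun do rewrite mul0r; exact: cvg_cst.
  rewrite inE => /S[l lS _]; apply: cvgM; first exact: cvg_cst.
  by apply/cvg_ex; exists l.
- by apply: integD; apply: integZ => //; exact: integ_fourier_sq.
- apply: filterS finae => x finx.
  have [l1 l1C l1B] := C _ finx; have [l2 l2S l2B] := S _ finx.
  have i1 : \1_fin x = 1 :> R by rewrite indicE mem_set.
  split.
  + by rewrite /F1 i1 mul1r (cvg_lim _ l1C).
  + by rewrite /F2 i1 mul1r (cvg_lim _ l2S).
  + move=> j; split; [apply: le_trans (dom x _ _ l1B j) _|apply: le_trans (dom x _ _ l2B j) _].
      by rewrite lerD2r ler_wpM2l// lerDl sqr_ge0.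
    by rewrite lerD2r ler_wpM2l// lerDr sqr_ge0.
Qed.

End L2_inversion.

Section dominated_L2_convergence.
Context (R : realType) (d : nat).
Local Notation integ f := ((lebesgue R d).-integrable setT (EFin \o f)).
Local Notation leb := (lebesgue R d).
Implicit Types (v : nat -> 'cV[R]_d -> R) (V w : 'cV[R]_d -> R).

Lemma ae_shift (P : 'cV[R]_d -> Prop) (t : 'cV[R]_d) :
  {ae leb, forall x, P x} -> {ae leb, forall x, P (x - t)}.
Proof.
move=> [N [mN N0 PN]].
have mt : measurable_fun setT (fun x : 'cV[R]_d => - t + 1 *: x).
  exact: measurable_affine_cv.
have mN' : measurable ((fun x : 'cV[R]_d => - t + 1 *: x) @^-1` N).
  by rewrite -[X in measurable X]setTI; exact: mt.
exists ((fun x : 'cV[R]_d => - t + 1 *: x) @^-1` N); split => //.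
- have := integral_indic leb measurableT mN'; rewrite setIT => <-.
  transitivity (\int[leb]_x (\1_N (- t + 1 *: x))%:E)%E; first by [].
  have := @ge0_integral_affine_cv R d (- t) 1 (fun x => (\1_N x)%:E) (oner_neq0 _).
  rewrite normr1 expr1n mul1e => ->.
  + by rewrite integral_indic// setIT.
  + by apply/measurable_EFinP; exact: measurable_indic.
  + by move=> x; rewrite lee_fin.
- by move=> x /= h; rewrite scale1r addrC; apply: PN.
Qed.

(** Almost everywhere convergence dominated in [L^2]: it implies convergence in
    [L^2], and is stable under linear combinations and translations. *)
Definition cvL2 v V :=
  [/\ forall j, measurable_fun setT (v j), measurable_fun setT V,
      {ae leb, forall x, v j x @[j --> \oo] --> V x} &
      exists2 E, integ E & {ae leb, forall x j, v j x ^+ 2 <= E x}].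

Lemma cvL2_0 : cvL2 (fun _ _ => 0) (fun=> 0).
Proof.
split => //; first by apply/aeW => x; exact: cvg_cst.
exists (fun=> 0); first exact: (@integrable0 _ _ _ leb).
by apply/aeW => x j; rewrite expr0n.
Qed.

Lemma cvL2D v V v' V' : cvL2 v V -> cvL2 v' V' ->
  cvL2 (fun j x => v j x + v' j x) (fun x => V x + V' x).
Proof.
move=> [mv mV vV [E Ei vE]] [mv' mV' vV' [E' Ei' vE']]; split.
- by move=> j; exact: measurable_funD.
- exact: measurable_funD.
- by apply: filterS2 vV vV' => x; exact: cvgD.
- exists (fun x => 2 * E x + 2 * E' x); first by apply: integD; exact: integZ.
  apply: filterS2 vE vE' => x h h' j; have := h j; have := h' j.
  have := sqr_ge0 (v j x - v' j x); nra.
Qed.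

Lemma cvL2Z (c : R) v V : cvL2 v V -> cvL2 (fun j x => c * v j x) (fun x => c * V x).
Proof.
move=> [mv mV vV [E Ei vE]]; split.
- by move=> j; exact: measurable_funM.
- exact: measurable_funM.
- by apply: filterS vV => x h; apply: cvgM h; exact: cvg_cst.
- exists (fun x => c ^+ 2 * E x); first exact: integZ.
  by apply: filterS vE => x h j; rewrite exprMn ler_wpM2l ?sqr_ge0.
Qed.

Lemma cvL2_shift (t : 'cV[R]_d) v V : cvL2 v V ->
  cvL2 (fun j x => v j (x - t)) (fun x => V (x - t)).
Proof.
move=> [mv mV vV [E Ei vE]].
have mt : measurable_fun setT (fun x : 'cV[R]_d => x - t).
  have := measurable_affine_cv (- t) 1.
  by under eq_fun do rewrite scale1r addrC.
split.
- by move=> j; exact: measurableT_comp.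
- exact: measurableT_comp.
- exact: (ae_shift t vV).
- exists (fun x => E (x - t)); last exact: (ae_shift t vE).
  have [+ _] := Rintegral_affine_cv (- t) (oner_neq0 R) Ei.
  by under eq_fun do rewrite scale1r addrC.
Qed.

Lemma cvL2_sum (K : Type) (s : seq K) (v : K -> nat -> 'cV[R]_d -> R)
    (V : K -> 'cV[R]_d -> R) : (forall k, cvL2 (v k) (V k)) ->
  cvL2 (fun j x => \sum_(k <- s) v k j x) (fun x => \sum_(k <- s) V k x).
Proof.
move=> vV; elim: s => [|k s IH].
  under eq_fun do under eq_fun do rewrite big_nil.
  by under [X in cvL2 _ X]eq_fun do rewrite big_nil; exact: cvL2_0.
under eq_fun do under eq_fun do rewrite big_cons.
by under [X in cvL2 _ X]eq_fun do rewrite big_cons; exact: cvL2D.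
Qed.

Lemma cvL2_sq v V : cvL2 v V -> integ (fun x => V x ^+ 2) /\
  \int[leb]_x (v j x ^+ 2) @[j --> \oo] --> \int[leb]_x (V x ^+ 2).
Proof.
move=> [mv mV vV [E Ei vE]].
apply: (@Rintegral_dominated_convergence _ _ _ leb (fun j x => v j x ^+ 2) _ E) => //.
- by move=> j; exact: measurable_funX.
- exact: measurable_funX.
- by apply: filterS vV => x h; exact: (cvgM h h).
- by apply: filterS vE => x h j; rewrite ger0_norm ?sqr_ge0.
Qed.

Lemma cvL2_pair v V w : cvL2 v V -> measurable_fun setT w ->
  integ (fun x => w x ^+ 2) -> integ (fun x => V x * w x) /\
  \int[leb]_x (v j x * w x) @[j --> \oo] --> \int[leb]_x (V x * w x).
Proof.
move=> [mv mV vV [E Ei vE]] mw wi.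
apply: (@Rintegral_dominated_convergence _ _ _ leb (fun j x => v j x * w x) _
  (fun x => E x + w x ^+ 2)).
- by move=> j; exact: measurable_funM.
- exact: measurable_funM.
- by apply: filterS vV => x h; apply: cvgM h _; exact: cvg_cst.
- exact: integD.
- apply: filterS vE => x h j; apply: le_trans (ler_norm_mul_sq _ _) _.
  by rewrite lerD2r.
Qed.

End dominated_L2_convergence.

(** * Translates and trigonometric polynomials *)

Section complex_parts.
Context (R : rcfType).
Implicit Types z w : R[i].

Lemma ReM z w : complex.Re (z * w) = complex.Re z * complex.Re w - complex.Im z * complex.Im w.
Proof. by case: z; case: w. Qed.

Lemma ImM z w : complex.Im (z * w) = complex.Re z * complex.Im w + complex.Im z * complex.Re w.
Proof. by case: z => a b; case: w. Qed.

Lemma ReD z w : complex.Re (z + w) = complex.Re z + complex.Re w.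
Proof. by case: z; case: w. Qed.

Lemma ImD z w : complex.Im (z + w) = complex.Im z + complex.Im w.
Proof. by case: z; case: w. Qed.

Lemma Re_sum (K : Type) (s : seq K) (z : K -> R[i]) :
  complex.Re (\sum_(k <- s) z k) = \sum_(k <- s) complex.Re (z k).
Proof. by elim: s => [|k s IH]; rewrite ?big_nil// !big_cons ReD IH. Qed.

Lemma Im_sum (K : Type) (s : seq K) (z : K -> R[i]) :
  complex.Im (\sum_(k <- s) z k) = \sum_(k <- s) complex.Im (z k).
Proof. by elim: s => [|k s IH]; rewrite ?big_nil// !big_cons ImD IH. Qed.

Lemma complex_eq z w : complex.Re z = complex.Re w -> complex.Im z = complex.Im w -> z = w.
Proof. by case: z => a b; case: w => c e /= -> ->. Qed.

End complex_parts.

Lemma sqr_normc (R : realType) (z : R[i]) :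
  normc z ^+ 2 = complex.Re z ^+ 2 + complex.Im z ^+ 2.
Proof.
by case: z => a b; rewrite /normc /= sqr_sqrtr// addr_ge0// sqr_ge0.
Qed.

Section trigonometric_sums.
Context (R : realType) (d : nat).
Local Notation integ f := ((lebesgue R d).-integrable setT (EFin \o f)).
Local Notation leb := (lebesgue R d).
Implicit Types (a b u : 'cV[R]_d -> R) (x y t : 'cV[R]_d).

(** Real and imaginary parts of the sum of the [c k * exp (- i * dotv (t k) y)]. *)
Definition trigRe (K : Type) (s : seq K) (c : K -> R[i]) (t : K -> 'cV[R]_d) y : R :=
  \sum_(k <- s) (complex.Re (c k) * cos (dotv (t k) y) + complex.Im (c k) * sin (dotv (t k) y)).
Definition trigIm (K : Type) (s : seq K) (c : K -> R[i]) (t : K -> 'cV[R]_d) y : R :=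
  \sum_(k <- s) (complex.Im (c k) * cos (dotv (t k) y) - complex.Re (c k) * sin (dotv (t k) y)).

Section mulnice.
Variables (K : Type) (s : seq K) (c : K -> R[i]) (t : K -> 'cV[R]_d).

Lemma continuous_cos_dotv z : continuous (fun y : 'cV[R]_d => cos (dotv z y)).
Proof.
by move=> y; apply: (@continuous_comp _ _ _ (dotv z) cos);
  [exact: continuous_dotv|exact: continuous_cos].
Qed.

Lemma continuous_sin_dotv z : continuous (fun y : 'cV[R]_d => sin (dotv z y)).
Proof.
by move=> y; apply: (@continuous_comp _ _ _ (dotv z) sin);
  [exact: continuous_dotv|exact: continuous_sin].
Qed.

Lemma continuous_trigRe : continuous (trigRe s c t).
Proof.
move=> y; apply: (@cvg_sumr _ _ _ (nbhs y) (nbhs_filter y)) => k.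
by apply: cvgD; apply: cvgM; [exact: cvg_cst|exact: continuous_cos_dotv
  |exact: cvg_cst|exact: continuous_sin_dotv].
Qed.

Lemma continuous_trigIm : continuous (trigIm s c t).
Proof.
move=> y; apply: (@cvg_sumr _ _ _ (nbhs y) (nbhs_filter y)) => k.
by apply: cvgB; apply: cvgM; [exact: cvg_cst|exact: continuous_cos_dotv
  |exact: cvg_cst|exact: continuous_sin_dotv].
Qed.

Definition coef_norm : R := \sum_(k <- s) (`|complex.Re (c k)| + `|complex.Im (c k)|).

Lemma norm_trigRe y : `|trigRe s c t y| <= coef_norm.
Proof.
apply: (le_trans (ler_norm_sum _ _ _)); apply: ler_sum => k _.
by rewrite (le_trans (ler_normD _ _))// !normrM lerD// ler_piMr//
  ?norm_cos_le1 ?norm_sin_le1.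
Qed.

Lemma norm_trigIm y : `|trigIm s c t y| <= coef_norm.
Proof.
apply: (le_trans (ler_norm_sum _ _ _)); apply: ler_sum => k _.
by rewrite (le_trans (ler_normB _ _))// !normrM addrC lerD// ler_piMr//
  ?norm_cos_le1 ?norm_sin_le1.
Qed.

Lemma nice_mul u v N : nice u -> continuous v -> (forall y, `|v y| <= N) ->
  nice (fun y => u y * v y).
Proof.
move=> [cu [M uM] ui] cv vN; split.
- by move=> y; exact: (cvgM (cu y) (cv y)).
- by exists (M * N) => y; rewrite normrM ler_pM.
- exact: (integ_mul ui (continuous_measurable_cv cv) vN).
Qed.

End mulnice.

Lemma fcosD a b x : integ a -> integ b -> fcos (fun y => a y + b y) x = fcos a x + fcos b x.
Proof.
move=> ai bi; rewrite /fcos -RintegralD//; [|exact: integ_mul_cosk|exact: integ_mul_cosk].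
by apply: eq_Rintegral => y _; rewrite mulrDl.
Qed.

Lemma fsinD a b x : integ a -> integ b -> fsin (fun y => a y + b y) x = fsin a x + fsin b x.
Proof.
move=> ai bi; rewrite /fsin -RintegralD//; [|exact: integ_mul_sink|exact: integ_mul_sink].
by apply: eq_Rintegral => y _; rewrite mulrDl.
Qed.

(** The transform of a translate is a modulation. *)
Lemma fourier_shift_one u x t (p r : R) : nice u ->
  p * fcos u (x - t) - r * fsin u (x - t) =
    fcos (fun y => u y * (p * cos (dotv t y) + r * sin (dotv t y))) x -
    fsin (fun y => u y * (r * cos (dotv t y) - p * sin (dotv t y))) x /\
  p * fsin u (x - t) + r * fcos u (x - t) =
    fsin (fun y => u y * (p * cos (dotv t y) + r * sin (dotv t y))) x +
    fcos (fun y => u y * (r * cos (dotv t y) - p * sin (dotv t y))) x.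
Proof.
move=> un; have [_ _ ui] := un.
have n1 := nice_mul un (continuous_trigRe (s := [:: tt]) (c := fun=> Complex p r) (t := fun=> t))
  (norm_trigRe _ _ _).
have n2 := nice_mul un (continuous_trigIm (s := [:: tt]) (c := fun=> Complex p r) (t := fun=> t))
  (norm_trigIm _ _ _).
have i1 : integ (fun y => u y * (p * cos (dotv t y) + r * sin (dotv t y))).
  by have [_ _] := n1; under eq_fun do rewrite /trigRe big_seq1.
have i2 : integ (fun y => u y * (r * cos (dotv t y) - p * sin (dotv t y))).
  by have [_ _] := n2; under eq_fun do rewrite /trigIm big_seq1.
have dE y : dotv (x - t) y = dotv x y - dotv t y.
  by rewrite !(dotvC _ y) dotvBr.
have Ac := integ_mul_cosk (x - t) ui; have As := integ_mul_sink (x - t) ui.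
split.
- rewrite /fcos /fsin -(RintegralZl p measurableT Ac) -(RintegralZl r measurableT As).
  rewrite -(RintegralB measurableT (integZ p Ac) (integZ r As)).
  rewrite -(RintegralB measurableT (integ_mul_cosk x i1) (integ_mul_sink x i2)).
  by apply: eq_Rintegral => y _; rewrite /cosk /sink/= dE cosB sinB; ring.
- rewrite /fcos /fsin -(RintegralZl p measurableT As) -(RintegralZl r measurableT Ac).
  rewrite -(RintegralD measurableT (integZ p As) (integZ r Ac)).
  rewrite -(RintegralD measurableT (integ_mul_sink x i1) (integ_mul_cosk x i2)).
  by apply: eq_Rintegral => y _; rewrite /cosk /sink/= dE cosB sinB; ring.
Qed.

Lemma fourier_shift u x (K : Type) (s : seq K) (c : K -> R[i]) (t : K -> 'cV[R]_d) : nice u ->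
  \sum_(k <- s) (complex.Re (c k) * fcos u (x - t k) - complex.Im (c k) * fsin u (x - t k)) =
    fcos (fun y => u y * trigRe s c t y) x - fsin (fun y => u y * trigIm s c t y) x /\
  \sum_(k <- s) (complex.Re (c k) * fsin u (x - t k) + complex.Im (c k) * fcos u (x - t k)) =
    fsin (fun y => u y * trigRe s c t y) x + fcos (fun y => u y * trigIm s c t y) x.
Proof.
move=> un; have [_ _ ui] := un.
have ii (r : seq K) : integ (fun y => u y * trigRe r c t y) /\ integ (fun y => u y * trigIm r c t y).
  have [_ _ h1] := nice_mul un (@continuous_trigRe _ r c t) (norm_trigRe r c t).
  have [_ _ h2] := nice_mul un (@continuous_trigIm _ r c t) (norm_trigIm r c t).
  by [].
have i1 k : integ (fun y => u y * (complex.Re (c k) * cos (dotv (t k) y) + complex.Im (c k) * sin (dotv (t k) y))).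
  by have [+ _] := ii [:: k]; under eq_fun do rewrite /= /trigRe big_seq1.
have i2 k : integ (fun y => u y * (complex.Im (c k) * cos (dotv (t k) y) - complex.Re (c k) * sin (dotv (t k) y))).
  by have [_] := ii [:: k]; under eq_fun do rewrite /= /trigIm big_seq1.
elim: s => [|k s [IH1 IH2]].
  have z1 : (fun y => u y * trigRe [::] c t y) = fun=> 0.
    by apply/funext => y; rewrite /trigRe big_nil mulr0.
  have z2 : (fun y => u y * trigIm [::] c t y) = fun=> 0.
    by apply/funext => y; rewrite /trigIm big_nil mulr0.
  have z3 : fcos (fun=> 0) x = 0 :> R.
    by rewrite /fcos; under eq_Rintegral do rewrite mul0r; rewrite Rintegral_cst// mul0r.
  have z4 : fsin (fun=> 0) x = 0 :> R.
    by rewrite /fsin; under eq_Rintegral do rewrite mul0r; rewrite Rintegral_cst// mul0r.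
  by rewrite !big_nil z1 z2 z3 z4 subrr addr0.
have e1 : (fun y => u y * trigRe (k :: s) c t y) = (fun y =>
    u y * (complex.Re (c k) * cos (dotv (t k) y) + complex.Im (c k) * sin (dotv (t k) y)) +
    u y * trigRe s c t y).
  by apply/funext => y; rewrite /trigRe big_cons mulrDr.
have e2 : (fun y => u y * trigIm (k :: s) c t y) = (fun y =>
    u y * (complex.Im (c k) * cos (dotv (t k) y) - complex.Re (c k) * sin (dotv (t k) y)) +
    u y * trigIm s c t y).
  by apply/funext => y; rewrite /trigIm big_cons mulrDr.
have [j1 j2] := ii s.
have [f1 f2] := fourier_shift_one x (t k) (complex.Re (c k)) (complex.Im (c k)) un.
rewrite e1 e2 !big_cons IH1 IH2 f1 f2.
rewrite (fcosD _ (i1 k) j1) (fsinD _ (i2 k) j2) (fsinD _ (i1 k) j1) (fcosD _ (i2 k) j2).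
by split; [rewrite opprD addrACA|rewrite addrACA].
Qed.

End trigonometric_sums.

Lemma eq_cvg_trans (R : realType) (f g : nat -> R) (l : R) : f = g ->
  g n @[n --> \oo] --> l -> f n @[n --> \oo] --> l.
Proof. by move=> ->. Qed.

Lemma cvgnD (R : realType) (f g : nat -> R) (a b : R) :
  f n @[n --> \oo] --> a -> g n @[n --> \oo] --> b -> f n + g n @[n --> \oo] --> a + b.
Proof. exact: cvgD. Qed.

Lemma cvgnB (R : realType) (f g : nat -> R) (a b : R) :
  f n @[n --> \oo] --> a -> g n @[n --> \oo] --> b -> f n - g n @[n --> \oo] --> a - b.
Proof. exact: cvgB. Qed.

Lemma cvgnMl (R : realType) (f : nat -> R) (c a : R) :
  f n @[n --> \oo] --> a -> c * f n @[n --> \oo] --> c * a.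
Proof. by move=> fa; apply: cvgM fa; exact: cvg_cst. Qed.

(** * The inverse transform of a real function and its translates *)

Section inverse_transform.
Context (R : realType) (d : nat).
Local Notation integ f := ((lebesgue R d).-integrable setT (EFin \o f)).
Local Notation leb := (lebesgue R d).
Variables (h : 'cV[R]_d -> R) (M : R).
Hypotheses (ch : continuous h) (hM : forall x, `|h x| <= M)
  (hi : integ (fun x => h x ^+ 2)).

Let c : R := (2 * pi) ^- d.

Let c_neq0 : (2 * pi) ^+ d != 0 :> R.
Proof. by rewrite expf_neq0// mulf_neq0// lt0r_neq0// pi_gt0. Qed.

(** A trigonometric polynomial is bounded, so the square integrability of [h]
    passes to its products with one and to the limit. *)
Let limit_mul (u : nat -> 'cV[R]_d -> R) (v : 'cV[R]_d -> R) N :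
  (forall j, nice (u j)) -> (forall j x, `|u j x| <= `|h x|) ->
  (forall x, u j x @[j --> \oo] --> h x) -> continuous v -> (forall x, `|v x| <= N) ->
  integ (fun x => (h x * v x) ^+ 2) /\
  \int[leb]_x ((u j x * v x) ^+ 2) @[j --> \oo] --> \int[leb]_x ((h x * v x) ^+ 2).
Proof.
move=> un uh uc cv vN.
have mv := continuous_measurable_cv cv; have mh := continuous_measurable_cv ch.
have N0 : 0 <= N by apply: le_trans (vN 0).
apply: (@Rintegral_dominated_convergence _ _ _ leb (fun j x => (u j x * v x) ^+ 2) _
  (fun x => h x ^+ 2 * N ^+ 2)).
- move=> j; apply: measurable_funX; apply: measurable_funM => //.
  exact: nice_measurable (un j).
- by apply: measurable_funX; exact: measurable_funM.
- apply/aeW => x.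
  have H : u j x * v x @[j --> \oo] --> h x * v x by apply: cvgM (uc x) _; exact: cvg_cst.
  exact: (cvgM H H).
- by apply: (@integ_mul _ _ _ _ _ _ `|N ^+ 2|).
- apply/aeW => x j; rewrite ger0_norm ?sqr_ge0// exprMn.
  rewrite -(real_normK (num_real (u j x))) -(real_normK (num_real (v x))).
  rewrite -(real_normK (num_real (h x))) ler_pM ?sqr_ge0// ler_pXn2r ?nnegrE//.
Qed.

Lemma fourier_parts (g : 'cV[R]_d -> R[i]) xi :
  integ (fun x => complex.Re (g x)) -> integ (fun x => complex.Im (g x)) ->
  complex.Re (fourier g xi) = fcos (fun x => complex.Re (g x)) xi + fsin (fun x => complex.Im (g x)) xi /\
  complex.Im (fourier g xi) = fcos (fun x => complex.Im (g x)) xi - fsin (fun x => complex.Re (g x)) xi.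
Proof.
move=> ui vi; rewrite /fourier /integralC /=; split.
- rewrite /fcos /fsin -(RintegralD measurableT (integ_mul_cosk xi ui) (integ_mul_sink xi vi)).
  apply: eq_Rintegral => x _; rewrite ReM /= cosN sinN mulrN opprK.
  by rewrite /cosk /sink.
- rewrite /fcos /fsin -(RintegralB measurableT (integ_mul_cosk xi vi) (integ_mul_sink xi ui)).
  by apply: eq_Rintegral => x _; rewrite ImM /= cosN sinN mulrN addrC.
Qed.

(** Real form of Plancherel's formula for the unnormalized inverse transform of
    [u * (al + i * be)]; the cross terms cancel by [plancherel_cross]. *)
Lemma plancherel_sums (u al be : 'cV[R]_d -> R) : nice (fun x => u x * al x) ->
  nice (fun x => u x * be x) ->
  let a := fun x => u x * al x in let b := fun x => u x * be x in
  [/\ integ (fun x => (fcos a x - fsin b x) ^+ 2), integ (fun x => (fsin a x + fcos b x) ^+ 2) &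
  \int[leb]_x ((fcos a x - fsin b x) ^+ 2) + \int[leb]_x ((fsin a x + fcos b x) ^+ 2) =
  (2 * pi) ^+ d * (\int[leb]_x (a x ^+ 2) + \int[leb]_x (b x ^+ 2))].
Proof.
move=> an bn a b; have [_ _ ai] := an; have [_ _ bi] := bn.
have sq (v w : 'cV[R]_d -> R) : measurable_fun setT v -> measurable_fun setT w ->
    integ (fun x => v x ^+ 2) -> integ (fun x => w x ^+ 2) ->
    integ (fun x => (v x + w x) ^+ 2).
  move=> mv mw vi wi; apply: (@integ_le _ _ _ _ _ (fun x => 2 * v x ^+ 2 + 2 * w x ^+ 2)).
  - by apply: measurable_funX; exact: measurable_funD.
  - move=> x; rewrite ger0_norm ?sqr_ge0//; have := sqr_ge0 (v x - w x); nra.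
  - by apply: integD; apply: integZ.
have mca := measurable_fcos ai; have msa := measurable_fsin ai.
have mcb := measurable_fcos bi; have msb := measurable_fsin bi.
have i1 : integ (fun x => (fcos a x - fsin b x) ^+ 2).
  apply: (sq (fcos a) (fun x => - fsin b x) mca _ (integ_fcos_sq an)).
    exact: measurableT_comp.
  by under eq_fun do rewrite /= sqrrN; exact: integ_fsin_sq.
have i2 : integ (fun x => (fsin a x + fcos b x) ^+ 2).
  by apply: sq => //; [exact: integ_fsin_sq|exact: integ_fcos_sq].
have ja := integ_fourier_sq an; have jb := integ_fourier_sq bn.
have jc := integB (integ_fcos_fsin an bn) (integ_fsin_fcos an bn).
split => //; rewrite -(RintegralD measurableT i1 i2).
have pa := plancherel an an; have pb := plancherel bn bn.
have pc := plancherel_cross an bn.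
transitivity (\int[leb]_x (fcos a x * fcos a x + fsin a x * fsin a x) +
   \int[leb]_x (fcos b x * fcos b x + fsin b x * fsin b x) -
   2 * \int[leb]_x (fcos a x * fsin b x - fsin a x * fcos b x)); last first.
  rewrite [X in X + _ - _]pa [X in _ + X - _]pb [X in _ - 2 * X]pc mulr0 subr0 -mulrDr.
  by congr (_ * (_ + _)); apply: eq_Rintegral => x _; rewrite expr2.
rewrite -(RintegralZl 2 measurableT jc) -(RintegralD measurableT ja jb).
rewrite -(RintegralB measurableT (integD ja jb) (integZ 2 jc)).
by apply: eq_Rintegral => x _; ring.
Qed.

(** The inverse transform is [(2 * pi) ^- d * (F1 + i * F2)], where [F1] and [F2] are
    the limits of the cosine and sine transforms of truncations of [h]. Its pairings
    and the norms of combinations of its translates are limits of those of the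
    truncations, to which Plancherel's formula applies. *)
Theorem L2_inverse_transform : exists f : 'cV[R]_d -> R[i],
  [/\ L2 f,
      forall g, nice (fun x => complex.Re (g x)) -> nice (fun x => complex.Im (g x)) ->
        function_distribution f (fourier g) =
        function_distribution (fun xi => (h xi)%:C%C) g &
      forall (s : seq 'cV[int]_d) (w : 'cV[int]_d -> R[i]),
        sqnormL2 (lincomb (integer_shifts f) s w) =
        (c * (\int[leb]_x ((h x * trigRe s w (fun k => real_mx R k) x) ^+ 2) +
              \int[leb]_x ((h x * trigIm s w (fun k => real_mx R k) x) ^+ 2)))%:E].
Proof.
have [u [F1 [F2 [E [[un uh uc] [mF1 mF2 Ei ae]]]]]] := L2_inversion ch hM hi.
have ui j : integ (u j) by have [_ _] := un j.
have cv1 : cvL2 (fun j => fcos (u j)) F1.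
  split => //; [by move=> j; exact: measurable_fcos|by apply: filterS ae => x []|].
  by exists E => //; apply: filterS ae => x [_ _ h'] j; have [] := h' j.
have cv2 : cvL2 (fun j => fsin (u j)) F2.
  split => //; [by move=> j; exact: measurable_fsin|by apply: filterS ae => x []|].
  by exists E => //; apply: filterS ae => x [_ _ h'] j; have [] := h' j.
pose f x : R[i] := Complex (c * F1 x) (c * F2 x).
have mf : Defs.measurableC f by split; apply: measurable_funM.
have [F1i _] := cvL2_sq cv1; have [F2i _] := cvL2_sq cv2.
exists f; split.
- split => //; rewrite /sqnormL2.
  have fi : integ (fun x => (c * F1 x) ^+ 2 + (c * F2 x) ^+ 2).
    by apply: integD; under eq_fun do rewrite /= exprMn; apply: integZ.
  under eq_integral do rewrite sqr_normc.
  by rewrite -(EFin_Rintegral fi) ltry.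
- move=> g Ren Imn; have [_ _ Rei] := Ren; have [_ _ Imi] := Imn.
  have pairing (v : 'cV[R]_d -> R) : nice v ->
      [/\ integ (fun x => F1 x * fcos v x + F2 x * fsin v x),
          integ (fun x => F1 x * fsin v x - F2 x * fcos v x),
          \int[leb]_x (F1 x * fcos v x + F2 x * fsin v x) = (2 * pi) ^+ d * \int[leb]_x (h x * v x) &
          \int[leb]_x (F1 x * fsin v x - F2 x * fcos v x) = 0].
    move=> vn; have [_ [N vN] vi] := vn.
    have mc := measurable_fcos vi; have ms := measurable_fsin vi.
    have [a1 b1] := cvL2_pair cv1 mc (integ_fcos_sq vn).
    have [a2 b2] := cvL2_pair cv2 ms (integ_fsin_sq vn).
    have [a3 b3] := cvL2_pair cv1 ms (integ_fsin_sq vn).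
    have [a4 b4] := cvL2_pair cv2 mc (integ_fcos_sq vn).
    split; [exact: integD|exact: integB| |].
    - rewrite (RintegralD measurableT a1 a2).
      have lim1 := cvgnD b1 b2.
      have eq1 j : \int[leb]_x (fcos (u j) x * fcos v x) + \int[leb]_x (fsin (u j) x * fsin v x) =
          (2 * pi) ^+ d * \int[leb]_x (u j x * v x).
        rewrite -(RintegralD measurableT (integ_fcos_fcos (un j) vn) (integ_fsin_fsin (un j) vn)).
        exact: plancherel.
      have lim2 : \int[leb]_x (u j x * v x) @[j --> \oo] --> \int[leb]_x (h x * v x).
        have [| | | | |_ //] := @Rintegral_dominated_convergence _ _ _ leb
          (fun j x => u j x * v x) (fun x => h x * v x) (fun x => `|v x| * M).
        + by move=> j; apply: measurable_funM; exact: nice_measurable.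
        + by apply: measurable_funM; [exact: continuous_measurable_cv|exact: nice_measurable].
        + by apply/aeW => x; apply: cvgM (uc x) _; exact: cvg_cst.
        + by apply: (@integ_mul _ _ _ _ _ _ `|M|) => //; exact: integrable_norm.
        + apply/aeW => x j; rewrite normrM mulrC ler_wpM2l//.
          exact: le_trans (uh j x) (@hM x).
      have lim3 := cvgnMl (c := (2 * pi) ^+ d) lim2.
      have eq2 : (fun j => \int[leb]_x (fcos (u j) x * fcos v x) +
          \int[leb]_x (fsin (u j) x * fsin v x)) =
          (fun j => (2 * pi) ^+ d * \int[leb]_x (u j x * v x)).
        by apply/funext => j; exact: eq1.
      exact: (cvg_unique _ lim1 (eq_cvg_trans eq2 lim3)).
    - rewrite (RintegralB measurableT a3 a4).
      have lim1 := cvgnB b3 b4.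
      have eq2 : (fun j => \int[leb]_x (fcos (u j) x * fsin v x) -
          \int[leb]_x (fsin (u j) x * fcos v x)) = (fun=> 0).
        apply/funext => j.
        rewrite -[LHS](RintegralB measurableT (integ_fcos_fsin (un j) vn) (integ_fsin_fcos (un j) vn)).
        exact: plancherel_cross.
      exact: (cvg_unique _ lim1 (eq_cvg_trans eq2 (cvg_cst 0))).
  have [p1 p2 p3 p4] := pairing _ Ren; have [q1 q2 q3 q4] := pairing _ Imn.
  have cK : c * (2 * pi) ^+ d = 1 by rewrite mulVf.
  apply: complex_eq.
  + transitivity (c * (\int[leb]_x (F1 x * fcos (fun x => complex.Re (g x)) x +
          F2 x * fsin (fun x => complex.Re (g x)) x) +
        \int[leb]_x (F1 x * fsin (fun x => complex.Im (g x)) x -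
          F2 x * fcos (fun x => complex.Im (g x)) x))).
      rewrite -(RintegralD measurableT p1 q2) -(RintegralZl c measurableT (integD p1 q2)).
      apply: eq_Rintegral => x _; have [e1 e2] := fourier_parts x Rei Imi.
      by rewrite ReM e1 e2 /=; ring.
    rewrite p3 q4 addr0 mulrA cK mul1r; apply: eq_Rintegral => x _.
    by rewrite ReM /= mul0r subr0.
  + transitivity (c * (\int[leb]_x (F1 x * fcos (fun x => complex.Im (g x)) x +
          F2 x * fsin (fun x => complex.Im (g x)) x) -
        \int[leb]_x (F1 x * fsin (fun x => complex.Re (g x)) x -
          F2 x * fcos (fun x => complex.Re (g x)) x))).
      rewrite -(RintegralB measurableT q1 p2) -(RintegralZl c measurableT (integB q1 p2)).
      apply: eq_Rintegral => x _; have [e1 e2] := fourier_parts x Rei Imi.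
      by rewrite ImM e1 e2 /=; ring.
    rewrite q3 p4 subr0 mulrA cK mul1r; apply: eq_Rintegral => x _.
    by rewrite ImM /= mul0r addr0.
- move=> s w.
  pose t := fun k : 'cV[int]_d => real_mx R k.
  pose v1 j x := c * \sum_(k <- s) (complex.Re (w k) * fcos (u j) (x - t k) -
     complex.Im (w k) * fsin (u j) (x - t k)).
  pose v2 j x := c * \sum_(k <- s) (complex.Re (w k) * fsin (u j) (x - t k) +
     complex.Im (w k) * fcos (u j) (x - t k)).
  pose V1 x := c * \sum_(k <- s) (complex.Re (w k) * F1 (x - t k) -
     complex.Im (w k) * F2 (x - t k)).
  pose V2 x := c * \sum_(k <- s) (complex.Re (w k) * F2 (x - t k) +
     complex.Im (w k) * F1 (x - t k)).
  have cV1 : cvL2 v1 V1.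
    apply: cvL2Z; apply: cvL2_sum => k.
    have := cvL2D (cvL2Z (complex.Re (w k)) (cvL2_shift (t k) cv1))
                  (cvL2Z (- complex.Im (w k)) (cvL2_shift (t k) cv2)).
    under eq_fun do under eq_fun do rewrite mulNr.
    by under [X in cvL2 _ X -> _]eq_fun do rewrite mulNr.
  have cV2 : cvL2 v2 V2.
    apply: cvL2Z; apply: cvL2_sum => k.
    exact: (cvL2D (cvL2Z (complex.Re (w k)) (cvL2_shift (t k) cv2))
                  (cvL2Z (complex.Im (w k)) (cvL2_shift (t k) cv1))).
  have [iV1 l1] := cvL2_sq cV1; have [iV2 l2] := cvL2_sq cV2.
  have lc x : complex.Re (lincomb (integer_shifts f) s w x) = V1 x /\
      complex.Im (lincomb (integer_shifts f) s w x) = V2 x.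
    rewrite /lincomb Re_sum Im_sum /V1 /V2 !mulr_sumr.
    by split; apply: eq_bigr => k _; rewrite ?ReM ?ImM /integer_shifts/=; ring.
  rewrite /sqnormL2.
  under eq_integral => x _.
    rewrite sqr_normc; have [-> ->] := lc x; over.
  rewrite -(EFin_Rintegral (integD iV1 iV2)) (RintegralD measurableT iV1 iV2).
  congr EFin.
  have n1 j := nice_mul (un j) (@continuous_trigRe R d _ s w t) (norm_trigRe s w t).
  have n2 j := nice_mul (un j) (@continuous_trigIm R d _ s w t) (norm_trigIm s w t).
  have [g1 m1] := limit_mul un uh uc (@continuous_trigRe R d _ s w t) (norm_trigRe s w t).
  have [g2 m2] := limit_mul un uh uc (@continuous_trigIm R d _ s w t) (norm_trigIm s w t).
  have lim1 := cvgnD l1 l2; have lim2 := cvgnMl (c := c) (cvgnD m1 m2).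
  suff eq1 : (fun j => \int[leb]_x (v1 j x ^+ 2) + \int[leb]_x (v2 j x ^+ 2)) =
      (fun j => c * (\int[leb]_x ((u j x * trigRe s w t x) ^+ 2) +
     \int[leb]_x ((u j x * trigIm s w t x) ^+ 2))).
    exact: (cvg_unique _ lim1 (eq_cvg_trans eq1 lim2)).
  apply/funext => j; have [k1 k2 k3] := plancherel_sums (n1 j) (n2 j).
  transitivity (c ^+ 2 * \int[leb]_x ((fcos (fun y => u j y * trigRe s w t y) x -
        fsin (fun y => u j y * trigIm s w t y) x) ^+ 2) +
      c ^+ 2 * \int[leb]_x ((fsin (fun y => u j y * trigRe s w t y) x +
        fcos (fun y => u j y * trigIm s w t y) x) ^+ 2)).
    rewrite -(RintegralZl (c ^+ 2) measurableT k1) -(RintegralZl (c ^+ 2) measurableT k2).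
    congr (_ + _); apply: eq_Rintegral => x _; have [s1 s2] := fourier_shift x s w t (un j).
      by rewrite /v1 s1 exprMn.
    by rewrite /v2 s2 exprMn.
  by rewrite -mulrDr k3 mulrA expr2 -(mulrA c c) mulVf// mulr1.
Qed.

End inverse_transform.

(** * Orthogonality of characters and Riesz bounds *)

Section orthogonality.
Context (R : realType) (d : nat).
Local Notation integ f := ((lebesgue R d).-integrable setT (EFin \o f)).
Local Notation leb := (lebesgue R d).

Lemma Rintegral_sum (K : Type) (s : seq K) (f : K -> 'cV[R]_d -> R) :
  (forall k, integ (f k)) -> integ (fun x => \sum_(k <- s) f k x) /\
  \int[leb]_x (\sum_(k <- s) f k x) = \sum_(k <- s) \int[leb]_x f k x.
Proof.
move=> fi; elim: s => [|k s [IH1 IH2]].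
  have -> : (fun x => \sum_(k <- [::]) f k x) = fun=> 0.
    by apply/funext => x; rewrite big_nil.
  by rewrite big_nil Rintegral_cst// mul0r; split => //; exact: integrable0.
have -> : (fun x => \sum_(i <- k :: s) f i x) = fun x => f k x + \sum_(i <- s) f i x.
  by apply/funext => x; rewrite big_cons.
by rewrite big_cons; split; [exact: integD|rewrite RintegralD// IH2].
Qed.

Definition cube (L : nat) : 'cV[R]_d -> R := @pweight R (@periods R L) d.

Lemma integ_cube L : integ (cube L).
Proof. by apply: integ_pweight; [exact: periods_ge0|exact: integ1_periods]. Qed.

Lemma cube_ge0 L x : 0 <= cube L x.
Proof. by apply: pweight_ge0; exact: periods_ge0. Qed.

Lemma cube_le1 L x : cube L x <= 1.
Proof.
apply: prodr_ile1 => i _; rewrite periods_ge0/= /periods indicE.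
by case: (_ \in _) => /=.
Qed.

Lemma cube_in L (x : 'cV[R]_d) : (forall i, `|x i ord0| <= pi * L%:R) -> cube L x = 1.
Proof.
move=> xL; apply: big1 => i _.
by rewrite /periods indicE mem_setE in_itv/= -(ler_norml (x i ord0) (pi * L%:R)) xL.
Qed.

Lemma cube_out L (x : 'cV[R]_d) : cube L x != 0 -> forall i, `|x i ord0| <= pi * L%:R.
Proof.
move=> /prodf_neq0 xL i; have := xL i isT.
by rewrite /periods indicE mem_setE in_itv/= -(ler_norml (x i ord0) (pi * L%:R)); case: (_ <= _) => //=; rewrite eqxx.
Qed.

(** Integer frequencies: the sides of the cube contain whole periods, so one factor
    of the product vanishes as soon as the frequencies differ. *)
Lemma Rintegral_cube_exp L (k l : 'cV[int]_d) :
  \int[leb]_x (cube L x * cos (dotv (real_mx R k - real_mx R l) x)) =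
    (k == l)%:R * (2 * pi * L%:R) ^+ d /\
  \int[leb]_x (cube L x * sin (dotv (real_mx R k - real_mx R l) x)) = 0.
Proof.
have [-> ->] := Rintegral_pweight_trig (t := real_mx R k - real_mx R l)
  (@periods_ge0 R L) (integ1_periods R L) (fun i => Rintegral_periods_sin L _).
split => //; have [->|kl] := eqVneq k l.
  rewrite subrr mul1r -[in RHS](card_ord d) -prodr_const; apply: eq_bigr => i _.
  rewrite mxE -(Rintegral_periods R L); apply: eq_Rintegral => x _.
  by rewrite mul0r cos0 mulr1.
have [i ki] : exists i, k i ord0 != l i ord0.
  apply/existsP; rewrite -negb_forall; apply: contra kl => /forallP kl.
  by apply/eqP/matrixP => i j; rewrite (ord1 j); apply/eqP.
rewrite mul0r; apply/eqP/prodf_eq0; exists i => //.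
rewrite !mxE -intrB; apply/eqP; apply: Rintegral_periods_cos.
by rewrite subr_eq0.
Qed.

(** Orthogonality reduces the double sum of the squared modulus to its diagonal. *)
Lemma Rintegral_cube_trig L (s : seq 'cV[int]_d) (c : 'cV[int]_d -> R[i]) : uniq s ->
  integ (fun x => cube L x * (trigRe s c (fun k => real_mx R k) x ^+ 2 +
                              trigIm s c (fun k => real_mx R k) x ^+ 2)) /\
  \int[leb]_x (cube L x * (trigRe s c (fun k => real_mx R k) x ^+ 2 +
                           trigIm s c (fun k => real_mx R k) x ^+ 2)) =
  (2 * pi * L%:R) ^+ d * \sum_(k <- s) normc (c k) ^+ 2.
Proof.
move=> us.
pose p k := complex.Re (c k); pose r k := complex.Im (c k).
pose t k := real_mx R k : 'cV[R]_d.
pose F k l x := (p k * p l + r k * r l) * (cube L x * cos (dotv (t k - t l) x)) +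
                (r k * p l - p k * r l) * (cube L x * sin (dotv (t k - t l) x)).
have E x : cube L x * (trigRe s c t x ^+ 2 + trigIm s c t x ^+ 2) =
    \sum_(k <- s) \sum_(l <- s) F k l x.
  rewrite !expr2 /trigRe /trigIm !big_distrlr/= -big_split mulr_sumr/=.
  apply: eq_bigr => k _; rewrite -big_split mulr_sumr/=; apply: eq_bigr => l _.
  rewrite /F !(dotvC _ x) dotvBr cosB sinB -/(p k) -/(p l) -/(r k) -/(r l).
  by move: (cube L x) => w; ring.
have iC k l := integZ (p k * p l + r k * r l) (integ_mul_cos (t k - t l) (integ_cube L)).
have iS k l := integZ (r k * p l - p k * r l) (integ_mul_sin (t k - t l) (integ_cube L)).
have iF k l : integ (F k l) by exact: (integD (iC k l) (iS k l)).
have [i1 e1] : integ (fun x => \sum_(k <- s) \sum_(l <- s) F k l x) /\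
    \int[leb]_x (\sum_(k <- s) \sum_(l <- s) F k l x) =
    \sum_(k <- s) \sum_(l <- s) \int[leb]_x F k l x.
  have [a b] := @Rintegral_sum _ s (fun k x => \sum_(l <- s) F k l x)
    (fun k => (Rintegral_sum s (iF k)).1).
  by rewrite b; split => //; apply: eq_bigr => k _; exact: (Rintegral_sum s (iF k)).2.
have -> : (fun x => cube L x * (trigRe s c t x ^+ 2 + trigIm s c t x ^+ 2)) =
    (fun x => \sum_(k <- s) \sum_(l <- s) F k l x) by apply/funext.
split; first exact: i1.
rewrite [LHS]e1 mulr_sumr; apply: eq_big_seq => k ks.
have FE l : \int[leb]_x F k l x = (k == l)%:R * (2 * pi * L%:R) ^+ d * (p k * p l + r k * r l).
  have [h1 h2] := Rintegral_cube_exp L k l.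
  rewrite /F (RintegralD measurableT (iC k l) (iS k l)).
  rewrite (RintegralZl _ measurableT (integ_mul_cos (t k - t l) (integ_cube L))).
  rewrite (RintegralZl _ measurableT (integ_mul_sin (t k - t l) (integ_cube L))).
  by rewrite h1 h2 mulr0 addr0 mulrC.
rewrite (bigD1_seq k)//= big1 => [|l lk]; last by rewrite FE eq_sym (negbTE lk) !mul0r.
by rewrite FE eqxx mul1r addr0 sqr_normc -!expr2.
Qed.

End orthogonality.

Section cube_domination.
Context (R : realType) (d : nat).
Local Notation integ f := ((lebesgue R d).-integrable setT (EFin \o f)).
Local Notation leb := (lebesgue R d).
Variables (h : 'cV[R]_d -> R) (a : nat -> R) (L : nat -> nat) (K r : R).
Hypotheses (ch : continuous h) (r01 : 0 <= r < 1) (a0 : forall n, 0 <= a n)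
  (aL : forall n, a n * (2 * pi * (L n)%:R) ^+ d <= K * r ^+ n)
  (ha : forall x, exists n, h x ^+ 2 <= a n * cube (L n) x).

(** At each point some term of the series of the [a n * cube (L n)] dominates
    [h x ^+ 2]; the series is integrated term by term against [T]. *)
Lemma integral_cube_dominated (T : 'cV[R]_d -> R) (S : R) :
  measurable_fun setT T -> (forall x, 0 <= T x) -> 0 <= S ->
  (forall n, integ (fun x => cube n x * T x)) ->
  (forall n, \int[leb]_x (cube n x * T x) = (2 * pi * n%:R) ^+ d * S) ->
  (\int[leb]_x (h x ^+ 2 * T x)%:E <= (K / (1 - r) * S)%:E)%E.
Proof.
move=> mT T0 S0 iT eT.
pose g n x := ((a n * (cube (L n) x * T x))%:E)%E.
have g0 n x : (0 <= g n x)%E by rewrite lee_fin !mulr_ge0// cube_ge0.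
have ig n : integ (fun x => a n * (cube (L n) x * T x)) by exact: integZ.
have mg n : measurable_fun setT (g n) by exact: measurable_int (ig n).
have mh := continuous_measurable_cv ch.
apply: (@le_trans _ _ (\int[leb]_x \sum_(0 <= n <oo) g n x)%E).
  apply: ge0_le_integral => //.
  - by move=> x _; rewrite lee_fin mulr_ge0// sqr_ge0.
  - by apply/measurable_EFinP; apply: measurable_funM => //; exact: measurable_funX.
  - by apply: ge0_emeasurable_sum => // n x _ _; exact: g0.
  - move=> x _; have [n hn] := ha x.
    apply: (@le_trans _ _ (g n x)); first by rewrite lee_fin mulrA ler_wpM2r.
    apply: (@le_trans _ _ (\sum_(0 <= i < n.+1) g i x)%E); last first.
      by apply: nneseries_lim_ge => i _ _; exact: g0.
    by rewrite big_nat_recr//= -[leLHS]add0e leeD2r// sume_ge0.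
rewrite integral_nneseries//.
apply: (@le_trans _ _ (\sum_(0 <= n <oo) ((K * S) * r ^+ n)%:E)%E).
  apply: lee_nneseries => n _; first by rewrite integral_ge0.
  rewrite /g -(EFin_Rintegral (ig n)) (RintegralZl _ measurableT (iT (L n))) eT lee_fin.
  by rewrite mulrA (mulrAC K) ler_wpM2r.
by rewrite nneseries_geometric// lee_fin mulrAC.
Qed.

Lemma integ_cube_dominated : integ (fun x => h x ^+ 2).
Proof.
apply: integ_ge0P.
- by apply: measurable_funX; exact: continuous_measurable_cv.
- by move=> x; exact: sqr_ge0.
- have := @integral_cube_dominated (fun=> 1) 1 (@measurable_cst _ _ _ _ _ _) (fun=> ler01) ler01.
  move=> H; rewrite (eq_integral (fun x => (h x ^+ 2 * 1)%:E)); last first.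
    by move=> x _; rewrite mulr1.
  apply: le_lt_trans (H _ _) (ltry _) => n.
    by under eq_fun do rewrite /= mulr1; exact: integ_cube.
  under eq_Rintegral do rewrite mulr1.
  rewrite (@Rintegral_pweight R _ d (@periods_ge0 R n) (integ1_periods R n)).
  by rewrite Rintegral_periods mulr1.
Qed.

End cube_domination.

Section riesz.
Context (R : realType) (d : nat).
Local Notation integ f := ((lebesgue R d).-integrable setT (EFin \o f)).
Local Notation leb := (lebesgue R d).
Variables (h : 'cV[R]_d -> R) (M : R) (a : nat -> R) (L : nat -> nat) (K r m : R).
Hypotheses (ch : continuous h) (hM : forall x, `|h x| <= M)
  (K0 : 0 < K) (r01 : 0 <= r < 1) (a0 : forall n, 0 <= a n)
  (aL : forall n, a n * (2 * pi * (L n)%:R) ^+ d <= K * r ^+ n)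
  (ha : forall x, exists n, h x ^+ 2 <= a n * cube (L n) x)
  (m0 : 0 < m) (hm : forall x : 'cV[R]_d, (forall i, `|x i ord0| <= pi) -> m <= h x ^+ 2).

Let hi := integ_cube_dominated ch r01 a0 aL ha.

(** The lower bound keeps only the cube of one period, where [h ^+ 2] is at least [m];
    the upper bound is [integral_cube_dominated]. *)
Lemma trig_bounds (s : seq 'cV[int]_d) (w : 'cV[int]_d -> R[i]) : uniq s ->
  let I := \int[leb]_x ((h x * trigRe s w (fun k => real_mx R k) x) ^+ 2) +
           \int[leb]_x ((h x * trigIm s w (fun k => real_mx R k) x) ^+ 2) in
  m * (2 * pi) ^+ d * \sum_(k <- s) normc (w k) ^+ 2 <= I /\
  I <= K / (1 - r) * \sum_(k <- s) normc (w k) ^+ 2.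
Proof.
move=> us I.
pose t k := real_mx R k : 'cV[R]_d.
pose T x := trigRe s w t x ^+ 2 + trigIm s w t x ^+ 2.
have T0 x : 0 <= T x by rewrite addr_ge0// sqr_ge0.
have cR := @continuous_trigRe R d _ s w t; have cI := @continuous_trigIm R d _ s w t.
have mR := continuous_measurable_cv cR; have mI := continuous_measurable_cv cI.
have mT : measurable_fun setT T by apply: measurable_funD; exact: measurable_funX.
have S0 : 0 <= \sum_(k <- s) normc (w k) ^+ 2 by apply: sumr_ge0 => k _; exact: sqr_ge0.
have sqi (v : 'cV[R]_d -> R) N : measurable_fun setT v -> (forall x, `|v x| <= N) ->
    integ (fun x => (h x * v x) ^+ 2).
  move=> mv vN; under eq_fun do rewrite /= exprMn.
  apply: (integ_mul (C := N ^+ 2) hi); first exact: measurable_funX.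
  move=> x; rewrite ger0_norm ?sqr_ge0// -(real_normK (num_real (v x))).
  by rewrite ler_pXn2r ?nnegrE//; exact: le_trans (vN x).
have iR := sqi _ _ mR (norm_trigRe s w t); have iI := sqi _ _ mI (norm_trigIm s w t).
have iT : integ (fun x => h x ^+ 2 * T x).
  have := integD iR iI; congr (integrable _ _ _); apply/funext => x /=.
  by rewrite /T mulrDr !exprMn.
have -> : I = \int[leb]_x (h x ^+ 2 * T x).
  rewrite /I -(RintegralD measurableT iR iI); apply: eq_Rintegral => x _.
  by rewrite /T mulrDr !exprMn.
have ct n := @Rintegral_cube_trig R d n s w us.
split.
- have [c1 c2] := ct 1; rewrite mulr1 in c2.
  rewrite -mulrA -c2 -(RintegralZl m measurableT c1).
  apply: (le_Rintegral measurableT (integZ m c1) iT) => x _; rewrite mulrA ler_wpM2r; [by []|exact: T0|].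
  have [->|/cube_out xc] := eqVneq (cube 1 x) 0; first by rewrite mulr0 sqr_ge0.
  apply: (@le_trans _ _ m); first by rewrite ler_piMr ?cube_le1 ?ltW.
  by apply: hm => i; have := xc i; rewrite mulr1.
- rewrite -lee_fin (EFin_Rintegral iT).
  exact: (integral_cube_dominated ch r01 a0 aL ha mT T0 S0 (fun n => (ct n).1) (fun n => (ct n).2)).
Qed.

Theorem riesz_inverse_transform : exists f : 'cV[R]_d -> R[i],
  [/\ L2 f,
      forall g, nice (fun x => complex.Re (g x)) -> nice (fun x => complex.Im (g x)) ->
        function_distribution f (fourier g) =
        function_distribution (fun xi => (h xi)%:C%C) g &
      riesz_basis (closed_span (integer_shifts f)) (integer_shifts f)].
Proof.
have [f [f2 fp fg]] := L2_inverse_transform ch hM hi.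
exists f; split => //.
have pi2 : 0 < (2 * pi) ^+ d :> R by rewrite exprn_gt0// mulr_gt0// pi_gt0.
have r1 : 0 < 1 - r by have /andP[_] := r01; rewrite subr_gt0.
split => //.
- move=> k; split; last first.
    move=> e e0; exists [:: k], (fun=> 1).
    rewrite /sqnormL2 (eq_integral (fun=> 0%E)) ?integral0 ?lte_fin// => x _.
    by rewrite /lincomb big_seq1 mul1r subrr sqr_normc/= expr0n addr0.
  have -> : integer_shifts f k = lincomb (integer_shifts f) [:: k] (fun=> 1).
    by apply/funext => x; rewrite /lincomb big_seq1 mul1r.
  split; last by rewrite fg ltry.
  have [mf1 mf2] := f2.1.
  have mt : measurable_fun setT (fun x : 'cV[R]_d => x - real_mx R k).
    have := measurable_affine_cv (- real_mx R k) 1.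
    by under eq_fun do rewrite scale1r addrC.
  have -> : lincomb (integer_shifts f) [:: k] (fun=> 1) = fun x => f (x - real_mx R k).
    by apply/funext => x; rewrite /lincomb big_seq1 mul1r.
  by split; [exact: (measurableT_comp mf1 mt)|exact: (measurableT_comp mf2 mt)].
- exists m, ((2 * pi) ^- d * (K / (1 - r))); split => //.
    by rewrite mulr_gt0 ?invr_gt0// divr_gt0.
  move=> s w us; rewrite fg !lee_fin; have [b1 b2] := trig_bounds w us; split.
    by rewrite [leRHS]mulrC ler_pdivlMr// mulrAC.
  by rewrite -mulrA ler_wpM2l// invr_ge0 ltW.
Qed.

End riesz.

(** * Schwartz functions and tempered distributions *)

Section lipschitz_along_axes.
Context (R : realType) (d : nat).
Implicit Types (f : 'cV[R]_d -> R) (x y z : 'cV[R]_d).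

Lemma is_derive_line f z (v : 'cV[R]_d) (t : R) :
  derivable f (z + t *: v) v ->
  is_derive t (1 : R) (fun s : R => f (z + s *: v)) ('D_v f (z + t *: v)).
Proof.
move=> df.
have E : (fun h : R => h^-1 *: (((fun s : R => f (z + s *: v)) \o shift t) (h *: (1 : R)) -
      f (z + t *: v))) =
    (fun h : R => h^-1 *: ((f \o shift (z + t *: v)) (h *: v) - f (z + t *: v))).
  apply/funext => h /=; rewrite /shift/=; congr (_ *: (f _ - _)).
  by rewrite /GRing.scale/= mulr1 -/(GRing.scale _ _) scalerDl addrCA.
by split; rewrite /derivable/derive E.
Qed.

Lemma axis_mvt f z (v : 'cV[R]_d) (K t : R) :
  (forall x, derivable f x v) -> (forall x, `|'D_v f x| <= K) ->
  `|f (z + t *: v) - f z| <= K * `|t|.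
Proof.
move=> df dK.
have dl s : is_derive s (1 : R) (fun s : R => f (z + s *: v)) ('D_v f (z + s *: v)).
  exact: is_derive_line.
have cl : continuous (fun s : R => f (z + s *: v)).
  move=> s; have ? := dl s; apply: differentiable_continuous; apply/derivable1_diffP.
  exact: ex_derive.
have key a b : a <= b -> `|f (z + b *: v) - f (z + a *: v)| <= K * (b - a).
  rewrite le_eqVlt => /orP[/eqP ->|ab]; first by rewrite !subrr normr0 mulr0.
  have [c _ ->] := MVT ab (fun s _ => dl s) (continuous_subspaceT cl).
  have ba : 0 <= b - a by rewrite subr_ge0 ltW.
  by rewrite normrM (ger0_norm ba) ler_wpM2r.
have [t0|t0] := leP 0 t.
  by have := key 0 t t0; rewrite scale0r addr0 subr0 (ger0_norm t0).
by have := key t 0 (ltW t0); rewrite scale0r addr0 sub0r distrC (ltr0_norm t0).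
Qed.

(** The coordinates are changed one at a time, each along an axis where the mean
    value theorem applies. *)
Lemma lipschitz_of_partials f (K : R) :
  (forall i x, derivable f x (basis_cv R i)) ->
  (forall i x, `|'D_(basis_cv R i) f x| <= K) ->
  forall x y, `|f y - f x| <= K * \sum_(i < d) `|y i ord0 - x i ord0|.
Proof.
move=> df dK x y.
pose z n : 'cV[R]_d := \col_i (if (i < n)%N then y i ord0 else x i ord0).
have z0 : z 0 = x by apply/matrixP => i j; rewrite mxE (ord1 j).
have zd : z d = y by apply/matrixP => i j; rewrite mxE (ord1 j) ltn_ord.
have zS (i : 'I_d) : z i.+1 = z i + (y i ord0 - x i ord0) *: basis_cv R i.
  apply/matrixP => k j; rewrite !mxE (ord1 j) eqxx andbT ltnS leq_eqVlt -val_eqE.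
  case: eqVneq => [/val_inj ->|_] /=; first by rewrite ltnn mulr1 addrC subrK.
  by rewrite mulr0 addr0.
have H n : (n <= d)%N -> `|f (z n) - f x| <= K * \sum_(i < d | (i < n)%N) `|y i ord0 - x i ord0|.
  elim: n => [_|n IH nd]; first by rewrite z0 subrr normr0 big_pred0 ?mulr0.
  pose i := Ordinal nd.
  rewrite (bigD1 i)//= mulrDr -(subrK (f (z n)) (f (z n.+1))) -addrA.
  rewrite (le_trans (ler_normD _ _))// lerD//.
    by rewrite (zS i); exact: axis_mvt.
  apply: le_trans (IH (ltnW nd)) _; rewrite (eq_bigl (fun k : 'I_d => (k < n)%N))// => k.
  by rewrite ltnS leq_eqVlt -val_eqE /=; case: eqVneq => [->|_]; rewrite ?ltnn ?andbF ?andbT.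
have := H d (leqnn d); rewrite zd (eq_bigl xpredT)// => i.
by rewrite ltn_ord.
Qed.

Lemma continuous_lipschitz f (K : R) :
  (forall x y, `|f y - f x| <= K * \sum_(i < d) `|y i ord0 - x i ord0|) -> continuous f.
Proof.
move=> fK x; apply/(@cvgrPdist_le _ _ _ (nbhs x) (nbhs_filter x)) => e e0.
have c1 : \sum_(i < d) `|(y : 'cV[R]_d) i ord0 - x i ord0| @[y --> x] --> (0 : R).
  have s0 : \sum_(i < d) `|x i ord0 - x i ord0| = 0 :> R.
    by rewrite big1// => i _; rewrite subrr normr0.
  rewrite -[X in _ --> X]s0.
  apply: (@cvg_sumr _ _ _ (nbhs x) (nbhs_filter x)) => i.
  apply: cvg_norm; apply: cvgB; last exact: cvg_cst.
  exact: continuous_coord.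
have c : K * \sum_(i < d) `|(y : 'cV[R]_d) i ord0 - x i ord0| @[y --> x] --> (0 : R).
  by rewrite -[X in _ --> X](mulr0 K); apply: cvgM c1; exact: cvg_cst.
move/(@cvgrPdist_le _ _ _ (nbhs x) (nbhs_filter x)) : c => /(_ e e0); apply: filterS => y.
rewrite sub0r normrN distrC => h; apply: le_trans h; apply: le_trans (fK x y) _.
exact: ler_norm.
Qed.

End lipschitz_along_axes.

Section schwartz.
Context (R : realType) (d : nat).
Local Notation integ f := ((lebesgue R d).-integrable setT (EFin \o f)).
Local Notation leb := (lebesgue R d).

Lemma normc_ge_Re (z : R[i]) : `|complex.Re z| <= normc z.
Proof.
have n0 : 0 <= normc z by case: z => a b; exact: sqrtr_ge0.
rewrite -(ler_pXn2r (n := 2))// ?nnegrE// real_normK ?num_real// sqr_normc.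
by rewrite lerDl sqr_ge0.
Qed.

Lemma normc_ge_Im (z : R[i]) : `|complex.Im z| <= normc z.
Proof.
have n0 : 0 <= normc z by case: z => a b; exact: sqrtr_ge0.
rewrite -(ler_pXn2r (n := 2))// ?nnegrE// real_normK ?num_real// sqr_normc.
by rewrite lerDr sqr_ge0.
Qed.

Lemma normc_le (z : R[i]) : normc z <= `|complex.Re z| + `|complex.Im z|.
Proof.
have n0 : 0 <= normc z by case: z => a b; exact: sqrtr_ge0.
rewrite -(ler_pXn2r (n := 2))// ?nnegrE ?addr_ge0// sqr_normc.
rewrite -(real_normK (num_real (complex.Re z))) -(real_normK (num_real (complex.Im z))).
have := normr_ge0 (complex.Re z); have := normr_ge0 (complex.Im z); nra.
Qed.

Lemma normc_realM (a : R) (z : R[i]) : normc (a%:C%C * z) = `|a| * normc z.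
Proof.
have n0 w : 0 <= normc w :> R by case: w => x y; exact: sqrtr_ge0.
apply/eqP; rewrite -(eqrXn2 (n := 2))// ?mulr_ge0//; apply/eqP.
rewrite exprMn !sqr_normc ReM ImM /= real_normK ?num_real//; ring.
Qed.

(** For each point, the coordinates larger than one select a seminorm that
    controls the decay there. *)
Lemma schwartz_decay (g : 'cV[R]_d -> R[i]) (K : R) :
  (forall alpha : seq 'I_d, (size alpha <= 2 * d)%N ->
     forall x, normc ((monomial alpha x)%:C%C * g x) <= K) ->
  forall x, normc (g x) <= K * poissonw x.
Proof.
move=> gK x.
(* Each large coordinate is taken twice, as [x i ^+ 2] compensates [1 + x i ^+ 2]. *)
pose J := [seq i <- index_enum 'I_d | 1 < `|x i ord0|].
have sJ : (size (J ++ J) <= 2 * d)%N.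
  rewrite size_cat addnn -mul2n leq_mul2l/= size_filter (leq_trans (count_size _ _))//.
  by rewrite -[in leqRHS](card_ord d) cardE enumT.
have := gK _ sJ x; rewrite normc_realM => h.
have p1 : 1 <= `|monomial (J ++ J) x| * poissonw x.
  rewrite /monomial big_cat/= -big_split/= big_filter normr_prod /poissonw /pweight.
  rewrite big_mkcond/= -big_split/= big_seq; elim/big_ind : _ => //.
    by move=> a b a1 b1; rewrite -[1]mulr1 ler_pM.
  move=> i _; have s1 : 0 < 1 + x i ord0 ^+ 2 by rewrite ltr_wpDr ?sqr_ge0.
  case: ifP => xi.
    rewrite -expr2 ger0_norm ?sqr_ge0// /poisson mulrA ler_pdivlMr// mul1r.
    have : 1 <= x i ord0 ^+ 2 by rewrite -real_normK ?num_real// exprn_ege1 ?ltW.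
    lra.
  rewrite mul1r /poisson ler_pdivlMr// mul1r.
  have : x i ord0 ^+ 2 <= 1 by rewrite -real_normK ?num_real// exprn_ile1 // leNgt xi.
  lra.
have n0 : 0 <= normc (g x) by case: (g x) => a b; exact: sqrtr_ge0.
have pp : 0 <= poissonw x by apply: pweight_ge0; exact: poisson_ge0.
apply: (@le_trans _ _ (`|monomial (J ++ J) x| * normc (g x) * poissonw x)); last first.
  by rewrite ler_wpM2r.
by rewrite mulrAC ler_peMl.
Qed.

Lemma poissonw_bounds (x : 'cV[R]_d) : 0 <= poissonw x <= 2 ^+ d.
Proof.
rewrite pweight_ge0 /=; last exact: poisson_ge0.
rewrite -[in leRHS](card_ord d) -prodr_const; apply: ler_prod => i _.
rewrite poisson_ge0/= /poisson ler_pdivrMr ?ltr_wpDr ?sqr_ge0// ler_peMr//.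
by rewrite lerDl sqr_ge0.
Qed.

Lemma schwartz_bound (g : 'cV[R]_d -> R[i]) : schwartz g ->
  exists2 K, 0 <= K & forall x, normc (g x) <= K * poissonw x.
Proof.
move=> [_ bd].
have h alpha : exists k, forall x, normc ((monomial alpha x)%:C%C * g x) <= k.
  by have [k kP] := bd alpha [::]; exists k.
have [k kP] := choice h.
pose K := \sum_(n < (2 * d).+1) \sum_(t : n.-tuple 'I_d) `|k t|.
exists K; first by apply: sumr_ge0 => n _; apply: sumr_ge0.
apply: schwartz_decay => alpha salpha x; apply: le_trans (kP alpha x) _.
apply: le_trans (ler_norm _) _.
have salpha' : (size alpha < (2 * d).+1)%N by [].
rewrite /K (bigD1 (Ordinal salpha'))//= (bigD1 (in_tuple alpha))//= -addrA lerDl.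
by rewrite addr_ge0// sumr_ge0// => n _; apply: sumr_ge0.
Qed.

(** Continuity comes from bounds on the first partial derivatives, and integrability
    from the domination by [poissonw]. *)
Lemma schwartz_nice (g : 'cV[R]_d -> R[i]) : schwartz g ->
  nice (fun x => complex.Re (g x)) /\ nice (fun x => complex.Im (g x)).
Proof.
move=> gs; have [sm bd] := gs.
have [K K0 gK] := schwartz_bound gs.
have h i : exists k, forall x, normc (dpartial i g x) <= k.
  have [k kP] := bd [::] [:: i]; exists k => x.
  by have := kP x; rewrite /monomial big_nil mul1r.
have [c cP] := choice h.
have cB i : c i <= \sum_(j < d) `|c j|.
  by rewrite (le_trans (ler_norm _))// (bigD1 i)//= lerDl sumr_ge0.
have cRe : continuous (fun x => complex.Re (g x)).
  apply: (@continuous_lipschitz _ _ _ (\sum_(j < d) `|c j|)); apply: lipschitz_of_partials.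
    by move=> i x; have [] := sm [::] i x.
  move=> i x; apply: le_trans (cB i); apply: le_trans (cP i x).
  exact: (normc_ge_Re (dpartial i g x)).
have cIm : continuous (fun x => complex.Im (g x)).
  apply: (@continuous_lipschitz _ _ _ (\sum_(j < d) `|c j|)); apply: lipschitz_of_partials.
    by move=> i x; have [] := sm [::] i x.
  move=> i x; apply: le_trans (cB i); apply: le_trans (cP i x).
  exact: (normc_ge_Im (dpartial i g x)).
have bnd x : normc (g x) <= K * 2 ^+ d.
  by apply: le_trans (gK x) _; rewrite ler_wpM2l//; have /andP[] := poissonw_bounds x.
have ip := integZ K (integ_poissonw R d).
split; split => //.
- by exists (K * 2 ^+ d) => x; exact: le_trans (normc_ge_Re _) (bnd x).
- apply: integ_le ip; first exact: continuous_measurable_cv.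
  by move=> x; exact: le_trans (normc_ge_Re _) (gK x).
- by exists (K * 2 ^+ d) => x; exact: le_trans (normc_ge_Im _) (bnd x).
- apply: integ_le ip; first exact: continuous_measurable_cv.
  by move=> x; exact: le_trans (normc_ge_Im _) (gK x).
Qed.

Lemma integ_poissonw_sq : integ (fun x => (@poissonw R d x) ^+ 2).
Proof.
apply: (integ_mul (integ_poissonw R d)); first exact: integ_measurable (integ_poissonw R d).
by move=> x; have /andP[p0 p1] := poissonw_bounds x; rewrite ger0_norm//; exact: p1.
Qed.

Lemma L2_parts (f : 'cV[R]_d -> R[i]) : L2 f ->
  [/\ measurable_fun setT (fun x => complex.Re (f x)), measurable_fun setT (fun x => complex.Im (f x)),
   integ (fun x => complex.Re (f x) ^+ 2) & integ (fun x => complex.Im (f x) ^+ 2)].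
Proof.
move=> [[m1 m2] fi].
have i : integ (fun x => normc (f x) ^+ 2).
  apply: integ_ge0P => //.
    under eq_fun do rewrite sqr_normc.
    by apply: measurable_funD; exact: measurable_funX.
  by move=> x; exact: sqr_ge0.
split => //; apply: (integ_le _ _ i); try exact: measurable_funX.
  by move=> x; rewrite ger0_norm ?sqr_ge0// sqr_normc lerDl sqr_ge0.
by move=> x; rewrite ger0_norm ?sqr_ge0// sqr_normc lerDr sqr_ge0.
Qed.

(** The function is paired with [poissonw], which is square integrable and dominates
    Schwartz functions through finitely many seminorms. *)
Theorem L2_tempered (f : 'cV[R]_d -> R[i]) : L2 f -> tempered (function_distribution f).
Proof.
move=> /L2_parts[mF1 mF2 iF1 iF2].
pose F1 x := complex.Re (f x); pose F2 x := complex.Im (f x).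
have prod (F u : 'cV[R]_d -> R) : measurable_fun setT F -> integ (fun x => F x ^+ 2) ->
    nice u -> integ (fun x => F x * u x).
  move=> mF iF un; apply: integ_mul_sq => //; [exact: nice_measurable|exact: nice_sq].
split.
- move=> a g g' gs gs'.
  have [gR gI] := schwartz_nice gs; have [gR' gI'] := schwartz_nice gs'.
  have i1 := prod F1 _ mF1 iF1 gR; have i2 := prod F1 _ mF1 iF1 gI.
  have i3 := prod F2 _ mF2 iF2 gR; have i4 := prod F2 _ mF2 iF2 gI.
  have j1 := prod F1 _ mF1 iF1 gR'; have j2 := prod F1 _ mF1 iF1 gI'.
  have j3 := prod F2 _ mF2 iF2 gR'; have j4 := prod F2 _ mF2 iF2 gI'.
  have reE (v : 'cV[R]_d -> R[i]) : complex.Re (function_distribution f v) =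
      \int[leb]_x (F1 x * complex.Re (v x) - F2 x * complex.Im (v x)).
    by apply: eq_Rintegral => x _; rewrite ReM.
  have imE (v : 'cV[R]_d -> R[i]) : complex.Im (function_distribution f v) =
      \int[leb]_x (F1 x * complex.Im (v x) + F2 x * complex.Re (v x)).
    by apply: eq_Rintegral => x _; rewrite ImM.
  have iR := integB i1 i4; have iI := integD i2 i3.
  have jR := integB j1 j4; have jI := integD j2 j3.
  apply: complex_eq.
  + rewrite ReD ReM !reE imE.
    rewrite -(RintegralZl (complex.Re a) measurableT iR) -(RintegralZl (complex.Im a) measurableT iI).
    rewrite -(RintegralB measurableT (integZ (complex.Re a) iR) (integZ (complex.Im a) iI)).
    rewrite -(RintegralD measurableT (integB (integZ (complex.Re a) iR) (integZ (complex.Im a) iI)) jR).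
    by apply: eq_Rintegral => x _; rewrite ReD ImD ReM ImM; ring.
  + rewrite ImD ImM !imE reE.
    rewrite -(RintegralZl (complex.Re a) measurableT iI) -(RintegralZl (complex.Im a) measurableT iR).
    rewrite -(RintegralD measurableT (integZ (complex.Re a) iI) (integZ (complex.Im a) iR)).
    rewrite -(RintegralD measurableT (integD (integZ (complex.Re a) iI) (integZ (complex.Im a) iR)) jI).
    by apply: eq_Rintegral => x _; rewrite ReD ImD ReM ImM; ring.
- have mp : measurable_fun setT (@poissonw R d) by exact: integ_measurable (integ_poissonw R d).
  have pos (F : 'cV[R]_d -> R) : measurable_fun setT F -> integ (fun x => F x ^+ 2) ->
      integ (fun x => `|F x| * @poissonw R d x).
    move=> mF iF; apply: integ_mul_sq => //; first exact: measurableT_comp.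
      by under eq_fun do rewrite /= real_normK ?num_real//.
    exact: integ_poissonw_sq.
  have p1 := pos _ mF1 iF1; have p2 := pos _ mF2 iF2.
  pose C := \int[leb]_x (`|F1 x| * @poissonw R d x) + \int[leb]_x (`|F2 x| * @poissonw R d x).
  exists (2 * d)%N, (2 * C) => g gs K gK.
  have [gR gI] := schwartz_nice gs.
  have dec x : normc (g x) <= K * poissonw x.
    by apply: schwartz_decay => alpha sa y; exact: (gK alpha [::]).
  have bnd (F1' F2' u v : 'cV[R]_d -> R) : integ (fun x => F1' x * u x + F2' x * v x) ->
      integ (fun x => `|F1' x| * @poissonw R d x) -> integ (fun x => `|F2' x| * @poissonw R d x) ->
      (forall x, `|u x| <= K * poissonw x) -> (forall x, `|v x| <= K * poissonw x) ->
      `|\int[leb]_x (F1' x * u x + F2' x * v x)| <=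
      (\int[leb]_x (`|F1' x| * @poissonw R d x) + \int[leb]_x (`|F2' x| * @poissonw R d x)) * K.
    move=> ii q1 q2 uK vK; apply: (le_trans (le_normr_Rintegral measurableT ii)).
    have q3 := integZ K (integD q1 q2).
    rewrite -(RintegralD measurableT q1 q2) mulrC -(RintegralZl K measurableT (integD q1 q2)).
    apply: (le_Rintegral measurableT (integrable_norm ii) q3) => x _.
    rewrite (le_trans (ler_normD _ _))// !normrM mulrDr !(mulrCA K).
    by rewrite lerD// ler_wpM2l.
  apply: (le_trans (normc_le _)).
  rewrite (_ : 2 * C * K = C * K + C * K); last by ring.
  apply: lerD.
  + have i1 := prod F1 _ mF1 iF1 gR; have i4 := prod F2 _ mF2 iF2 gI.
    have -> : complex.Re (function_distribution f g) =
        \int[leb]_x (F1 x * complex.Re (g x) + F2 x * - complex.Im (g x)).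
      by apply: eq_Rintegral => x _; rewrite ReM mulrN.
    apply: bnd => //.
    * by have := integB i1 i4; congr (integrable _ _ _); apply/funext => x /=; rewrite mulrN.
    * by move=> x; exact: le_trans (normc_ge_Re _) (dec x).
    * by move=> x; rewrite normrN; exact: le_trans (normc_ge_Im _) (dec x).
  + have i2 := prod F1 _ mF1 iF1 gI; have i3 := prod F2 _ mF2 iF2 gR.
    have -> : complex.Im (function_distribution f g) =
        \int[leb]_x (F1 x * complex.Im (g x) + F2 x * complex.Re (g x)).
      by apply: eq_Rintegral => x _; rewrite ImM.
    apply: bnd => //.
    * exact: integD i2 i3.
    * by move=> x; exact: le_trans (normc_ge_Im _) (dec x).
    * by move=> x; exact: le_trans (normc_ge_Re _) (dec x).
Qed.

End schwartz.

(** * Determinant, trigonometry and compactness *)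

Section expanding.
Context (R : realType) (d : nat).

(** Over the complex numbers the determinant is the product of the entries of a
    diagonalization, which are eigenvalues. *)
Lemma isotropic_det (A : 'M[int]_d) : (0 < d)%N -> isotropic_dilation R A ->
  1 < absdet R A /\ real_mx R A \in unitmx.
Proof.
move=> d0 [big [P Pu /similar_diagPex[D /(similarP Pu) PD]] _].
have evD i : eigenvalue (complex_mx R A) (D ord0 i).
  apply/eigenvalueP; exists (row i P).
    by rewrite -row_mul PD row_mul row_diag_mx -scalemxAl -rowE.
  apply/eqP => Pi0; have : row i (P *m invmx P) = 0 by rewrite row_mul Pi0 mul0mx.
  rewrite mulmxV// => /rowP/(_ i)/eqP; rewrite !mxE eqxx /=.
  by rewrite oner_eq0.
have P0 : \det P != 0 by rewrite -unitfE -unitmxE.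
have dD : \det (complex_mx R A) = \prod_i D ord0 i.
  have := congr1 determinant PD; rewrite !det_mulmx det_diag [LHS]mulrC.
  by move=> /(mulIf P0).
have dA : \det (complex_mx R A) = (\det A)%:~R by rewrite (det_map_mx (intr : {rmorphism int -> R[i]})).
have gt1 : 1 < `|\det (complex_mx R A)|.
  rewrite dD normr_prod (bigD1 (Ordinal d0))//=.
  have h1 : 1 < `|D ord0 (Ordinal d0)| by apply: big; exact: evD.
  have h2 : 1 <= \prod_(i < d | i != Ordinal d0) `|D ord0 i|.
    by elim/big_ind : _ => // [x y x1 y1|i _]; [rewrite mulr_ege1|apply/ltW/big/evD].
  by rewrite (lt_le_trans h1)// ler_peMr.
have gt1' : 1 < `|\det A|.
  by move: gt1; rewrite dA -intr_norm ltr1z.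
split; first by rewrite /absdet ltr1z.
rewrite unitmxE unitfE (det_map_mx (intr : {rmorphism int -> R})) intr_eq0.
by rewrite -normr_gt0 (lt_trans _ gt1').
Qed.

End expanding.

Section trigonometry.
Context (R : realType).
Implicit Types (x y : R) (z : int).

Lemma sinDintpi_sq x z : sin (x + z%:~R * pi) ^+ 2 = sin x ^+ 2.
Proof.
rewrite sinD sin_intpi mulr0 addr0 exprMn.
have := cos2Dsin2 (z%:~R * pi : R); rewrite sin_intpi expr0n addr0 => ->.
by rewrite mulr1.
Qed.

Lemma sinD2intpi x z : sin (x + 2 * pi * z%:~R) = sin x.
Proof.
have e : 2 * pi * z%:~R = z%:~R * pi + z%:~R * pi :> R by ring.
have c2 := cos2Dsin2 (z%:~R * pi : R); rewrite sin_intpi expr0n addr0 in c2.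
by rewrite e sinD sinD cosD sin_intpi !(mulr0, mul0r) addr0 subr0 -expr2 c2 mulr0 addr0 mulr1.
Qed.

Lemma sin_eq0_intpi x : sin x = 0 -> exists z : int, x = z%:~R * pi.
Proof.
move=> x0; pose z := Num.floor (x / pi); exists z.
have p0 := pi_gt0 R.
have /andP[z1 z2] : z%:~R <= x / pi < (z + 1)%:~R by exact: floor_itv.
pose y := x - z%:~R * pi.
have y0 : 0 <= y by rewrite subr_ge0 -ler_pdivlMr.
have y1 : y < pi.
  by move: z2; rewrite ltr_pdivrMr// intrD mulrDl mul1r /y ltrBlDl.
have : sin y ^+ 2 = 0 by rewrite /y -mulNr -intrN sinDintpi_sq x0 expr0n.
move=> /eqP; rewrite sqrf_eq0 => /eqP sy.
have [y00|] := eqVneq y 0; first by apply/eqP; rewrite -subr_eq0; apply/eqP.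
move=> yn0; have : 0 < sin y by rewrite sin_gt0_pi// lt_neqAle eq_sym yn0 y0.
by rewrite sy ltxx.
Qed.

Lemma sin_lipschitz x y : `|sin y - sin x| <= `|y - x|.
Proof.
wlog xy : x y / x <= y.
  by move=> H; have [/H//|/ltW/H] := leP x y; rewrite distrC (distrC x).
move: xy; rewrite le_eqVlt => /orP[/eqP ->|xy]; first by rewrite !subrr.
have cs : {within `[x, y], continuous (@sin R)}.
  by apply: continuous_subspaceT; exact: continuous_sin.
have [c _ ->] := MVT xy (fun s _ => is_derive_sin s) cs.
by rewrite normrM ler_piMl// norm_cos_le1.
Qed.

(** The double angle formula gives [(sin x)^2 = 4 sin (x/2)^2 (1 - sin (x/2)^2)]. *)
Lemma sin_half_fourth x :
  4 * sin (x / 2) ^+ 2 - sin x ^+ 2 = 4 * sin (x / 2) ^+ 4.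
Proof.
have e : x = x / 2 + x / 2 by lra.
rewrite {2}e sinD; have := cos2Dsin2 (x / 2).
move: (sin (x / 2)) (cos (x / 2)) => s c sc.
have {}sc : c ^+ 2 = 1 - s ^+ 2 by rewrite -sc addrK.
rewrite (_ : s * c + c * s = 2 * (s * c)); last by ring.
by rewrite !exprMn sc; ring.
Qed.

End trigonometry.

Section compactness.
Context (R : realType) (d : nat).

Lemma trmx_continuous : continuous (fun v : 'rV[R]_d => v^T : 'cV[R]_d).
Proof.
move=> v P [F FP sub]; exists (fun i j => F j i).
  by move=> i j /=; have := FP j i; rewrite mxE.
move=> w wF /=; apply: sub => i j; rewrite mxE; exact: wF.
Qed.

(** The points concerned form a compact set, on which [f] attains its minimum. *)
Lemma positive_min (f g : 'cV[R]_d -> R) (M e : R) : continuous f -> continuous g ->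
  (forall x : 'cV[R]_d, (forall i, `|x i ord0| <= M) -> e <= g x -> 0 < f x) ->
  exists2 c, 0 < c & forall x : 'cV[R]_d, (forall i, `|x i ord0| <= M) -> e <= g x -> c <= f x.
Proof.
move=> cf cg fpos.
pose B := [set v : 'rV[R]_d | forall i, `[(- M), M]%classic (v ord0 i)].
have cB : compact B by apply: (@rV_compact _ _ (fun=> `[(- M), M]%classic)) => i; exact: segment_compact.
pose K := (fun v : 'rV[R]_d => v^T : 'cV[R]_d) @` B.
have cK : compact K.
  apply: continuous_compact => //; apply: continuous_subspaceT; exact: trmx_continuous.
have KP (x : 'cV[R]_d) : K x <-> forall i, `|x i ord0| <= M.
  split=> [[v vB <-] i|xM]; first by rewrite mxE ler_norml; have := vB i; rewrite /= in_itv.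
  exists x^T; last by rewrite trmxK.
  by move=> i; rewrite /= mxE in_itv/= -ler_norml.
pose C := K `&` (g @^-1` [set t | e <= t]).
have cC : compact C.
  apply: compact_closedI => //; apply: preimage_closed => //; exact: closed_ge.
have [C0|/set0P[x0 Cx0]] := eqVneq C set0.
  exists 1 => // x xM ex; have : C x by split => //; apply/KP.
  by rewrite C0.
have [c cC' cmin] := compact_EVT_min (ex_intro _ _ Cx0) cC (continuous_subspaceT cf).
move: cC'; rewrite inE => -[/KP Kc ec].
exists (f c); first exact: fpos.
by move=> x xM ex; apply: cmin; rewrite inE; split => //; apply/KP.
Qed.

End compactness.

(** * The trigonometric symbol *)

Section bounded_lipschitz.
Context (R : realType) (d : nat).
Implicit Types (f g : 'cV[R]_d -> R) (x y : 'cV[R]_d).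

Definition dist1 x y : R := \sum_(i < d) `|y i ord0 - x i ord0|.

Lemma dist1_ge0 x y : 0 <= dist1 x y.
Proof. exact: sumr_ge0. Qed.

(** A class stable under sums, products and linear substitutions that contains the
    symbol and the mask. The Lipschitz bound at the origin makes the infinite product
    converge, and the one elsewhere makes it continuous. *)
Definition bounded_lipschitz f :=
  exists C, (forall x, `|f x| <= C) /\ forall x y, `|f y - f x| <= C * dist1 x y.

Lemma blip_cst (c : R) : bounded_lipschitz (fun=> c).
Proof.
exists `|c|; split => // x y; rewrite subrr normr0 mulr_ge0//; exact: dist1_ge0.
Qed.

Lemma blipD f g : bounded_lipschitz f -> bounded_lipschitz g ->
  bounded_lipschitz (fun x => f x + g x).
Proof.
move=> [C [fC fL]] [D [gD gL]]; exists (C + D); split => [x|x y].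
  by rewrite (le_trans (ler_normD _ _))// lerD.
by rewrite opprD addrACA (le_trans (ler_normD _ _))// mulrDl lerD.
Qed.

Lemma blipM f g : bounded_lipschitz f -> bounded_lipschitz g ->
  bounded_lipschitz (fun x => f x * g x).
Proof.
move=> [C [fC fL]] [D [gD gL]].
have C0 : 0 <= C by apply: le_trans (fC 0).
have D0 : 0 <= D by apply: le_trans (gD 0).
exists (2 * (C * D)); split => [x|x y].
  rewrite normrM; apply: (@le_trans _ _ (C * D)); first by rewrite ler_pM.
  by rewrite ler_peMl ?mulr_ge0// ler1n.
have -> : f y * g y - f x * g x = f y * (g y - g x) + (f y - f x) * g x by ring.
rewrite (le_trans (ler_normD _ _))// !normrM.
have -> : 2 * (C * D) * dist1 x y = C * (D * dist1 x y) + (C * dist1 x y) * D by ring.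
by rewrite lerD// ler_pM.
Qed.

Lemma blip_sum (J : Type) (s : seq J) (P : pred J) (f : J -> 'cV[R]_d -> R) :
  (forall j, bounded_lipschitz (f j)) ->
  bounded_lipschitz (fun x => \sum_(j <- s | P j) f j x).
Proof.
move=> fB; elim: s => [|j s IH].
  by under eq_fun do rewrite big_nil; exact: blip_cst.
under eq_fun do rewrite big_cons; case: (P j) => //.
exact: blipD.
Qed.

Lemma blip_prod (J : Type) (s : seq J) (P : pred J) (f : J -> 'cV[R]_d -> R) :
  (forall j, bounded_lipschitz (f j)) ->
  bounded_lipschitz (fun x => \prod_(j <- s | P j) f j x).
Proof.
move=> fB; elim: s => [|j s IH].
  by under eq_fun do rewrite big_nil; exact: blip_cst.
under eq_fun do rewrite big_cons; case: (P j) => //.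
exact: blipM.
Qed.

Lemma blip_translate f t : bounded_lipschitz f -> bounded_lipschitz (fun x => f (x + t)).
Proof.
move=> [C [fC fL]]; exists C; split => // x y; apply: le_trans (fL _ _) _.
rewrite /dist1 (eq_bigr (fun i => `|y i ord0 - x i ord0|))// => i _.
by rewrite !mxE opprD addrACA subrr addr0.
Qed.

Lemma blip_sin (c : R) i : bounded_lipschitz (fun x => sin (c * x i ord0)).
Proof.
exists (1 + `|c|); split => [x|x y].
  by rewrite (le_trans (norm_sin_le1 _))// lerDl.
apply: le_trans (sin_lipschitz _ _) _; rewrite -mulrBr normrM.
apply: ler_pM => //; first by rewrite lerDr.
by rewrite /dist1 (bigD1 i)//= lerDl sumr_ge0.
Qed.

Lemma blip_continuous f : bounded_lipschitz f -> continuous f.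
Proof. by move=> [C [_ fL]]; exact: (continuous_lipschitz fL). Qed.

End bounded_lipschitz.

Section elliptic_symbol.
Context (R : realType) (d : nat) (Q : 'M[R]_d).
Hypotheses (QT : Q^T = Q)
  (Qpos : forall x : 'cV[R]_d, x != 0 -> 0 < (x^T *m Q *m x) ord0 ord0).

Lemma Q_unit : Q \in unitmx.
Proof.
rewrite -unitmx_tr -row_free_unit -kermx_eq0; apply/eqP/row_matrixP => i.
rewrite row0; apply/eqP; apply: contraT => v0.
set v := row i (kermx Q^T) in v0 *.
have vQ : v *m Q = 0.
  by rewrite -[in LHS]QT; apply/sub_kermxP; exact: row_sub.
have := @Qpos v^T; rewrite trmx_eq0 => /(_ v0).
by rewrite trmxK vQ mul0mx mxE ltxx.
Qed.

Lemma Q2_diag i : (Q *m Q) i i = \sum_j Q i j ^+ 2.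
Proof.
rewrite mxE; apply: eq_bigr => j _; rewrite expr2; congr (_ * _).
by rewrite -[in RHS]QT mxE.
Qed.

Lemma Q2_diag_gt0 i : 0 < (Q *m Q) i i.
Proof.
rewrite Q2_diag lt_neqAle sumr_ge0 ?andbT => [|j _]; last exact: sqr_ge0.
rewrite eq_sym; apply/eqP => /eqP; rewrite psumr_eq0 => [|j _]; last exact: sqr_ge0.
move=> /allP h; have Qi0 : row i Q = 0.
  apply/rowP => j; rewrite !mxE; apply/eqP.
  by have /= := h j (mem_index_enum _); rewrite sqrf_eq0.
have : row i (Q *m invmx Q) = 0 by rewrite row_mul Qi0 mul0mx.
rewrite mulmxV ?Q_unit// => /rowP/(_ i)/eqP; rewrite !mxE eqxx /=.
by rewrite oner_eq0.
Qed.

Lemma quadratic_sum (s : 'I_d -> R) :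
  \sum_k (\sum_i Q k i * s i) ^+ 2 =
  \sum_i (Q *m Q) i i * s i ^+ 2 +
  2 * (\sum_(i < d) \sum_(j < d | (i < j)%N) (Q *m Q) i j * s i * s j).
Proof.
have symQ i j : (Q *m Q) i j = (Q *m Q) j i.
  have e : (Q *m Q)^T = Q *m Q by rewrite trmx_mul !QT.
  by rewrite -[in RHS]e [RHS]mxE.
have -> : \sum_k (\sum_i Q k i * s i) ^+ 2 = \sum_i \sum_j (Q *m Q) i j * s i * s j.
  under eq_bigr do rewrite expr2 big_distrlr/=.
  rewrite exchange_big/=; apply: eq_bigr => i _.
  rewrite exchange_big/=; apply: eq_bigr => j _.
  rewrite mxE !mulr_suml; apply: eq_bigr => k _.
  have -> : Q i k = Q k i by rewrite -[in LHS]QT mxE.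
  ring.
have split3 i : \sum_j (Q *m Q) i j * s i * s j =
    (Q *m Q) i i * s i ^+ 2 + \sum_(j < d | (i < j)%N) (Q *m Q) i j * s i * s j +
    \sum_(j < d | (j < i)%N) (Q *m Q) i j * s i * s j.
  rewrite (bigD1 i)//= expr2 mulrA -addrA; congr (_ + _).
  rewrite (bigID (fun j : 'I_d => (i < j)%N))/=; congr (_ + _); apply: eq_bigl => j.
    by rewrite -val_eqE neq_ltn; case: ltngtP.
  by rewrite -val_eqE neq_ltn; case: ltngtP.
under eq_bigr do rewrite split3.
rewrite !big_split/= -addrA; congr (_ + _); rewrite mulr_natl mulr2n; congr (_ + _).
rewrite (exchange_big_dep xpredT)//=; apply: eq_bigr => j _; apply: eq_bigr => i _.
by rewrite symQ mulrAC.
Qed.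

(** The identity [4 sin (x/2)^2 = (sin x)^2 + 4 sin (x/2)^4] in the diagonal terms
    completes the quadratic form in the sines, and shows the symbol as a sum of
    nonnegative terms. *)
Lemma G_fourth (x : 'cV[R]_d) :
  G Q x = \sum_k (\sum_i Q k i * sin (x i ord0)) ^+ 2 +
          4 * \sum_i (Q *m Q) i i * sin (x i ord0 / 2) ^+ 4.
Proof.
rewrite quadratic_sum /G addrAC; congr (_ + _).
rewrite !mulr_sumr -big_split/=; apply: eq_bigr => i _.
have e := sin_half_fourth (x i ord0).
have -> : 4 * ((Q *m Q) i i * sin (x i ord0 / 2) ^+ 4) =
  (Q *m Q) i i * (4 * sin (x i ord0 / 2) ^+ 4) by ring.
by rewrite -e; ring.
Qed.

Lemma Q2_fourth_ge0 i (t : R) : 0 <= (Q *m Q) i i * t ^+ 4.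
Proof. by rewrite mulr_ge0 ?exprn_even_ge0// ltW// Q2_diag_gt0. Qed.

Lemma G_ge0 x : 0 <= G Q x.
Proof.
rewrite G_fourth; apply: addr_ge0; first by apply: sumr_ge0 => i _; exact: sqr_ge0.
by apply: mulr_ge0 => //; apply: sumr_ge0 => i _; exact: Q2_fourth_ge0.
Qed.

Lemma G_periodic x (k : 'cV[int]_d) : G Q (x + (2 * pi) *: real_mx R k) = G Q x.
Proof.
have e1 i : sin ((x + (2 * pi) *: real_mx R k) i ord0) = sin (x i ord0).
  by rewrite !mxE sinD2intpi.
have e2 i : sin ((x + (2 * pi) *: real_mx R k) i ord0 / 2) ^+ 2 = sin (x i ord0 / 2) ^+ 2.
  have -> : (x + (2 * pi) *: real_mx R k) i ord0 / 2 = x i ord0 / 2 + (k i ord0)%:~R * pi.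
    by rewrite !mxE; field.
  exact: sinDintpi_sq.
rewrite /G; congr (_ * _ + _ * _).
  by apply: eq_bigr => i _; rewrite e2.
by apply: eq_bigr => i _; apply: eq_bigr => j _; rewrite !e1.
Qed.

(** The fourth powers force every [sin (x i / 2)] to vanish. *)
Lemma G_eq0 x : G Q x = 0 <-> two_pi_lattice x.
Proof.
split=> [|[k ->]]; last first.
  have z i : (0 : 'cV[R]_d) i ord0 = 0 by rewrite mxE.
  rewrite -[X in G Q X]add0r G_periodic /G.
  rewrite [X in 4 * X]big1 => [|i _]; last by rewrite z mul0r sin0 expr0n mulr0.
  rewrite [X in _ + 2 * X]big1 ?mulr0 ?addr0// => i _.
  by rewrite big1// => j _; rewrite z sin0 mulr0 mul0r.
rewrite G_fourth => /eqP; rewrite paddr_eq0; last 2 first.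
- by apply: sumr_ge0 => i _; exact: sqr_ge0.
- by apply: mulr_ge0 => //; apply: sumr_ge0 => i _; exact: Q2_fourth_ge0.
move=> /andP[_]; rewrite mulf_eq0 pnatr_eq0/= psumr_eq0; last first.
  by move=> i _; exact: Q2_fourth_ge0.
move=> /allP h.
have h' i : exists z : int, x i ord0 / 2 = z%:~R * pi.
  apply: sin_eq0_intpi; have /= := h i (mem_index_enum _).
  by rewrite mulf_eq0 gt_eqF ?Q2_diag_gt0//= expf_eq0/= => /eqP.
have [z zP] := choice h'.
exists (\col_i z i); apply/matrixP => i j; rewrite (ord1 j) !mxE.
by rewrite -mulrA (mulrC pi) -zP; field.
Qed.

Lemma G_gt0 x : ~ two_pi_lattice x -> 0 < G Q x.
Proof.
move=> xl; rewrite lt_neqAle G_ge0 andbT eq_sym; apply/eqP => /G_eq0.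
exact: xl.
Qed.

Lemma blip_G : bounded_lipschitz (G Q).
Proof.
have bs i : bounded_lipschitz (fun x : 'cV[R]_d => sin (x i ord0)).
  by have := @blip_sin R d 1 i; under eq_fun do rewrite mul1r.
apply: blipD; apply: blipM; try exact: blip_cst; apply: blip_sum => i.
  have b2 : bounded_lipschitz (fun x : 'cV[R]_d => sin (x i ord0 / 2)).
    by have := @blip_sin R d 2^-1 i; under eq_fun do rewrite mulrC.
  by apply: blipM; [exact: blip_cst|exact: (blipM b2 b2)].
apply: blip_sum => j; apply: blipM => //; apply: blipM => //; exact: blip_cst.
Qed.

End elliptic_symbol.

(** * The mask *)

Section mask.
Context (R : realType) (d : nat) (A : 'M[int]_d) (Q : 'M[R]_d).
Hypotheses (Au : real_mx R A \in unitmx) (QT : Q^T = Q)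
  (Qpos : forall x : 'cV[R]_d, x != 0 -> 0 < (x^T *m Q *m x) ord0 ord0).

Local Notation T := (invT R A).

Lemma invT_mul : (real_mx R A)^T *m T = 1%:M.
Proof. by rewrite /invT mulmxV// unitmx_tr. Qed.

Lemma mul_invT : T *m (real_mx R A)^T = 1%:M.
Proof. by rewrite /invT mulVmx// unitmx_tr. Qed.

Lemma real_mxD (k l : 'cV[int]_d) : real_mx R (k + l) = real_mx R k + real_mx R l.
Proof. by apply/matrixP => i j; rewrite !mxE intrD. Qed.

Lemma real_mxN (k : 'cV[int]_d) : real_mx R (- k) = - real_mx R k.
Proof. by apply/matrixP => i j; rewrite !mxE mulrNz. Qed.

Lemma real_mx_mulT (k : 'cV[int]_d) : (real_mx R A)^T *m real_mx R k = real_mx R (A^T *m k).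
Proof.
rewrite /real_mx (map_mxM (intr : {rmorphism int -> R})); congr (_ *m _).
by rewrite map_trmx.
Qed.

Lemma lattice_mulT (x : 'cV[R]_d) : two_pi_lattice x -> two_pi_lattice ((real_mx R A)^T *m x).
Proof.
move=> [k ->]; exists (A^T *m k).
by rewrite -scalemxAr real_mx_mulT.
Qed.

(** The integer vector [A^T s] determines [s], and it is bounded by the entries of
    [A] when the coordinates of [s] are between [0] and [1]. *)
Lemma finite_digits : finite_set (@digits R d A).
Proof.
pose N := (\sum_i \sum_j `|A i j|)%N.
pose f (v : 'cV['I_(2 * N).+1]_d) : 'cV[R]_d :=
  T *m real_mx R (\col_i ((v i ord0 : nat)%:Z - N%:Z)).
apply: (@sub_finite_set _ _ (f @` setT)); last exact/finite_image/finite_finset.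
move=> s [s01 [k ks]].
have kN i : `|k i ord0| <= N%:Z.
  rewrite -(ler_int R) intr_norm.
  have -> : (k i ord0)%:~R = ((real_mx R A)^T *m s) i ord0 by rewrite ks mxE.
  rewrite mxE (le_trans (ler_norm_sum _ _ _))//.
  apply: (@le_trans _ _ (\sum_j (`|A j i|%N)%:R)).
    apply: ler_sum => j _; rewrite !mxE normrM natr_absz intr_norm ler_piMr//.
    by have /andP[s0 /ltW s1] := s01 j; rewrite ger0_norm.
  rewrite -natr_sum -pmulrn ler_nat; apply: leq_sum => j _.
  by rewrite (bigD1 i)//= leq_addr.
exists (\col_i inord (absz (k i ord0 + N%:Z))) => //.
rewrite /f -[RHS]mul1mx -mul_invT -mulmxA ks; congr (_ *m real_mx R _).
apply/matrixP => i j; rewrite (ord1 j) !mxE.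
have := kN i; rewrite ler_norml => /andP[k1 k2].
have p0 : 0 <= k i ord0 + N%:Z by rewrite -lerBlDr sub0r.
rewrite inordK.
  by rewrite gez0_abs// addrK.
rewrite ltnS -lez_nat gez0_abs// mul2n -addnn PoszD lerD2r.
exact: k2.
Qed.

Definition mask_digits : seq 'cV[R]_d := finmap.enum_fset (fset_set (@digits R d A `\ 0)).

Lemma mem_mask_digits (s : 'cV[R]_d) : (s \in mask_digits) <-> digits A s /\ s != 0.
Proof.
have fin : finite_set (@digits R d A `\ 0).
  by apply: sub_finite_set finite_digits => x [].
rewrite in_fset_set// inE /=; split=> -[s1 s2]; split => //.
  by apply/eqP.
by move=> s0; rewrite s0 eqxx in s2.
Qed.

Lemma m0E x : m0 A Q x =
  \prod_(s <- mask_digits) (G Q (x + (2 * pi) *: s) / G Q ((2 * pi) *: s)).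
Proof.
rewrite /m0 fsbig_finite//.
by apply: sub_finite_set finite_digits => y [].
Qed.

Lemma two_pi_neq0 : 2 * pi != 0 :> R.
Proof. by rewrite mulf_neq0// lt0r_neq0// pi_gt0. Qed.

Lemma digit_not_lattice (s : 'cV[R]_d) : digits A s -> s != 0 -> ~ two_pi_lattice ((2 * pi) *: s).
Proof.
move=> [s01 _] s0 [k] /(scalerI two_pi_neq0) sk.
move/eqP : s0; apply; apply/matrixP => i j; rewrite (ord1 j) mxE.
have := s01 i; rewrite sk mxE -[0]/(0%:~R) -[1]/(1%:~R) ler_int ltr_int.
by move=> /andP[]; case: (k i ord0) => [[|n]|n].
Qed.

Lemma G_digit_gt0 (s : 'cV[R]_d) : s \in mask_digits -> 0 < G Q ((2 * pi) *: s).
Proof.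
move=> /mem_mask_digits[sd s0]; apply: G_gt0 => //.
exact: digit_not_lattice.
Qed.

Lemma m0_ge0 x : 0 <= m0 A Q x.
Proof.
rewrite m0E big_seq; apply: prodr_ge0 => s sS.
by rewrite divr_ge0 ?G_ge0// ltW// G_digit_gt0.
Qed.

Lemma m0_0 : m0 A Q 0 = 1.
Proof.
rewrite m0E big_seq big1// => s sS.
by rewrite add0r mulfV// gt_eqF// G_digit_gt0.
Qed.

Lemma blip_m0 : bounded_lipschitz (m0 A Q).
Proof.
have -> : m0 A Q = fun x => \prod_(s <- mask_digits) (G Q (x + (2 * pi) *: s) / G Q ((2 * pi) *: s)).
  by apply/funext => x; exact: m0E.
apply: blip_prod => s; apply: blipM; last exact: blip_cst.
by apply: blip_translate; exact: blip_G.
Qed.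

(** If the factor of the digit [s] vanishes, [T *m x + (2 * pi) *: s] is in the lattice;
    multiplication by [A^T] brings it to [x] plus a point of the lattice. *)
Lemma m0_eq0 (x : 'cV[R]_d) : m0 A Q (T *m x) = 0 -> two_pi_lattice x.
Proof.
rewrite m0E => /eqP; rewrite prodf_seq_eq0 => /hasP[s sS /=].
have [sd s0] := (mem_mask_digits s).1 sS.
rewrite mulf_eq0 invr_eq0 (gt_eqF (G_digit_gt0 sS)) orbF => /eqP.
move=> /(G_eq0 QT Qpos)/lattice_mulT; rewrite mulmxDr mulmxA invT_mul mul1mx.
have [_ [k sk]] := sd; rewrite -scalemxAr sk => -[l xl].
exists (l - k); rewrite real_mxD real_mxN scalerBr -xl.
by rewrite addrK.
Qed.

(** Modulo the lattice [T *m x] is [- (2 * pi) *: s] for some digit [s]. If [s] is zero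
    then [G] vanishes there, and otherwise the factor of [s] in the mask does. *)
Lemma numerator_lattice (x : 'cV[R]_d) : two_pi_lattice x -> m0 A Q (T *m x) * G Q (T *m x) = 0.
Proof.
move=> [k ->]; rewrite -scalemxAr; set y := T *m real_mx R k.
(* The digit is the fractional part of [- y]. *)
pose l : 'cV[int]_d := \col_i Num.floor (- y i ord0).
pose s := - y - real_mx R l.
have sd : digits A s.
  split=> [i|].
    have sE (z : 'cV[R]_d) : (- z - real_mx R (\col_i Num.floor (- z i ord0))) i ord0 =
        - z i ord0 - (Num.floor (- z i ord0))%:~R by rewrite !mxE.
    have := floor_itv (- y i ord0); rewrite /s sE intrD.
    by move: (_%:~R) => f /andP[f1 f2]; rewrite subr_ge0 f1/= ltrBlDl.
  exists (- k - A^T *m l).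
  rewrite /s mulmxBr mulmxN mulmxA invT_mul mul1mx real_mx_mulT.
  by rewrite real_mxD !real_mxN.
have ysl : (2 * pi) *: y + (2 * pi) *: s = (2 * pi) *: real_mx R (- l).
  by rewrite -scalerDr /s addrA subrr add0r real_mxN.
have [s0|s0] := eqVneq s 0.
  have yl : (2 * pi) *: y = (2 * pi) *: real_mx R (- l).
    by rewrite -ysl s0 scaler0 addr0.
  by rewrite ((G_eq0 QT Qpos ((2 * pi) *: y)).2 _) ?mulr0//; exists (- l).
have sS : s \in mask_digits by apply/mem_mask_digits.
rewrite m0E (bigD1_seq s)//= ?finmap.fset_uniq// ysl.
by rewrite ((G_eq0 QT Qpos ((2 * pi) *: real_mx R (- l))).2 _) ?mul0r//; exists (- l).
Qed.

End mask.

(** * The infinite product *)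

Section dynamics.
Context (R : realType) (d : nat) (Q U T : 'M[R]_d) (r : R).
Hypotheses (Qu : Q \in unitmx) (UU : U *m U^T = 1%:M)
  (TE : T = r *: (invmx Q *m U *m Q)) (r01 : 0 < r < 1).

Let r0 : 0 < r. Proof. by case/andP: r01. Qed.
Let r1 : r < 1. Proof. by case/andP: r01. Qed.

(** The norm in which [T] is [r] times an isometry. *)
Definition nu (x : 'cV[R]_d) : R := Num.sqrt (\sum_i (Q *m x) i ord0 ^+ 2).

Lemma nu_ge0 x : 0 <= nu x. Proof. exact: sqrtr_ge0. Qed.

Lemma sum_sq_mul (y : 'cV[R]_d) : \sum_i y i ord0 ^+ 2 = (y^T *m y) ord0 ord0.
Proof. by rewrite mxE; apply: eq_bigr => i _; rewrite mxE expr2. Qed.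

Lemma nu_T (x : 'cV[R]_d) : nu (T *m x) = r * nu x.
Proof.
rewrite /nu -[X in X * _](ger0_norm (ltW r0)) -sqrtr_sqr -sqrtrM ?sqr_ge0//; congr Num.sqrt.
have -> : Q *m (T *m x) = r *: (U *m (Q *m x)).
  by rewrite TE -scalemxAl -scalemxAr !mulmxA mulmxV// mul1mx.
rewrite mulr_sumr (eq_bigr (fun i => r ^+ 2 * (U *m (Q *m x)) i ord0 ^+ 2)); last first.
  by move=> i _; rewrite mxE exprMn.
rewrite -!mulr_sumr; congr (_ * _); rewrite !sum_sq_mul trmx_mul -mulmxA (mulmxA U^T).
by rewrite (mulmx1C UU) mul1mx.
Qed.

Lemma nu_Tn n (x : 'cV[R]_d) : nu (T ^+ n *m x) = r ^+ n * nu x.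
Proof.
elim: n => [|n IH]; first by rewrite !expr0 mul1mx mul1r.
by rewrite !exprS -mulmxE -mulmxA nu_T IH mulrA.
Qed.

Lemma coord_le_nu : exists2 C : R, 0 < C & forall (x : 'cV[R]_d) i, `|x i ord0| <= C * nu x.
Proof.
pose C := 1 + \sum_i \sum_j `|invmx Q i j|.
have C1 : 1 <= C by rewrite lerDl; apply: sumr_ge0 => i _; exact: sumr_ge0.
exists C; first exact: lt_le_trans C1.
move=> x i.
have xE : x = invmx Q *m (Q *m x) by rewrite mulmxA mulVmx// mul1mx.
have yn j : `|(Q *m x) j ord0| <= nu x.
  rewrite -sqrtr_sqr ler_wsqrtr// (bigD1 j)//= lerDl.
  by apply: sumr_ge0 => k _; exact: sqr_ge0.
rewrite [in X in X <= _]xE mxE (le_trans (ler_norm_sum _ _ _))//.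
apply: (@le_trans _ _ (\sum_j `|invmx Q i j| * nu x)).
  by apply: ler_sum => j _; rewrite normrM ler_wpM2l.
rewrite -mulr_suml ler_wpM2r ?nu_ge0//.
apply: (@le_trans _ _ (\sum_k \sum_j `|invmx Q k j|)); last by rewrite lerDr.
rewrite [leRHS](bigD1 i)//= lerDl.
by apply: sumr_ge0 => k _; exact: sumr_ge0.
Qed.

Lemma continuous_nu : continuous nu.
Proof.
have cl i : continuous (fun x : 'cV[R]_d => (Q *m x) i ord0).
  have -> : (fun x : 'cV[R]_d => (Q *m x) i ord0) = fun x => \sum_k Q i k * x k ord0.
    by apply/funext => x; rewrite mxE.
  move=> x; apply: (@cvg_sumr _ _ _ (nbhs x) (nbhs_filter x)) => k.
  by apply: cvgM; [exact: cvg_cst|exact: continuous_coord].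
move=> x; apply: (@continuous_comp _ _ _ (fun y => \sum_i (Q *m y) i ord0 ^+ 2) Num.sqrt).
  apply: (@cvg_sumr _ _ _ (nbhs x) (nbhs_filter x)) => i.
  exact: (cvgM (@cl i x) (@cl i x)).
exact: sqrt_continuous.
Qed.

Lemma blip_linear (f : 'cV[R]_d -> R) (M : 'M[R]_d) :
  bounded_lipschitz f -> bounded_lipschitz (fun x => f (M *m x)).
Proof.
move=> [C [fC fL]]; have C0 : 0 <= C by apply: le_trans (fC 0).
pose S := \sum_i \sum_k `|M i k|.
have S0 : 0 <= S by apply: sumr_ge0 => i _; exact: sumr_ge0.
exists (C * (1 + S)); split => [x|x y].
  by rewrite (le_trans (fC _))// ler_peMr// lerDl.
apply: le_trans (fL _ _) _; rewrite -mulrA ler_wpM2l//.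
apply: (@le_trans _ _ (S * dist1 x y)); last first.
  by rewrite ler_wpM2r ?dist1_ge0// lerDr.
rewrite /S mulr_suml; apply: ler_sum => i _.
have -> : (M *m y) i ord0 - (M *m x) i ord0 = \sum_k M i k * (y k ord0 - x k ord0).
  by rewrite !mxE -sumrB; apply: eq_bigr => k _; rewrite mulrBr.
rewrite (le_trans (ler_norm_sum _ _ _))// mulr_suml; apply: ler_sum => k _.
rewrite normrM ler_wpM2l// /dist1 (bigD1 k)//= lerDl; exact: sumr_ge0.
Qed.

Variable m0 : 'cV[R]_d -> R.
Hypotheses (m0_blip : bounded_lipschitz m0) (m0_pos : forall x, 0 <= m0 x) (m00 : m0 0 = 1).

Definition partial_phi n x : R := \prod_(1 <= j < n.+1) m0 (T ^+ j *m x).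
Local Notation p := partial_phi.

Lemma partial_phi0 x : p 0 x = 1.
Proof. by rewrite /p big_geq. Qed.

Lemma partial_phiS n x : p n.+1 x = p n x * m0 (T ^+ n.+1 *m x).
Proof. by rewrite /p big_nat_recr. Qed.

Lemma partial_phi_ge0 n x : 0 <= p n x.
Proof. by apply: prodr_ge0 => j _; exact: m0_pos. Qed.

Lemma Tn_add n k (x : 'cV[R]_d) : T ^+ (n + k) *m x = T ^+ k *m (T ^+ n *m x).
Proof. by rewrite addnC exprD -mulmxE mulmxA. Qed.

Lemma partial_phiD n k x : p (n + k) x = p n x * p k (T ^+ n *m x).
Proof.
elim: k => [|k IH]; first by rewrite addn0 partial_phi0 mulr1.
by rewrite addnS !partial_phiS IH -mulrA -addnS Tn_add.
Qed.

(** The mask is Lipschitz at the origin, where its value is [1]. *)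
Lemma m0_near1 : exists2 C : R, 0 < C & forall x, `|m0 x - 1| <= C * nu x.
Proof.
have [C [mC mL]] := m0_blip; have [D D0 xD] := coord_le_nu.
have C0 : 0 <= C by apply: le_trans (mC 0).
exists (1 + C * (d%:R * D)); first by rewrite ltr_wpDr// mulr_ge0// mulr_ge0// ltW.
move=> x; rewrite -[X in _ - X]m00; apply: le_trans (mL _ _) _.
have -> : (1 + C * (d%:R * D)) * nu x = nu x + C * (d%:R * D * nu x) by ring.
rewrite -[leLHS]add0r lerD ?nu_ge0// ler_wpM2l//.
apply: (@le_trans _ _ (\sum_(i < d) D * nu x)).
  by apply: ler_sum => i _; rewrite mxE subr0.
by rewrite sumr_const card_ord -[leLHS]mulr_natl mulrA.
Qed.

(** Since [m0 (T ^+ j *m x)] differs from [1] by at most [C * r ^+ j * nu x], the partial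
    products are at most [expR (C * nu x / (1 - r))] and their increments decay
    geometrically. *)
Lemma phi_limit : exists2 E : R -> R, (forall s t, 0 <= s -> s <= t -> 0 <= E s <= E t) &
  forall x, [/\ p n x @[n --> \oo] --> limn (p ^~ x),
     (forall n, p n x <= 1 + E (nu x)) &
     (forall n, `|limn (p ^~ x) - p n x| <= E (nu x) * nu x * r ^+ n)].
Proof.
have [C C0 mC] := m0_near1.
have s0 : 0 < 1 - r by rewrite subr_gt0.
pose B t := expR (C * t / (1 - r)).
have B0 t : 0 <= B t by exact: expR_ge0.
have Bm s t : s <= t -> B s <= B t.
  by move=> st; rewrite ler_expR ler_wpM2r ?invr_ge0 ?(ltW s0)// ler_wpM2l// ltW.
have pB n x : p n x <= expR (C * nu x * ((1 - r ^+ n) / (1 - r))).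
  elim: n => [|n IH]; first by rewrite partial_phi0 expr0 subrr mul0r mulr0 expR0.
  rewrite partial_phiS.
  have -> : C * nu x * ((1 - r ^+ n.+1) / (1 - r)) =
      C * nu x * ((1 - r ^+ n) / (1 - r)) + C * nu x * r ^+ n.
    by rewrite exprS; field; exact: lt0r_neq0.
  rewrite expRD ler_pM ?partial_phi_ge0//.
  apply: le_trans (expR_ge1Dx _).
  rewrite -lerBlDl (le_trans (ler_norm _))// (le_trans (mC _))// nu_Tn.
  rewrite exprS -!mulrA ler_wpM2l ?(ltW C0)// [leRHS]mulrC.
  by rewrite ler_piMl ?(ltW r1)// mulr_ge0 ?nu_ge0// exprn_ge0// ltW.
have pB' n x : p n x <= B (nu x).
  apply: le_trans (pB n x) _; rewrite ler_expR -!mulrA ler_wpM2l ?(ltW C0)//.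
  by rewrite ler_wpM2l ?nu_ge0// ler_piMl ?invr_ge0 ?(ltW s0)// gerBl exprn_ge0// ltW.
exists (fun t => B t * (1 + C / (1 - r))).
  have c0 : 0 <= 1 + C / (1 - r) by rewrite addr_ge0// divr_ge0 ?ltW.
  by move=> s t _ st; rewrite mulr_ge0//= ler_wpM2r// Bm.
move=> x.
have K0 : 0 <= B (nu x) * (C * nu x) by rewrite mulr_ge0// mulr_ge0 ?nu_ge0// ltW.
have r01' : 0 <= r < 1 by rewrite (ltW r0) r1.
have step n : `|p n.+1 x - p n x| <= B (nu x) * (C * nu x) * r ^+ n.
  rewrite partial_phiS -[X in _ - X]mulr1 -mulrBr normrM ger0_norm ?partial_phi_ge0//.
  rewrite -mulrA; apply: ler_pM => //; first exact: partial_phi_ge0.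
  apply: le_trans (mC _) _; rewrite nu_Tn -mulrA ler_wpM2l ?(ltW C0)// exprS mulrC.
  by rewrite ler_wpM2l ?nu_ge0// ler_piMl ?(ltW r1)// exprn_ge0// ltW.
have [l pl lp] := geometric_cauchy r01' K0 step.
have -> : limn (p ^~ x) = l by apply/cvg_lim.
split => // n.
  apply: le_trans (pB' n x) _; rewrite -[leLHS]add0r lerD// ler_peMr// lerDl.
  by rewrite divr_ge0 ?ltW.
apply: le_trans (lp n) _; rewrite ler_wpM2r ?exprn_ge0 ?(ltW r0)//.
rewrite mulrDr mulr1 mulrDl -[leLHS]add0r lerD//; first by rewrite mulr_ge0// nu_ge0.
rewrite le_eqVlt; apply/orP; left; apply/eqP; field; exact: lt0r_neq0.
Qed.

Definition phi x : R := limn (p ^~ x).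

Lemma phi_ge0 x : 0 <= phi x.
Proof.
have [E _ /(_ x)[c _ _]] := phi_limit; apply: limr_ge; first exact: cvgP c.
by apply: nearW => n; exact: partial_phi_ge0.
Qed.

Lemma phi_factor n (x : 'cV[R]_d) : phi x = p n x * phi (T ^+ n *m x).
Proof.
have [E _ Ex] := phi_limit; have [c _ _] := Ex x; have [c' _ _] := Ex (T ^+ n *m x).
have h1 : p (k + n)%N x @[k --> \oo] --> phi x by have := c; rewrite -(cvg_shiftn n).
have h2 := cvgnMl (c := p n x) c'.
apply: (cvg_unique _ h1) => //; apply: eq_cvg_trans h2.
by apply/funext => k; rewrite addnC partial_phiD.
Qed.

Lemma phi_bounded_ball t : 0 <= t -> exists2 D, 0 < D & forall x, nu x <= t -> phi x <= D.
Proof.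
have [E Em Ex] := phi_limit => t0.
have /andP[E0 _] := Em t t t0 (lexx t).
exists (1 + E t); first by rewrite ltr_wpDr.
move=> x xt; have [c pE _] := Ex x; apply: limr_le; first exact: cvgP c.
apply: nearW => n; apply: le_trans (pE n) _; rewrite lerD2l.
by have /andP[] := Em _ _ (nu_ge0 x) xt.
Qed.

(** On balls of [nu] the partial products, which are continuous, converge uniformly. *)
Lemma continuous_phi : continuous phi.
Proof.
have [E Em Ex] := phi_limit => x0.
apply/(@cvgrPdist_le _ _ _ (nbhs x0) (nbhs_filter x0)) => e e0.
pose t := nu x0 + 1.
have t0 : 0 <= t by rewrite addr_ge0// nu_ge0.
have /andP[Et0 _] := Em t t t0 (lexx t).
have e3 : 0 < e / 3 by rewrite divr_gt0.
have [n nP] : exists n, E t * t * r ^+ n <= e / 3.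
  have c : E t * t * r ^+ n @[n --> \oo] --> (0 : R).
    rewrite -[X in _ --> X](mulr0 (E t * t)); apply: cvgnMl.
    by apply: cvg_expr; rewrite ger0_norm ?(ltW r0).
  move/cvgrPdist_le : c => /(_ _ e3)[N _ NP]; exists N.
  have := NP N (leqnn N); rewrite sub0r normrN; apply: le_trans; exact: ler_norm.
have bnd x : nu x <= t -> `|phi x - p n x| <= e / 3.
  move=> xt; have [_ _ /(_ n) h] := Ex x; apply: le_trans h _; apply: le_trans nP.
  rewrite ler_wpM2r ?exprn_ge0 ?(ltW r0)//.
  have /andP[a b] := Em _ _ (nu_ge0 x) xt; rewrite ler_pM//; exact: nu_ge0.
have pn : continuous (p n).
  by apply: blip_continuous; apply: blip_prod => j; exact: blip_linear.
have pnx := pn x0; move/(@cvgrPdist_le _ _ _ (nbhs x0) (nbhs_filter x0)) : pnx => /(_ _ e3) A1.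
have cn := @continuous_nu x0.
move/(@cvgrPdist_le _ _ _ (nbhs x0) (nbhs_filter x0)) : cn => /(_ _ ltr01) A2.
apply: (@filterS2 _ (nbhs x0) (nbhs_filter x0) _ _ _ _ A1 A2) => x h1 h2.
have xt : nu x <= t.
  by move: h2; rewrite distrC ler_norml => /andP[_]; rewrite lerBlDl.
have b1 := bnd x xt; have b2 := bnd x0 (_ : nu x0 <= t).
have {}b2 : `|phi x0 - p n x0| <= e / 3 by apply: b2; rewrite lerDl.
have -> : phi x0 - phi x = (phi x0 - p n x0) + (p n x0 - p n x) + (p n x - phi x) by ring.
rewrite (le_trans (ler_normD _ _))// (_ : e = e / 3 + e / 3 + e / 3); last by field.
rewrite lerD ?(distrC (p n x) (phi x))//.
by rewrite (le_trans (ler_normD _ _))// lerD.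
Qed.

(** For [n] large, [T ^+ n *m x] is so close to the origin that the value of [phi] there
    is at distance less than [1] from [1]; the first [n] factors do not vanish. *)
Lemma phi_gt0 (x : 'cV[R]_d) : (forall j, (0 < j)%N -> m0 (T ^+ j *m x) != 0) -> 0 < phi x.
Proof.
have [E Em Ex] := phi_limit => mx.
pose K := E (nu x) * nu x.
have [n nP] : exists n, K * r ^+ n < 1.
  have c : K * r ^+ n @[n --> \oo] --> (0 : R).
    rewrite -[X in _ --> X](mulr0 K); apply: cvgnMl.
    by apply: cvg_expr; rewrite ger0_norm ?(ltW r0).
  move/cvgrPdist_lt : c => /(_ _ ltr01)[N _ NP]; exists N.
  have := NP N (leqnn N); rewrite sub0r normrN; apply: le_lt_trans; exact: ler_norm.
have rn1 : r ^+ n <= 1 by rewrite exprn_ile1 ?ltW.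
have yx : nu (T ^+ n *m x) <= nu x by rewrite nu_Tn ler_piMl// nu_ge0.
have /andP[Ey0 Eyx] := Em _ _ (nu_ge0 (T ^+ n *m x)) yx.
rewrite (phi_factor n); apply: mulr_gt0.
  rewrite lt_neqAle partial_phi_ge0 andbT eq_sym.
  rewrite /p prodf_seq_neq0; apply/allP => j; rewrite mem_index_iota => /andP[j1 _].
  exact: mx.
have [_ _ /(_ 0)] := Ex (T ^+ n *m x); rewrite expr0 mulr1 partial_phi0 => h.
have h2 : E (nu (T ^+ n *m x)) * nu (T ^+ n *m x) < 1.
  apply: le_lt_trans nP; rewrite nu_Tn mulrCA [leRHS]mulrC ler_wpM2l ?exprn_ge0 ?(ltW r0)//.
  by rewrite ler_wpM2r ?nu_ge0// -nu_Tn.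
have := le_lt_trans h h2; rewrite -/(phi _) ltr_norml => /andP[+ _].
by rewrite ltrBrDl subrr.
Qed.

(** The inequality on [m0] and [g] telescopes along the orbit of [x]. *)
Lemma partial_phi_decay (g : 'cV[R]_d -> R) (b : R) n (x : 'cV[R]_d) :
  (forall y, m0 (T *m y) * g (T *m y) <= b * g y) -> 0 <= b ->
  p n x * g (T ^+ n *m x) <= b ^+ n * g x.
Proof.
move=> mg b0; elim: n => [|n IH]; first by rewrite partial_phi0 !expr0 mul1mx.
have -> : T ^+ n.+1 *m x = T *m (T ^+ n *m x) by rewrite exprS -mulmxE mulmxA.
rewrite partial_phiS {1}exprS -mulmxE -mulmxA -mulrA.
apply: (@le_trans _ _ (p n x * (b * g (T ^+ n *m x)))).
  by rewrite ler_wpM2l// partial_phi_ge0.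
by rewrite mulrCA exprS -mulrA ler_wpM2l.
Qed.

Section decay.
Variables (g : 'cV[R]_d -> R) (b : R).
Hypotheses (g_blip : bounded_lipschitz g)
  (g_gt0 : forall x : 'cV[R]_d, (forall i, `|x i ord0| <= pi) -> x != 0 -> 0 < g x)
  (mg : forall y : 'cV[R]_d, m0 (T *m y) * g (T *m y) <= b * g y) (b0 : 0 < b).

Lemma nu0 : nu 0 = 0.
Proof. by rewrite /nu big1 ?sqrtr0// => i _; rewrite mulmx0 mxE expr0n. Qed.

(** Let [n] be the first time at which the orbit of [x] is in the ball [nu < delta]. For
    [n] positive the orbit is then in the annulus [r * delta <= nu < delta], where [g] is
    bounded below, so that [partial_phi_decay] bounds the first [n] factors; the
    remaining ones are bounded on the ball. *)
Lemma phi_decay : exists2 D, 0 < D & forall x : 'cV[R]_d,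
  exists n, phi x <= D * b ^+ n /\ forall i, `|x i ord0| <= pi * (r^-1) ^+ n.
Proof.
have [C C0 xC] := coord_le_nu; have [Gm [gG _]] := g_blip.
(* The ball [nu <= delta] lies in the cube [|x i| <= pi], where [g] is positive away
   from the origin. *)
pose delta := pi / C : R.
have d0 : 0 < delta by rewrite divr_gt0// pi_gt0.
have [E E0 phiE] := phi_bounded_ball (ltW d0).
have [g0 g00 gmin] : exists2 c, 0 < c & forall x : 'cV[R]_d,
    (forall i, `|x i ord0| <= pi) -> r * delta <= nu x -> c <= g x.
  apply: positive_min; [exact: blip_continuous|exact: continuous_nu|].
  move=> x xpi nx; apply: g_gt0 => //; apply: contraTneq nx => ->.
  by rewrite nu0 -ltNge mulr_gt0.
have Gm0 : 0 <= Gm by apply: le_trans (gG 0).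
have small (x : 'cV[R]_d) : exists n, r ^+ n * nu x < delta.
  have c : nu x * r ^+ n @[n --> \oo] --> (0 : R).
    rewrite -[X in _ --> X](mulr0 (nu x)); apply: cvgnMl.
    by apply: cvg_expr; rewrite ger0_norm ?(ltW r0).
  move/cvgrPdist_lt : c => /(_ _ d0)[N _ NP]; exists N; rewrite mulrC.
  have := NP N (leqnn N); rewrite sub0r normrN; apply: le_lt_trans; exact: ler_norm.
exists (E + Gm / g0 * E).
  by rewrite ltr_wpDr// mulr_ge0 ?(ltW E0)// divr_ge0// ltW.
move=> x; have [n nx nmin] := ex_minnP (small x).
have rn0 k : 0 < r ^+ k by rewrite exprn_gt0.
have yd : nu (T ^+ n *m x) <= delta by rewrite nu_Tn ltW.
exists n; split; last first.
  move=> i; apply: le_trans (xC x i) _.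
  have -> : pi * r^-1 ^+ n = C * (delta * (r ^+ n)^-1) by rewrite exprVn /delta; field; rewrite !lt0r_neq0.
  by rewrite ler_wpM2l ?(ltW C0)// ler_pdivlMr// mulrC ltW.
rewrite mulrDl; case: n nx nmin yd => [|n] nx nmin yd.
  rewrite expr0 !mulr1 -[leLHS]addr0 lerD ?mulr_ge0 ?invr_ge0 ?(ltW E0) ?(ltW g00)//.
  by move: yd; rewrite expr0 mul1mx => /phiE.
rewrite -[leLHS]add0r lerD ?mulr_ge0 ?exprn_ge0 ?(ltW E0) ?(ltW b0)//.
have yl : r * delta <= nu (T ^+ n.+1 *m x).
  rewrite nu_Tn exprS -mulrA ler_wpM2l ?(ltW r0)// leNgt; apply/negP => /nmin.
  by rewrite ltnn.
have ypi i : `|(T ^+ n.+1 *m x) i ord0| <= pi.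
  apply: le_trans (xC _ i) _; apply: (@le_trans _ _ (C * delta)).
    by rewrite ler_wpM2l// ltW.
  by rewrite /delta mulrCA mulfV ?mulr1// lt0r_neq0.
have gy := gmin _ ypi yl.
have := partial_phi_decay n.+1 x mg (ltW b0) => dec.
have pb : p n.+1 x <= Gm / g0 * b ^+ n.+1.
  rewrite mulrAC ler_pdivlMr//.
  apply: (@le_trans _ _ (p n.+1 x * g (T ^+ n.+1 *m x))).
    by rewrite ler_wpM2l// partial_phi_ge0.
  apply: le_trans dec _; rewrite mulrC ler_wpM2r ?exprn_ge0 ?(ltW b0)//.
  by apply: le_trans (gG x); exact: ler_norm.
rewrite (phi_factor n.+1) mulrAC.
apply: ler_pM => //; [exact: partial_phi_ge0|exact: phi_ge0|exact: phiE].
Qed.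

End decay.

End dynamics.

(** * Decay and positivity for the elliptic mask *)

Section elliptic.
Context (R : realType) (d m : nat) (A : 'M[int]_d) (Q : 'M[R]_d).
Hypotheses (d_gt0 : (0 < d)%N) (m_gt0 : (0 < m)%N)
  (isoA : isotropic_dilation R A) (factQ : isotropy_factor A Q)
  (supB : (ereal_sup (range (fun xi : 'cV[R]_d => (mu A Q xi)%:E))
             < (absdet R A `^ (2 / d%:R - 1 / (2 * m%:R)))%:E)%E).

Local Notation T := (invT R A).
Local Notation q := (absdet R A).
Let r := q `^ (- (d%:R^-1)).

Let q1 : 1 < q. Proof. by have [] := isotropic_det d_gt0 isoA. Qed.
Let q0 : 0 < q. Proof. exact: lt_trans ltr01 q1. Qed.
Let Au : real_mx R A \in unitmx. Proof. by have [] := isotropic_det d_gt0 isoA. Qed.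
Let QT : Q^T = Q. Proof. by have [] := factQ. Qed.
Let Qpos (x : 'cV[R]_d) : x != 0 -> 0 < (x^T *m Q *m x) ord0 ord0.
Proof. by have [_ h _] := factQ; exact: h. Qed.

Lemma absdet_powR_lt1 (s : R) : s < 0 -> q `^ s < 1.
Proof.
move=> s0; rewrite -[s]opprK powRN invf_lt1 ?powR_gt0//.
have s0' : 0 < - s by rewrite oppr_gt0.
have := @gt0_ltr_powR _ _ s0' 1 q; rewrite !nnegrE ler01 (ltW q0) powR1.
exact.
Qed.

Lemma dilation_rate : 0 < r < 1.
Proof.
rewrite powR_gt0//= absdet_powR_lt1// oppr_lt0 invr_gt0 ltr0n.
exact: d_gt0.
Qed.

Lemma powR_root (n : nat) : (0 < n)%N -> (q `^ (- (n%:R^-1))) ^+ n = q^-1.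
Proof.
move=> n0; rewrite -powR_mulrn ?powR_ge0// -powRrM mulNr mulVf ?pnatr_eq0 -?lt0n//.
by rewrite powR_inv1// ltW.
Qed.

(** Outside the lattice this is the bound on [mu]; on the lattice both sides vanish. *)
Lemma numerator_bound : exists2 b : R, 0 < b < q `^ (- ((2 * m)%:R^-1)) &
  forall y : 'cV[R]_d, m0 A Q (T *m y) * G Q (T *m y) <= b * G Q y.
Proof.
set b1 := q `^ _; have b10 : 0 < b1 by exact: powR_gt0.
have := supB; set S := ereal_sup _ => SB0.
have muS (x : 'cV[R]_d) : ((mu A Q x)%:E <= S)%E by apply: ereal_sup_ubound; exists x.
have [B SB] : exists B : R, S = B%:E.
  by move: (muS 0) SB0; case: S {muS} => [B| |]//; exists B.
rewrite SB lte_fin in SB0.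
have q20 : 0 < q `^ (2 / d%:R) by exact: powR_gt0.
have Bb : (q `^ (2 / d%:R))^-1 * B < b1.
  rewrite mulrC ltr_pdivrMr// (lt_le_trans SB0)// /b1 -powRD; last first.
    by apply/implyP => _; exact: lt0r_neq0.
  by rewrite addrC natrM mul1r.
(* The maximum with [b1 / 2] keeps the constant positive. *)
exists (Num.max ((q `^ (2 / d%:R))^-1 * B) (b1 / 2)).
  rewrite lt_max gt_max Bb orbC divr_gt0//=.
  by rewrite ltr_pdivrMr// ltr_pMr// ltr1n.
move=> y; have [yl|yl] := pselect (two_pi_lattice y).
  rewrite (numerator_lattice Au QT Qpos yl); apply: mulr_ge0; last exact: G_ge0.
  by rewrite le_max orbC divr_ge0// ltW.
have Gy := G_gt0 QT Qpos yl.
apply: (@le_trans _ _ ((q `^ (2 / d%:R))^-1 * B * G Q y)); last first.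
  by rewrite ler_wpM2r ?(ltW Gy)// le_max lexx.
have := muS y; rewrite SB lee_fin /mu asboolF// /mu_quotient ler_pdivrMr//.
by rewrite -mulrA -ler_pdivlMl// mulrA.
Qed.

Lemma two_pi_lattice_small (x : 'cV[R]_d) :
  two_pi_lattice x -> (forall i, `|x i ord0| <= pi) -> x = 0.
Proof.
move=> [k ->] kpi; suff -> : k = 0.
  by apply/matrixP => i j; rewrite !mxE mulr0.
apply/matrixP => i j; rewrite (ord1 j) mxE; apply/eqP; rewrite -absz_eq0 -leqn0 -ltnS.
have := kpi i; rewrite !mxE normrM ger0_norm ?mulr_ge0 ?pi_ge0// mulrAC -[leRHS]mul1r.
rewrite ler_pM2r ?pi_gt0// -intr_norm -natr_absz mulrC -natrM.
by rewrite (_ : 1 = 1%:R :> R)// ler_nat muln2; case: `|_|%N.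
Qed.

(** The lattice is stable under [A^T], the inverse of [T]. *)
Lemma two_pi_lattice_Tn n (x : 'cV[R]_d) : two_pi_lattice (T ^+ n *m x) -> two_pi_lattice x.
Proof.
elim: n => [|n IH]; first by rewrite expr0 mul1mx.
have -> : T ^+ n.+1 *m x = T *m (T ^+ n *m x) by rewrite exprS -mulmxE mulmxA.
move/(@lattice_mulT R d A); rewrite mulmxA (invT_mul Au) mul1mx.
exact: IH.
Qed.

Let m0_blip := @blip_m0 R d A Q Au.
Let m0_pos := @m0_ge0 R d A Q Au QT Qpos.
Let m00 := @m0_0 R d A Q Au QT Qpos.

Lemma phi_hat_gt0 (x : 'cV[R]_d) : (forall i, `|x i ord0| <= pi) -> 0 < phi_hat A Q x.
Proof.
have [_ _ [U [UU TE]]] := factQ => xpi.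
apply: (phi_gt0 (Q_unit QT Qpos) UU TE dilation_rate) => // -[//|j] _.
apply/eqP => mz; have xl : two_pi_lattice x.
  apply: (@two_pi_lattice_Tn j); apply: (m0_eq0 Au QT Qpos).
  by rewrite mulmxA mulmxE -exprS.
move: mz; rewrite (two_pi_lattice_small xl xpi) mulmx0 m00 => /eqP.
by rewrite oner_eq0.
Qed.

Lemma continuous_phi_hat : continuous (phi_hat A Q : 'cV[R]_d -> R).
Proof.
have [_ _ [U [UU TE]]] := factQ.
exact: (continuous_phi (Q_unit QT Qpos) UU TE dilation_rate).
Qed.

Lemma phi_hat_ge0 (x : 'cV[R]_d) : 0 <= phi_hat A Q x.
Proof.
have [_ _ [U [UU TE]]] := factQ.
exact: (phi_ge0 (Q_unit QT Qpos) UU TE dilation_rate).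
Qed.

(** The hypothesis on the supremum of [mu] makes [b ^+ (2 * m)] smaller than the
    reciprocal of [r^-1 ^+ d], the growth rate of the volumes of the cubes. *)
Lemma phi_hat_decay : exists b D : R, [/\ 0 < b <= 1, 0 < D, b ^+ (2 * m) * (r^-1) ^+ d < 1 &
  forall x : 'cV[R]_d, exists n, phi_hat A Q x <= D * b ^+ n /\
    forall i, `|x i ord0| <= pi * (r^-1) ^+ n].
Proof.
have [_ _ [U [UU TE]]] := factQ.
have [b /andP[b0 bq] mg] := numerator_bound.
have m2 : (0 < 2 * m)%N by rewrite muln_gt0.
have Gpos (x : 'cV[R]_d) : (forall i, `|x i ord0| <= pi) -> x != 0 -> 0 < G Q x.
  move=> xpi x0; apply: G_gt0 => // xl; move/eqP : x0; apply.
  exact: two_pi_lattice_small.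
have [D D0 DP] := phi_decay (Q_unit QT Qpos) UU TE dilation_rate m0_blip m0_pos m00
  (blip_G Q) Gpos mg b0.
exists b, D; split => //.
  rewrite b0 ltW// (lt_trans bq)// absdet_powR_lt1// oppr_lt0 invr_gt0 ltr0n.
  exact: m2.
rewrite exprVn powR_root// invrK -ltr_pdivlMr// mul1r -(powR_root m2).
by rewrite ltrXn2r ?(ltW b0)// -lt0n.
Qed.

Lemma phi_hat_riesz : exists f : 'cV[R]_d -> R[i],
  [/\ L2 f,
      forall g, nice (fun x => complex.Re (g x)) -> nice (fun x => complex.Im (g x)) ->
        function_distribution f (fourier g) =
        function_distribution (fun xi => (phi_hat A Q xi ^+ m)%:C%C) g &
      riesz_basis (closed_span (integer_shifts f)) (integer_shifts f)].
Proof.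
have [b [D [/andP[b0 b1] D0 bq dec]]] := phi_hat_decay.
have /andP[r0 r1] := dilation_rate.
have D2 : 0 < D ^+ (2 * m) by rewrite exprn_gt0.
(* [L n] is an integer between [r^-1 ^+ n] and its double, so that the cube of [L n]
   periods has volume at most [(4 * pi * r^-1 ^+ n) ^+ d]. *)
pose a n := D ^+ (2 * m) * (b ^+ (2 * m)) ^+ n.
pose L n := (Num.truncn (r^-1 ^+ n)).+1.
have rn0 n : 0 <= r^-1 ^+ n by rewrite exprn_ge0// invr_ge0 ltW.
have rn1 n : 1 <= r^-1 ^+ n by rewrite exprn_ege1// invf_ge1// ltW.
have La n : r^-1 ^+ n <= (L n)%:R by apply/ltW; exact: truncnS_gt.
have Lb n : (L n)%:R <= 2 * r^-1 ^+ n.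
  by rewrite /L -natr1 mulr_natl mulr2n lerD// truncn_le.
have [c c0 cP] : exists2 c : R, 0 < c &
    forall x : 'cV[R]_d, (forall i, `|x i ord0| <= pi) -> 0 <= (0 : R) -> c <= phi_hat A Q x.
  apply: (positive_min (g := fun=> 0)); [exact: continuous_phi_hat|exact: cst_continuous|].
  by move=> x xpi _; exact: phi_hat_gt0.
have bm0 : 0 <= b ^+ (2 * m) by rewrite exprn_ge0// ltW.
apply: (@riesz_inverse_transform R d (fun x => phi_hat A Q x ^+ m) (D ^+ m) a L
  (D ^+ (2 * m) * (4 * pi) ^+ d) (b ^+ (2 * m) * (r^-1) ^+ d) (c ^+ (2 * m))).
- move=> x; apply: (@continuous_comp _ _ _ (phi_hat A Q) (fun t => t ^+ m)).
    exact: continuous_phi_hat.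
  exact: exprn_continuous.
- move=> x; have [n [xb _]] := dec x.
  rewrite ger0_norm ?exprn_ge0 ?phi_hat_ge0// lerXn2r ?nnegrE ?phi_hat_ge0 ?(ltW D0)//.
  by rewrite (le_trans xb)// ler_piMr ?(ltW D0)// exprn_ile1// ltW.
- by rewrite mulr_gt0// exprn_gt0// mulr_gt0// pi_gt0.
- by rewrite bq andbT mulr_ge0.
- by move=> n; rewrite mulr_ge0 ?exprn_ge0// ltW.
- move=> n; rewrite [X in _ <= X](_ : _ = a n * (4 * pi * r^-1 ^+ n) ^+ d); last first.
    by rewrite /a (exprMn _ (b ^+ (2 * m))) (exprAC r^-1) (exprMn _ (4 * pi)); ring.
  apply: ler_wpM2l; first by rewrite mulr_ge0 ?exprn_ge0// ltW.
  rewrite lerXn2r ?nnegrE ?mulr_ge0 ?pi_ge0//.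
  have -> : 4 * pi * r^-1 ^+ n = 2 * pi * (2 * r^-1 ^+ n) by ring.
  by rewrite ler_wpM2l// mulr_ge0// pi_ge0.
- move=> x; have [n [xb xi]] := dec x; exists n.
  rewrite cube_in => [|i]; last by apply: le_trans (xi i) _; rewrite ler_wpM2l ?pi_ge0.
  rewrite mulr1 -exprM (mulnC m) (_ : a n = (D * b ^+ n) ^+ (2 * m)); last first.
    by rewrite /a exprMn (exprAC b).
  by rewrite lerXn2r ?nnegrE ?phi_hat_ge0 ?mulr_ge0 ?exprn_ge0 ?(ltW D0) ?(ltW b0).
- by rewrite exprn_gt0.
- move=> x xpi; rewrite -exprM (mulnC m) lerXn2r ?nnegrE ?phi_hat_ge0 ?(ltW c0)//.
  exact: cP.
Qed.

End elliptic.

Theorem mainTheorem3 (R : realType) (d m : nat) (A : 'M[int]_d) (Q : 'M[R]_d)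
    (d_gt0 : (0 < d)%N) (m_gt0 : (0 < m)%N)
    (isoA : isotropic_dilation R A) (factQ : isotropy_factor A Q)
    (supB : (ereal_sup (range (fun xi : 'cV[R]_d => (mu A Q xi)%:E))
               < (absdet R A `^ (2 / d%:R - 1 / (2 * m%:R)))%:E)%E) :
  exists f : 'cV[R]_d -> R[i],
    [/\ L2 f,
        elliptic_scaling_function A Q m (function_distribution f)
      & riesz_basis (closed_span (integer_shifts f)) (integer_shifts f)].
Proof.
have [f [f2 fp fr]] := phi_hat_riesz d_gt0 m_gt0 isoA factQ supB.
exists f; split => //; split; first exact: L2_tempered.
move=> g /schwartz_nice[gR gI]; exact: fp.
Qed.
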